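(* Let $n\ge 2$. Suppose that for every $p$ with $1<p\le n/(n-1)$ and $p<n$, for every integer $m\ge 1$ and every $\Omega\in C^1(S^{n-1},\mathbb{R}^m)$, the operator $A_\Omega^*: L^p(\mathbb{R}^n,\mathbb{R}^m)\to\dot W^{1,p}(\mathbb{R}^n)$ is bounded, i.e. there is a constant $C>0$ such that $A_\Omega^* f\in \dot W^{1,p}(\mathbb{R}^n)$ and $\|A_\Omega^* f\|_{\dot W^{1,p}}\le C\|f\|_p$ for all $f\in L^p(\mathbb{R}^n,\mathbb{R}^m)$. Then for every $p$ with $1<p\le n/(n-1)$ and $p<n$ the spherical maximal operator $\mathcal{S}:W^{1,p}(\mathbb{R}^n)\to\dot W^{1,p}(\mathbb{R}^n)$ is bounded, i.e. there is a constant $C'>0$ such that $\mathcal{S}f\in\dot W^{1,p}(\mathbb{R}^n)$ and $\|\mathcal{S}f\|_{\dot W^{1,p}}\le C'\|f\|_{1,p}$ for all $f\in W^{1,p}(\mathbb{R}^n)$.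
   Context: $S^{n-1}$ is the unit sphere in $\mathbb{R}^n$ and $S^{n-1}(x,t)$ is the sphere with center $x$ and radius $t$; $\sigma$ is surface measure and $\omega_n$ is the volume of the unit ball in $\mathbb{R}^n$. For $\Omega=(\Omega_1,\ldots,\Omega_m)\in C^1(S^{n-1},\mathbb{R}^m)$ put $\tilde K(x)=\Omega(x/|x|)/|x|^{n-1}$ for $x\ne0$, and for $f\in L^p(\mathbb{R}^n,\mathbb{R}^m)$ put $$A_\Omega^* f(x)=\sup_{t>0}\left|\int_{|x-z|\ge t} f(z)\cdot\tilde K(x-z)\,dz\right|.$$ The spherical maximal operator is $$\mathcal{S}f(x)=\sup_{t>0}\frac{1}{n\omega_n t^{n-1}}\int_{S^{n-1}(x,t)}|f(z)|\,d\sigma(z),$$ where for $f\in W^{1,1}_{\rm loc}(\mathbb{R}^n)$ the values of $f$ on the sphere $S^{n-1}(x,t)$ are understood in the sense of traces, so the integral is well defined and finite for every $x\in\mathbb{R}^n$ and $t>0$. $W^{1,p}(\mathbb{R}^n)$ is the Sobolev space of $f\in L^p$ with distributional gradient $\nabla f\in L^p$, with norm $\|f\|_{1,p}=\|f\|_p+\|\nabla f\|_p$. For $1<p<n$ let $p^*=np/(n-p)$; the homogeneous Sobolev space $\dot W^{1,p}(\mathbb{R}^n)$ consists of all $g\in L^{p^*}(\mathbb{R}^n)$ with distributional gradient $\nabla g\in L^p$, with norm $\|g\|_{\dot W^{1,p}}=\|g\|_{p^*}+\|\nabla g\|_p$. *)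

(* Defs.v *)
From HB Require Import structures.
From mathcomp Require Import all_boot all_order all_algebra.
From mathcomp Require Import all_classical all_reals all_analysis.
From mathcomp Require Import measurable_realfun measurable_fun_approximation.

Set Implicit Arguments.
Unset Strict Implicit.
Unset Printing Implicit Defensive.
Import Order.TTheory GRing.Theory Num.Theory.
Import numFieldNormedType.Exports.

Local Open Scope classical_set_scope.
Local Open Scope ring_scope.

(* 'rV[R]_n carries the sigma-algebra generated by the coordinates; it is the
   Borel sigma-algebra, because the topology of R is second countable. *)
Definition rV_display : measure_display. Proof. exact. Qed.

Section measurable_rV.
Variables (R : realType) (n : nat).

Let coord (i : 'I_n) (x : 'rV[R]_n) : R := x ord0 i.

Let rV_set0 : g_sigma_preimage coord set0.
Proof. exact: sigma_algebra0. Qed.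

Let rV_setC A : g_sigma_preimage coord A -> g_sigma_preimage coord (~` A).
Proof. exact: sigma_algebraC. Qed.

Let rV_bigcup (F : (set 'rV[R]_n)^nat) :
  (forall i, g_sigma_preimage coord (F i)) ->
  g_sigma_preimage coord (\bigcup_i (F i)).
Proof. exact: sigma_algebra_bigcup. Qed.

HB.instance Definition _ := @isMeasurable.Build rV_display
  'rV[R]_n (g_sigma_preimage coord) rV_set0 rV_setC rV_bigcup.

Lemma measurable_coord (i : 'I_n) :
  measurable_fun [set: 'rV[R]_n] (fun x : 'rV[R]_n => x ord0 i).
Proof.
move=> _ Y mY; rewrite setTI; apply: sub_sigma_algebra => /=.
rewrite -bigcup_seq/=; exists i => /=; first by rewrite mem_index_enum.
by exists Y => //; rewrite setTI.
Qed.
End measurable_rV.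

Lemma measurable_fun_rVP (R : realType) d (T : measurableType d) n
    (f : T -> 'rV[R]_n) :
  (forall i, measurable_fun [set: T] (fun x => f x ord0 i)) ->
  measurable_fun [set: T] f.
Proof.
move=> mf.
suff H : g_sigma_preimage (fun (i : 'I_n) (x : T) => f x ord0 i) `<=` measurable.
  move=> _ A mA; apply: H.
  rewrite (_ : (fun i x => f x ord0 i) = (fun i => (fun x : 'rV[R]_n => x ord0 i) \o f))//.
  by rewrite (g_sigma_preimage_comp (fun (i : 'I_n) (x : 'rV[R]_n) => x ord0 i)); exists A.
apply: smallest_sub; first exact: sigma_algebra_measurable.
rewrite -bigcup_seq; apply: bigcup_sub => i _.
by move=> A [B mB <-]; exact: mf.
Qed.

Section lebesgue_rV.
Variable R : realType.

Definition rV_cons n (xv : measurableTypeR R * 'rV[R]_n) : 'rV[R]_n.+1 :=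
  \row_i (if unlift ord0 i is Some j then xv.2 ord0 j else xv.1).

Definition rV_uncons n (v : 'rV[R]_n.+1) : measurableTypeR R * 'rV[R]_n :=
  (v ord0 ord0, \row_j v ord0 (lift ord0 j)).

Lemma rV_consK n : cancel (@rV_cons n) (@rV_uncons n).
Proof.
move=> [x v]; congr (_, _); first by rewrite mxE unlift_none.
by apply/rowP => j; rewrite !mxE liftK.
Qed.

Lemma measurable_rV_cons n : measurable_fun [set: measurableTypeR R * 'rV[R]_n] (@rV_cons n).
Proof.
apply: measurable_fun_rVP => i.
case: (unliftP ord0 i) => [j|] ->.
  rewrite (_ : (fun _ => _) = (fun v : 'rV[R]_n => v ord0 j) \o snd); last first.
    by apply/funext => -[x v] /=; rewrite mxE liftK.
  by apply: measurableT_comp => //; exact: measurable_coord.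
rewrite (_ : (fun _ => _) = fst) //.
by apply/funext => -[x v] /=; rewrite mxE unlift_none.
Qed.

Lemma measurable_rV_uncons n :
  measurable_fun [set: 'rV[R]_n.+1] (@rV_uncons n).
Proof.
apply/measurable_fun_pairP; split; first exact: (@measurable_coord R n.+1).
apply: measurable_fun_rVP => i /=.
by under eq_fun do rewrite mxE; exact: measurable_coord.
Qed.

Section step.
Variables (n : nat) (m1 : {sigma_finite_measure set (measurableTypeR R) -> \bar R}).
Variable m : {sigma_finite_measure set 'rV[R]_n -> \bar R}.

Definition rV_prod_measure : set 'rV[R]_n.+1 -> \bar R :=
  pushforward (m1 \x m)%E (@rV_cons n).

Let mcons := @measurable_rV_cons n.
#[local] Hint Resolve mcons : core.

Let step0 : rV_prod_measure set0 = 0%E.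
Proof. exact: measure0. Qed.

Let step_ge0 A : (0 <= rV_prod_measure A)%E.
Proof. exact: measure_ge0. Qed.

Let step_sigma_additive : semi_sigma_additive rV_prod_measure.
Proof. exact: measure_semi_sigma_additive. Qed.

HB.instance Definition _ := isMeasure.Build _ _ _ rV_prod_measure
  step0 step_ge0 step_sigma_additive.

Let step_sigma_finite : sigma_finite setT rV_prod_measure.
Proof.
have /sigma_finiteP[F [TF ndF Foo]] := sigma_finiteT m1.
have /sigma_finiteP[G [TG ndG Goo]] := sigma_finiteT m.
exists (fun k => @rV_uncons n @^-1` (F k `*` G k)) => [|k].
  rewrite -preimage_bigcup (_ : \bigcup_k _ = setT) ?preimage_setT//.
  rewrite -subTset => -[x y] _.
  have [i _ Fx] : (\bigcup_k F k) x by rewrite -TF.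
  have [j _ Gy] : (\bigcup_k G k) y by rewrite -TG.
  exists (maxn i j) => //; split => /=.
  - by move: x Fx; exact/subsetPset/ndF/leq_maxl.
  - by move: y Gy; exact/subsetPset/ndG/leq_maxr.
have [mF Fk] := Foo k; have [mG Gk] := Goo k.
have mFG : measurable (F k `*` G k) by exact: measurableX.
split; first by rewrite -[X in measurable X]setTI; exact: measurable_rV_uncons.
rewrite /rV_prod_measure /pushforward -comp_preimage.
rewrite (_ : _ \o _ = id); last by apply/funext => x /=; rewrite rV_consK.
by rewrite preimage_id product_measure1E// lte_mul_pinfty// ge0_fin_numE.
Qed.

HB.instance Definition _ := Measure_isSigmaFinite.Build _ _ _ rV_prod_measure
  step_sigma_finite.
End step.

Fixpoint lebesgue_rV n : {sigma_finite_measure set 'rV[R]_n -> \bar R} :=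
  if n is n'.+1 then rV_prod_measure lebesgue_measure (lebesgue_rV n') else \d_(0 : 'rV[R]_0).

Lemma lebesgue_rV_prod n (A : 'I_n -> set (measurableTypeR R)) : (forall i, measurable (A i)) ->
  lebesgue_rV n [set x | forall i, A i (x ord0 i)] =
  (\prod_(i < n) lebesgue_measure (A i))%E.
Proof.
elim: n A => [|n IH] A mA.
  by rewrite big_ord0 /= diracE mem_set// => -[].
have mB : measurable [set x : 'rV[R]_n | forall i, A (lift ord0 i) (x ord0 i)].
  rewrite (_ : [set _ | _] = \bigcap_(i in [set: 'I_n])
      [set x : 'rV[R]_n | A (lift ord0 i) (x ord0 i)]).
    apply: fin_bigcap_measurable => // i _.
    rewrite -[X in measurable X]setTI.
    by apply: (@measurable_coord R n i) => //; exact: mA.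
  by apply/seteqP; split => x /= h; [move=> i _|move=> i]; exact: h.
rewrite big_ord_recl -(IH (fun i => A (lift ord0 i)))//.
rewrite -product_measure1E// /= /rV_prod_measure /pushforward.
congr product_measure1; apply/seteqP; split => -[x v] /=.
  move=> h; split => [|i].
    by have := h ord0; rewrite mxE unlift_none.
  by have := h (lift ord0 i); rewrite mxE liftK.
move=> [Ax Av] i; rewrite mxE.
by case: (unliftP ord0 i) => [j|] ->.
Qed.

End lebesgue_rV.

Section euclidean.
Variables (R : realType) (n : nat).
Implicit Types x y z : 'rV[R]_n.

Definition dot x y : R := \sum_i x ord0 i * y ord0 i.

(* The norm that the library puts on 'rV[R]_n is the sup norm. *)
Definition enorm x : R := Num.sqrt (dot x x).

Definition eball x (t : R) : set 'rV[R]_n := [set z | enorm (z - x) < t].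

Definition esphere x (t : R) : set 'rV[R]_n := [set z | enorm (z - x) = t].

Definition edir x : 'rV[R]_n := (enorm x)^-1 *: x.

Lemma measurable_enorm : measurable_fun [set: 'rV[R]_n] enorm.
Proof.
apply: (measurableT_comp (f := @Num.sqrt R)).
  by apply: continuous_measurable_fun; exact: sqrt_continuous.
apply: measurable_sum => i.
by apply: measurable_funM; exact: measurable_coord.
Qed.

Lemma measurable_edir : measurable_fun [set: 'rV[R]_n] edir.
Proof.
apply: measurable_fun_rVP => i.
rewrite (_ : (fun _ => _) = fun x : 'rV[R]_n => enorm x `^ (-1) * x ord0 i).
  apply: measurable_funM; last exact: measurable_coord.
  apply: (measurableT_comp (f := fun r : R => r `^ (-1))) => //.
  exact: measurable_enorm.
by apply/funext => x; rewrite mxE powR_inv1// sqrtr_ge0.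
Qed.

Lemma measurable_rV_affine x (t : R) :
  measurable_fun [set: 'rV[R]_n] (fun z : 'rV[R]_n => x + t *: z).
Proof.
apply: measurable_fun_rVP => i; under eq_fun do rewrite !mxE.
apply: measurable_funD => //; apply: measurable_funM => //.
exact: measurable_coord.
Qed.

Definition punctured_ball : set 'rV[R]_n := [set z | 0 < enorm z < 1].

Lemma measurable_punctured_ball : measurable punctured_ball.
Proof.
have -> : punctured_ball = setT `&` enorm @^-1` `]0, 1[.
  by rewrite setTI; apply/seteqP; split => z /=; rewrite in_itv.
by apply: measurable_enorm => //; exact: measurable_itv.
Qed.

End euclidean.
Arguments punctured_ball {R n}.

Section surface_measure.
Variables (R : realType) (n : nat).
Local Open Scope ereal_scope.

(* Surface measure of the unit sphere, from polar coordinates: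
   sigma(A) = n * lambda {r theta | theta in A, 0 < r < 1}. *)
Definition unit_sphere_measure (A : set 'rV[R]_n) : \bar R :=
  n%:R%:E * lebesgue_rV R n (@edir R n @^-1` A `&` punctured_ball).

Let mu0 := mrestr (lebesgue_rV R n) (@measurable_punctured_ball R n).
Let m1 : {measure set 'rV[R]_n -> \bar R} := mscale n%:R%:nng%R
  (measure_function_pushforward__canonical__measure_function_Measure mu0 (@measurable_edir R n)).

HB.instance Definition _ := isMeasure.Build _ _ _ unit_sphere_measure
  (measure0 m1) (measure_ge0 m1) (@measure_semi_sigma_additive _ _ _ m1).

Variables (x : 'rV[R]_n) (t : R).

(* Image of t^(n-1) sigma under theta |-> x + t theta, for t > 0; the absolute
   value only makes the scaling factor nonnegative for every t. *)
Definition sphere_measure (A : set 'rV[R]_n) : \bar R :=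
  (`|t| ^+ n.-1)%:E *
  unit_sphere_measure ((fun z : 'rV[R]_n => x + t *: z)%R @^-1` A).

Let m2 : {measure set 'rV[R]_n -> \bar R} := mscale (`|t| ^+ n.-1)%:nng%R
  (measure_function_pushforward__canonical__measure_function_Measure unit_sphere_measure (measurable_rV_affine x t)).

HB.instance Definition _ := isMeasure.Build _ _ _ sphere_measure
  (measure0 m2) (measure_ge0 m2) (@measure_semi_sigma_additive _ _ _ m2).

End surface_measure.

Section smooth_functions.
Variables (R : realType) (n : nat).
Implicit Types (f : 'rV[R]_n -> R) (U : set 'rV[R]_n).

Definition partial (i : 'I_n) f : 'rV[R]_n -> R := 'D_(delta_mx ord0 i) f.

Definition grad f (x : 'rV[R]_n) : 'rV[R]_n := \row_i partial i f x.

(* f is of class C^k on U; U is meant to be open. *)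
Fixpoint class_C (k : nat) U f : Prop :=
  if k is k'.+1 then
    forall i : 'I_n,
      (forall x, U x -> derivable f x (delta_mx ord0 i)) /\
      class_C k' U (partial i f)
  else forall x, U x -> {for x, continuous f}.

Definition smooth f : Prop := forall k, class_C k setT f.

Definition test_function f : Prop :=
  smooth f /\ compact (closure [set x | f x != 0]).

(* Only the values of Omega on the unit sphere matter: C^1 functions on the
   submanifold S^(n-1) are those that extend locally to C^1 functions. *)
Definition C1_on_sphere m (Omega : 'rV[R]_n -> 'rV[R]_m) : Prop :=
  forall theta, enorm theta = 1 ->
  exists U (F : 'rV[R]_n -> 'rV[R]_m), [/\ open U, U theta,
    forall j, class_C 1 U (fun x => F x ord0 j) &
    forall eta, U eta -> enorm eta = 1 -> F eta = Omega eta].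

End smooth_functions.

Section sobolev_spaces.
Variables (R : realType) (n : nat).
Local Notation mu := (lebesgue_rV R n).
Implicit Types (p : R) (f h phi : 'rV[R]_n -> R) (G : 'rV[R]_n -> 'rV[R]_n).

Definition Lnorm_vec m p (F : 'rV[R]_n -> 'rV[R]_m) : \bar R :=
  'N[mu]_p%:E[EFin \o (@enorm R m \o F)].

Definition Lp_vec m p (F : 'rV[R]_n -> 'rV[R]_m) : Prop :=
  measurable_fun [set: 'rV[R]_n] F /\ (Lnorm_vec p F < +oo)%E.

Definition loc_integrable f : Prop :=
  forall K : set 'rV[R]_n, compact K -> mu.-integrable K (EFin \o f).

Definition weak_gradient f G : Prop :=
  [/\ loc_integrable f, forall i, loc_integrable (fun x => G x ord0 i) &
    forall phi, test_function phi -> forall i,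
      (\int[mu]_x (f x * partial i phi x))%R =
      - (\int[mu]_x (G x ord0 i * phi x))%R].

(* f belongs to W^{1,p}, with gradient G. *)
Definition sobolev p f G : Prop :=
  [/\ f \in Lfun mu p%:E, Lp_vec p G & weak_gradient f G].

Definition sobolev_norm p f G : \bar R :=
  ('N[mu]_p%:E[EFin \o f] + Lnorm_vec p G)%E.

Definition sobolev_conj p : R := n%:R * p / (n%:R - p).

(* The a.e. class of g belongs to the homogeneous Sobolev space: h is a
   real-valued representative of g and G its distributional gradient. Maximal
   functions may be +oo on a negligible set, hence the values in \bar R. *)
Definition hom_sobolev p (g : 'rV[R]_n -> \bar R) h G : Prop :=
  [/\ {ae mu, forall x, g x = (h x)%:E}, h \in Lfun mu (sobolev_conj p)%:E,
      Lp_vec p G & weak_gradient h G].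

Definition hom_sobolev_norm p h G : \bar R :=
  ('N[mu]_(sobolev_conj p)%:E[EFin \o h] + Lnorm_vec p G)%E.

End sobolev_spaces.

Section maximal_operators.
Variables (R : realType) (n : nat).
Local Notation mu := (lebesgue_rV R n).
Implicit Types (f g : 'rV[R]_n -> R) (x : 'rV[R]_n) (t : R).

Definition kernel_of m (Omega : 'rV[R]_n -> 'rV[R]_m) (y : 'rV[R]_n) :
  'rV[R]_m := (enorm y ^+ n.-1)^-1 *: Omega (edir y).

Definition truncated_integral m (Omega : 'rV[R]_n -> 'rV[R]_m)
    (f : 'rV[R]_n -> 'rV[R]_m) x t : R :=
  \int[mu]_(z in [set z | t <= enorm (x - z)])
    dot (f z) (kernel_of Omega (x - z)).

Definition maximal_singular m (Omega : 'rV[R]_n -> 'rV[R]_m)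
    (f : 'rV[R]_n -> 'rV[R]_m) x : \bar R :=
  ereal_sup [set `|truncated_integral Omega f x t|%:E | t in [set t | 0 < t]].

(* The trace operator W^{1,1}(B(x, t)) -> L^1(S(x, t), sigma) is the continuous
   extension of the restriction map phi |-> phi|_S(x, t) of smooth functions;
   g is its value at f. *)
Definition is_trace f x t g : Prop :=
  (sphere_measure x t).-integrable setT (EFin \o g) /\
  exists G, weak_gradient f G /\
  exists phi : nat -> 'rV[R]_n -> R,
    [/\ forall k, smooth (phi k),
      (\int[mu]_(z in eball x t) `|phi k z - f z|%:E)%E @[k --> \oo] --> 0%E,
      (\int[mu]_(z in eball x t) (enorm (grad (phi k) z - G z))%:E)%E
        @[k --> \oo] --> 0%E &
      (\int[sphere_measure x t]_(z in esphere x t) `|phi k z - g z|%:E)%E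
        @[k --> \oo] --> 0%E].

(* A trace is unique up to a sigma-negligible set; get picks a representative. *)
Definition trace f x t : 'rV[R]_n -> R := get (is_trace f x t).

Definition ball_volume : R := fine (mu (eball 0 1)).

Definition spherical_mean f x t : \bar R :=
  ((n%:R * ball_volume * t ^+ n.-1)^-1%:E *
   \int[sphere_measure x t]_(z in esphere x t) `|trace f x t z|%:E)%E.

Definition spherical_maximal f x : \bar R :=
  ereal_sup [set spherical_mean f x t | t in [set t | (0 < t)%R]].

End maximal_operators.

(* Main.v *)
(* Take m = n, Omega = id and F = sgn(f) Df. On almost every ray from x the
   function |f| is absolutely continuous and tends to 0 at infinity, so
   |f(x + t theta)| is minus the integral over r > t of the radial derivative
   of |f|. Integrating over theta in polar coordinates, for every x and t,
     (n omega_n t^(n-1))^-1 int_(S(x,t)) |f| dsigma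
       = (n omega_n)^-1 int_(|x-z| >= t) F(z) . (x - z) |x - z|^-n dz,
   so the spherical maximal function of f is a constant multiple of the maximal
   singular integral of F, and |F| <= |Df|. To obtain the identity for every
   sphere, the trace of f is written as a mean of f and Df along radii, |f| is
   replaced by sqrt(f^2 + e^2) - e and the exterior domain is cut off at radius
   T; smooth functions satisfy the resulting formula by the fundamental theorem
   of calculus, f by approximation, and e -> 0, T -> oo is a dominated limit
   whose dominating function is integrable by Hoelder's inequality as p < n. *)
Require Import Defs.
From HB Require Import structures.
From mathcomp Require Import all_boot all_order all_algebra.
From mathcomp Require Import all_classical all_reals all_analysis.
From mathcomp Require Import measurable_realfun measurable_fun_approximation.
From mathcomp Require Import ring lra.
Import Order.TTheory GRing.Theory Num.Def Num.Theory.
Import numFieldNormedType.Exports.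
Set Implicit Arguments.
Unset Strict Implicit.
Unset Printing Implicit Defensive.
Local Open Scope classical_set_scope.
Local Open Scope ring_scope.

(** The supremum defining [spherical_maximal] runs over every sphere, and each sphere is a null set,
    so an identity valid for almost every radius would not do. Moreover [trace] is a choice among
    functions that are only characterised as limits. The explicit [sphere_trace] settles both
    points: it is a trace, all traces have the same mean absolute value, and its distance to a
    smooth function on the sphere is bounded by a volume integral over the ball. Since the surface
    measure is an image of Lebesgue measure on the punctured ball, directions are written [edir w]
    with [w] in that ball. The absolute value is regularised because [|phi|] need not be
    differentiable at zeros of a smooth [phi], and because [Num.sg] jumps at 0, whereas
    [s / sqrt(s^2 + e^2)] is Lipschitz and lets errors be estimated. The increments of this function
    still multiply the unbounded gradient, which has to be truncated. Smooth approximation is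
    available on bounded sets only, hence the radius [T]; the linear factor [1 - r / T] removes the
    boundary term at [T] at the price of a term in [|f| / T]. *)

Lemma integral_mkcond_indic d (T : measurableType d) (R : realType)
    (m : {measure set T -> \bar R}) (D : set T) (f : T -> \bar R) :
  (\int[m]_(x in D) f x = \int[m]_x (f x * (\1_D x)%:E))%E.
Proof. by rewrite integral_mkcond epatch_indic. Qed.

(** * Lebesgue measure on row vectors *)

Section tonelli.
Context d1 d2 (T1 : measurableType d1) (T2 : measurableType d2) {R : realType}.
Variables (m1 : {sigma_finite_measure set T1 -> \bar R}).
Variables (m2 : {sigma_finite_measure set T2 -> \bar R}).
Variable f : T1 -> T2 -> \bar R.
Hypothesis mf : measurable_fun [set: T1 * T2] (fun z => f z.1 z.2).
Hypothesis f0 : forall x y, (0 <= f x y)%E.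

Lemma measurable_integral_param :
  measurable_fun [set: T1] (fun x => \int[m2]_y f x y)%E.
Proof.
exact: (@measurable_fun_fubini_tonelli_F _ _ _ _ _ m2 _ mf (fun=> f0 _ _)).
Qed.

Lemma tonelli_swap :
  (\int[m1]_x \int[m2]_y f x y = \int[m2]_y \int[m1]_x f x y)%E.
Proof.
exact: (@fubini_tonelli _ _ _ _ _ m1 m2 _ mf (fun=> f0 _ _)).
Qed.
End tonelli.

Section lebesgue_rV_theory.
Context {R : realType}.
Local Notation leb := (@lebesgue_measure R).
Local Open Scope ereal_scope.

(** [lebesgue_rV] is built as the image of a product measure under [rV_cons], so Tonelli's theorem
    peels off the first coordinate. This is the basis of inductions on the dimension. *)
Lemma ge0_integral_rV_cons n (f : 'rV[R]_n.+1 -> \bar R) :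
  measurable_fun [set: 'rV[R]_n.+1] f -> (forall x, 0 <= f x) ->
  \int[lebesgue_rV R n.+1]_x f x =
  \int[leb]_s \int[lebesgue_rV R n]_v f (rV_cons (s, v)).
Proof.
move=> mf f0.
pose m : {measure set 'rV[R]_n.+1 -> \bar R} :=
  measure_function_pushforward__canonical__measure_function_Measure
    (leb \x lebesgue_rV R n) (@measurable_rV_cons R n).
transitivity (\int[m]_x f x); first exact: eq_measure_integral.
rewrite ge0_integral_pushforward//; last exact: measurable_rV_cons.
rewrite preimage_setT fubini_tonelli1//=.
by apply: measurableT_comp => //; exact: measurable_rV_cons.
Qed.

Lemma measurable_affine (x c : R) :
  measurable_fun setT (fun s : measurableTypeR R => (x + c * s)%R : measurableTypeR R).
Proof. by apply: measurable_funD => //; exact: measurable_funM. Qed.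

(** By uniqueness of Lebesgue measure: the rescaled image measure gives every interval []a, b]] its
    length. *)
Lemma lebesgue_measure_affine (x c : R) (A : set (measurableTypeR R)) :
  (0 < c)%R -> measurable A ->
  leb A = c%:E * leb [set s | A (x + c * s)%R].
Proof.
move=> c0 mA; pose m0 : {measure set (measurableTypeR R) -> \bar R} :=
  measure_function_pushforward__canonical__measure_function_Measure leb (measurable_affine x c).
pose m : {measure set (measurableTypeR R) -> \bar R} := mscale (NngNum (ltW c0)) m0.
rewrite (@lebesgue_measure_unique R m)// => _ [[a b] _ <-]/=.
rewrite /m/= /mscale/= /pushforward/=.
rewrite (_ : _ @^-1` _ = `]((a - x) / c)%R, ((b - x) / c)%R]%classic); last first.
  apply/seteqP; split => s /=; rewrite !in_itv/= ltr_pdivrMr// ler_pdivlMr//.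
    by rewrite ltrBlDl lerBrDl (mulrC s).
  by rewrite ltrBlDl lerBrDl (mulrC s).
rewrite !lebesgue_measure_itv/= !lte_fin ltr_pM2r ?invr_gt0// ltrD2r.
case: ifPn => _; last by rewrite mule0.
by rewrite -!EFinB -EFinM -mulrBl mulrCA divff ?gt_eqF// mulr1 opprD opprK addrACA addNr addr0.
Qed.

Lemma ge0_integral_affine (f : R -> \bar R) (x c : R) : (0 < c)%R ->
  measurable_fun [set: measurableTypeR R] f -> (forall s, 0 <= f s) ->
  \int[leb]_s f s = c%:E * \int[leb]_s f (x + c * s)%R.
Proof.
move=> c0 mf f0.
pose m0 : {measure set (measurableTypeR R) -> \bar R} :=
  measure_function_pushforward__canonical__measure_function_Measure leb (measurable_affine x c).
transitivity (\int[mscale (NngNum (ltW c0)) m0]_s f s).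
  by apply: eq_measure_integral => A mA _; exact: lebesgue_measure_affine.
rewrite ge0_integral_mscale//= ge0_integral_pushforward//=.
- exact: measurable_affine.
Qed.

(** Induction on the dimension; each coordinate that is peeled off contributes one factor [c]. *)
Lemma ge0_integral_rV_affine n (f : 'rV[R]_n -> \bar R) (x : 'rV[R]_n) (c : R) :
  (0 < c)%R -> measurable_fun [set: 'rV[R]_n] f -> (forall s, 0 <= f s) ->
  \int[lebesgue_rV R n]_z f z =
  (c ^+ n)%:E * \int[lebesgue_rV R n]_z f (x + c *: z)%R.
Proof.
elim: n f x => [|n IH] f x c0 mf f0.
  rewrite expr0 mul1e; apply: eq_integral => z _.
  by congr f; apply/rowP => -[].
rewrite !ge0_integral_rV_cons//; last first.
  by apply: measurableT_comp mf _; exact: measurable_rV_affine.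
pose G s := \int[lebesgue_rV R n]_v f (rV_cons (s, v)).
have mfc : measurable_fun setT (f \o @rV_cons R n).
  by apply: measurableT_comp mf _; exact: measurable_rV_cons.
have mG : measurable_fun setT G.
  exact: (@measurable_integral_param _ _ _ _ _ _ (fun s v => f (rV_cons (s, v)))).
have G0 s : 0 <= G s by apply: integral_ge0.
rewrite [LHS](@ge0_integral_affine G (x ord0 ord0) c c0 mG G0).
rewrite exprS EFinM -muleA; congr *%E.
rewrite -ge0_integralZl//; first last.
- by rewrite lee_fin exprn_ge0// ltW.
- by move=> s _; apply: integral_ge0.
- have m1 : measurable_fun setT ((fun z => f (x + c *: z)%R) \o @rV_cons R n).
    apply: measurableT_comp; last exact: measurable_rV_cons.
    by apply: measurableT_comp mf _; exact: measurable_rV_affine.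
  exact: (@measurable_integral_param _ _ _ _ _ _ (fun s v => f (x + c *: rV_cons (s, v))%R)).
apply: eq_integral => s _.
rewrite /G (IH _ (\row_j x ord0 (lift ord0 j)))//; last first.
  by apply: (measurableT_comp mfc); exact: measurable_pair1.
congr *%E; apply: eq_integral => v _; congr f.
apply/rowP => i; rewrite !mxE; case: (unliftP ord0 i) => [j|] ->;
  by rewrite ?liftK ?unlift_none//= !mxE.
Qed.

End lebesgue_rV_theory.

(** * Topology and measurable sets of R^n *)

Section rV_topology.
Context {R : realType} {n : nat}.
Implicit Types (x y z : 'rV[R]_n) (M e : R).
Local Notation mu := (lebesgue_rV R n).

Lemma rV_ballP x e y : 0 < e ->
  ball x e y <-> forall i, `|x ord0 i - y ord0 i| < e.
Proof.
move=> e0; split => [[_ h] i|h]; first exact: h.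
by split => // i j; rewrite (ord1 i); exact: h.
Qed.

Lemma ler_coord_norm x i : `|x ord0 i| <= `|x|.
Proof.
rewrite [leRHS]/normr/= mx_normrE.
by apply/bigmax_geP; right => /=; exists (ord0, i).
Qed.

Lemma rV_norm_leP x M : 0 <= M ->
  reflect (forall i, `|x ord0 i| <= M) (`|x| <= M).
Proof.
move=> M0; apply: (iffP idP) => [h i|h].
  exact: le_trans (ler_coord_norm _ _) h.
rewrite [leLHS]/normr/= mx_normrE; apply/bigmax_leP; split => //= -[i j] _.
by rewrite (ord1 i).
Qed.

(** The sigma-algebra is generated by the coordinates, so an open set is written as a countable
    union of open boxes with rational centre and radius. Measurability of compact sets and of
    continuous functions follows. *)
Lemma open_measurable_rV (U : set 'rV[R]_n) : open U -> measurable U.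
Proof.
move=> oU.
pose rbox (c : 'rV[rat]_n * rat) : set 'rV[R]_n :=
  [set z | forall i, `|ratr (c.1 ord0 i) - z ord0 i| < ratr c.2].
have mrbox c : measurable (rbox c).
  rewrite (_ : rbox c = \bigcap_(i in [set: 'I_n])
      [set z : 'rV[R]_n | `|ratr (c.1 ord0 i) - z ord0 i| < ratr c.2]).
    apply: fin_bigcap_measurable => // i _.
    rewrite -[X in measurable X]setTI.
    apply: (@measurable_fun_ltr _ _ _ _ _ (fun=> _)) => //.
    apply: measurableT_comp => //.
    by apply: measurable_funB => //; exact: measurable_coord.
  by apply/seteqP; split => z h; [move=> i _|move=> i]; exact: h.
rewrite (_ : U = \bigcup_(c in [set c | rbox c `<=` U]) rbox c); last first.
  apply/seteqP; split => [z Uz|z [c cU]]; last exact: cU.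
  have /nbhs_ballP[e /= e0 eU] : nbhs z U by exact: open_nbhs_nbhs.
  (* With [r < e / 2], a rational box of radius [r] that contains [z] lies in the [e]-ball around
     [z]. *)
  have /rat_in_itvoo[r /andP[/= r0 re]] : 0 < e / 2 by rewrite divr_gt0.
  rewrite !bnd_simp in r0 re.
  have /choice[q qP] (i : 'I_n) : exists q : rat, `|ratr q - z ord0 i| < ratr r.
    have [//|q] := @rat_in_itvoo R (z ord0 i - ratr r) (z ord0 i + ratr r).
      by rewrite ltrBlDr -addrA ltrDl addr_gt0.
    rewrite in_itv/= => /andP[h1 h2]; exists q.
    by rewrite ltr_distl h1.
  exists (\row_i q i, r) => [w wq|i]; last by rewrite /= mxE.
  apply: eU; apply/rV_ballP => // i; rewrite (splitr e).
  rewrite -(subrKA (ratr (q i))) (le_lt_trans (ler_normD _ _))//.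
  rewrite ltrD// ?(lt_trans _ re)//; first by rewrite distrC.
  by have := wq i; rewrite /= mxE.
rewrite bigcup_mkcond; apply: countable_bigcupT_measurable.
  exact: countableP.
by move=> c; case: ifPn.
Qed.

Lemma closed_measurable_rV (A : set 'rV[R]_n) : closed A -> measurable A.
Proof.
by move=> cA; rewrite -(setCK A); apply: measurableC; apply: open_measurable_rV; exact: closed_openC.
Qed.

Lemma compact_measurable_rV (A : set 'rV[R]_n) : compact A -> measurable A.
Proof.
by move=> cA; apply: closed_measurable_rV; apply: compact_closed => //; exact: norm_hausdorff.
Qed.

Lemma continuous_measurable_rV (f : 'rV[R]_n -> R) :
  continuous f -> measurable_fun [set: 'rV[R]_n] f.
Proof.
move=> cf; apply: (measurability _ (RGenOInfty.measurableE R)) => _ [_ [a ->] <-].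
rewrite setTI; apply: open_measurable_rV.
by apply: open_comp => [z _|]; [exact: cf|exact: interval_open].
Qed.

(** Sup-norm balls are compact and, as products of intervals, of finite measure; they stand for
    general compact sets in all local statements. *)
Definition cube M : set 'rV[R]_n := [set z | `|z| <= M].

Lemma cubeE M : 0 <= M ->
  cube M = [set z : 'rV[R]_n | forall i, `[- M, M]%classic (z ord0 i)].
Proof.
move=> M0; apply/seteqP; split => z /=.
  by move/rV_norm_leP => /(_ M0) h i; rewrite in_itv/= -ler_norml.
by move=> h; apply/rV_norm_leP => // i; have := h i; rewrite in_itv/= ler_norml.
Qed.

Lemma compact_cube M : compact (cube M).
Proof.
have [M0|M0] := leP 0 M.
  by rewrite cubeE//; apply: (@rV_compact _ _ (fun=> `[- M, M]%classic)) => _; exact: segment_compact.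
rewrite (_ : cube M = set0); first exact: (@compact0 'rV[R]_n).
by apply/seteqP; split => // z /= /(le_trans (normr_ge0 _)); rewrite leNgt M0.
Qed.

Lemma measurable_cube M : measurable (cube M).
Proof. by apply: compact_measurable_rV; exact: compact_cube. Qed.

Lemma compact_sub_cube (K : set 'rV[R]_n) : compact K ->
  exists2 M, 0 < M & K `<=` cube M.
Proof.
move=> /compact_bounded[M [Mr h]]; exists (Num.max M 0 + 1).
  by rewrite ltr_wpDl// le_max lexx orbT.
by move=> z Kz; apply: (h _ _ _ Kz); rewrite (@le_lt_trans _ _ (Num.max M 0))// ?ltrDl// le_max lexx.
Qed.

Lemma cube_lty M : (mu (cube M) < +oo)%E.
Proof.
have [M0|M0] := leP 0 M; last first.
  rewrite (_ : cube M = set0) ?measure0//.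
  by apply/seteqP; split => // z /= /(le_trans (normr_ge0 _)); rewrite leNgt M0.
rewrite cubeE// (lebesgue_rV_prod (fun=> measurable_itv `[-M, M])).
rewrite ltey_eq; apply/orP; left.
apply: (big_ind (fun y : \bar R => y \is a fin_num)) => // [y y' yf yf'|i _].
  exact: fin_numM.
by rewrite lebesgue_measure_itv/=; case: ifP.
Qed.

Lemma bigcup_cube : \bigcup_k cube k%:R = [set: 'rV[R]_n].
Proof.
apply/seteqP; split => // z _; exists (Num.truncn `|z|).+1 => //=.
exact/ltW/truncnS_gt.
Qed.

Lemma le_cube M M' : M <= M' -> cube M `<=` cube M'.
Proof. by move=> MM z /= /le_trans; exact. Qed.

End rV_topology.
Arguments cube {R n} M.

(** * Polar coordinates *)

Section euclidean_norm.
Context {R : realType} {n : nat}.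
Implicit Types (x y z : 'rV[R]_n) (c : R).

Lemma dotZl c x y : dot (c *: x) y = c * dot x y.
Proof. by rewrite /dot mulr_sumr; apply: eq_bigr => i _; rewrite mxE mulrA. Qed.

Lemma dotZr c x y : dot x (c *: y) = c * dot x y.
Proof. by rewrite /dot mulr_sumr; apply: eq_bigr => i _; rewrite mxE mulrCA. Qed.

Lemma enorm_ge0 x : 0 <= enorm x.
Proof. exact: sqrtr_ge0. Qed.

Lemma dotxx_ge0 x : 0 <= dot x x.
Proof. by apply: sumr_ge0 => i _; rewrite -expr2 sqr_ge0. Qed.

Lemma enormZ c x : enorm (c *: x) = `|c| * enorm x.
Proof.
by rewrite /enorm dotZl dotZr mulrA -expr2 sqrtrM ?sqr_ge0// sqrtr_sqr.
Qed.

Lemma enormN x : enorm (- x) = enorm x.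
Proof. by rewrite -scaleN1r enormZ normrN1 mul1r. Qed.

Lemma ler_coord_enorm x i : `|x ord0 i| <= enorm x.
Proof.
rewrite -sqrtr_sqr ler_sqrt ?dotxx_ge0// /dot (bigD1 i)//= expr2 lerDl.
by apply: sumr_ge0 => j _; rewrite -expr2 sqr_ge0.
Qed.

Lemma enorm_le_sum x : enorm x <= \sum_i `|x ord0 i|.
Proof.
have S0 : 0 <= \sum_i `|x ord0 i| by apply: sumr_ge0.
rewrite -(ger0_norm S0) -sqrtr_sqr ler_sqrt ?sqr_ge0// expr2 /dot mulr_suml.
apply: ler_sum => i _; rewrite (le_trans (ler_norm _))// normrM.
by rewrite ler_wpM2l// (bigD1 i)//= lerDl; apply: sumr_ge0.
Qed.

Lemma norm_le_enorm x : `|x| <= enorm x.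
Proof. by apply/rV_norm_leP; [exact: enorm_ge0|exact: ler_coord_enorm]. Qed.

Lemma enorm_eq0 x : (enorm x == 0) = (x == 0).
Proof.
apply/eqP/eqP => [x0|->].
  by apply/eqP; rewrite -normr_le0 -x0 norm_le_enorm.
by rewrite -(scale0r 0) enormZ normr0 mul0r.
Qed.

Lemma enorm_gt0 x : (0 < enorm x) = (x != 0).
Proof. by rewrite lt_neqAle enorm_ge0 andbT eq_sym enorm_eq0. Qed.

Lemma enorm_edir x : x != 0 -> enorm (edir x) = 1.
Proof.
move=> x0; rewrite enormZ ger0_norm ?invr_ge0 ?enorm_ge0// mulVf//.
by rewrite enorm_eq0.
Qed.

Lemma edirZ c x : 0 < c -> edir (c *: x) = edir x.
Proof.
move=> c0; rewrite /edir enormZ gtr0_norm// scalerA invfM.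
by rewrite mulrAC mulVf ?mul1r// gt_eqF.
Qed.

Lemma enorm_edirK x : enorm x *: edir x = x.
Proof.
have [->|x0] := eqVneq x 0; first by rewrite /edir !scaler0.
by rewrite scalerA divff ?scale1r// enorm_eq0.
Qed.

Lemma edir_edir x : edir (edir x) = edir x.
Proof.
have [->|x0] := eqVneq x 0; first by rewrite /edir !scaler0.
by rewrite {1}/edir enorm_edir// invr1 scale1r.
Qed.

(** A coarse substitute for the Cauchy-Schwarz inequality; dimensional constants are harmless in the
    later estimates. *)
Lemma dot_le_sum x y : `|dot x y| <= (\sum_i `|x ord0 i|) * enorm y.
Proof.
rewrite mulr_suml (le_trans (ler_norm_sum _ _ _))//.
by apply: ler_sum => i _; rewrite normrM ler_wpM2l// ler_coord_enorm.
Qed.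

Lemma sum_le_enorm x : \sum_i `|x ord0 i| <= n%:R * enorm x.
Proof.
rewrite mulr_natl -[X in _ *+ X](card_ord n) -sumr_const.
by apply: ler_sum => i _; exact: ler_coord_enorm.
Qed.

Lemma punctured_ballE x : punctured_ball x -> x != 0.
Proof. by move=> /andP[+ _]; rewrite enorm_gt0. Qed.

End euclidean_norm.

Section measurable_rV_operations.
Context {R : realType} {n : nat} d (T : measurableType d).
Implicit Types (u v : T -> 'rV[R]_n) (a : T -> R).

Lemma measurable_rV_coord v i : measurable_fun [set: T] v ->
  measurable_fun [set: T] (fun z => v z ord0 i).
Proof. exact: (measurableT_comp (@measurable_coord R n i)). Qed.

Lemma measurable_rVZ a v : measurable_fun [set: T] a -> measurable_fun [set: T] v ->
  measurable_fun [set: T] (fun z => a z *: v z).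
Proof.
move=> ma mv; apply: (@measurable_fun_rVP R _ _ n) => i.
under eq_fun do rewrite mxE.
by apply: measurable_funM => //; exact: measurable_rV_coord.
Qed.

Lemma measurable_rVD u v : measurable_fun [set: T] u -> measurable_fun [set: T] v ->
  measurable_fun [set: T] (fun z => u z + v z).
Proof.
move=> mu mv; apply: (@measurable_fun_rVP R _ _ n) => i.
under eq_fun do rewrite mxE.
by apply: measurable_funD => //; exact: measurable_rV_coord.
Qed.

Lemma measurable_rVB u v : measurable_fun [set: T] u -> measurable_fun [set: T] v ->
  measurable_fun [set: T] (fun z => u z - v z).
Proof.
move=> mu mv; apply: (@measurable_fun_rVP R _ _ n) => i.
under eq_fun do rewrite !mxE.
by apply: measurable_funB => //; exact: measurable_rV_coord.
Qed.

Lemma measurable_dot u v : measurable_fun [set: T] u -> measurable_fun [set: T] v ->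
  measurable_fun [set: T] (fun z => dot (u z) (v z)).
Proof.
by move=> mu mv; apply: measurable_sum => i; apply: measurable_funM; exact: measurable_rV_coord.
Qed.

End measurable_rV_operations.

Section polar_coordinates.
Context {R : realType}.
Local Notation leb := (@lebesgue_measure R).
Local Open Scope ereal_scope.

Lemma powRN_cvg0 (q : R) : (0 < q)%R -> (s `^ (- q))%R @[s --> +oo%R] --> (0 : R)%R.
Proof.
move=> q0; apply/cvgrPdist_le => e e0; near=> s.
have s0 : (0 < s)%R by near: s; exact: nbhs_pinfty_gt.
rewrite sub0r normrN ger0_norm ?powR_ge0// powRN invf_ple ?posrE ?powR_gt0//.
have : (e^-1 `^ q^-1 <= s)%R by near: s; exact: nbhs_pinfty_ge.
move=> /(@ge0_ler_powR _ _ (ltW q0) _ _ (powR_ge0 _ _) (ltW s0)).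
by rewrite -powRrM mulVf ?gt_eqF// powRr1// invr_ge0 ltW.
Unshelve. all: by end_near. Qed.

Lemma integral_powR_itvcy (a q : R) : (0 < a)%R -> (0 < q)%R ->
  \int[leb]_(s in `[a, +oo[) (s `^ (- q - 1))%:E = (a `^ (- q) / q)%:E.
Proof.
move=> a0 q0.
have qn0 : q != 0%R by rewrite gt_eqF.
pose F (s : R) : R := (- q^-1 * s `^ (- q))%R.
have dF (x : R) : (a <= x)%R -> is_derive x 1%R F (x `^ (- q - 1))%R.
  move=> ax; have x0 := lt_le_trans a0 ax.
  rewrite (_ : (x `^ _)%R = (- q^-1 * (- q * x `^ (- q - 1)))%R).
    exact: (is_deriveZ (- q^-1)%R (is_derive1_powR (- q)%R x0)).
  by rewrite mulrA mulrNN mulVf// mul1r.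
have cpow (p x : R) : (0 < x)%R -> {for x, continuous (fun s : R => s `^ p)%R}.
  move=> x0; apply: differentiable_continuous; apply/derivable1_diffP.
  by have [] := is_derive1_powR p x0.
rewrite (@ge0_continuous_FTC2y _ _ F a 0%R).
- by rewrite sub0e /F -EFinN mulNr opprK mulrC.
- by move=> x _; exact: powR_ge0.
- apply: continuous_in_subspaceT => x; rewrite inE/= in_itv/= andbT => ax.
  by apply: cpow; exact: lt_le_trans ax.
- by rewrite -(mulr0 (- q^-1)%R); apply: cvgMr; exact: powRN_cvg0.
- by move=> x ax; have [] := dF _ (ltW ax).
- apply: cvg_at_right_filter; apply: cvgMr; exact: cpow.
- by move=> x; rewrite in_itv/= andbT => ax; rewrite derive1E; have [_ ->] := dF _ (ltW ax).
Qed.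

Lemma integral_powR_itvoy (a q : R) : (0 < a)%R -> (0 < q)%R ->
  \int[leb]_(s in `]a, +oo[) (s `^ (- q - 1))%:E = (a `^ (- q) / q)%:E.
Proof.
move=> a0 q0; rewrite -integral_powR_itvcy// integral_itv_obnd_cbnd//.
by apply/measurable_EFinP; apply: measurable_funTS; exact: measurable_powR.
Qed.

Context {n : nat} (n_gt0 : (0 < n)%N).
Local Notation mu := (lebesgue_rV R n).

Lemma lebesgue_rV_set1_0 : mu [set (0%R : 'rV[R]_n)] = 0.
Proof.
rewrite (_ : [set _] = [set x : 'rV[R]_n | forall i, [set (0%R : R)] (x ord0 i)]).
  rewrite (lebesgue_rV_prod (fun=> measurable_set1 _)).
  case: n n_gt0 => // k _; rewrite big_ord_recl/= lebesgue_measure_set1.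
  exact: mul0e.
by apply/seteqP; split => x /= => [-> i|h]; [rewrite mxE|apply/rowP => i; rewrite mxE h].
Qed.


Lemma mem_punctured_ballE (w : 'rV[R]_n) : (w \in (punctured_ball : set 'rV[R]_n)) = (0 < enorm w < 1)%R.
Proof. by apply/idP/idP => [/set_mem//|h]; apply/mem_set. Qed.

(** Tonelli's theorem for [L], which carries the weight [|y|^n s^(-n-1)] on [|y| < s]. Integrating
    first in [s] gives [H y / n], because [s^(-n-1)] has integral [|y|^(-n) / n] over [s > |y|].
    Integrating first in [y = s w] and then substituting [r = s |w|] gives the radial integrals; the
    power [|w|^n] is the one that makes the inner integral depend on [edir w] alone. *)
Lemma ge0_polar0 (H : 'rV[R]_n -> \bar R) :
  measurable_fun [set: 'rV[R]_n] H -> (forall x, 0 <= H x) ->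
  \int[mu]_z H z = n%:R%:E * \int[mu]_(w in punctured_ball)
    \int[leb]_(r in `]0%R, +oo[) ((r ^+ n.-1)%:E * H (r *: edir w)%R).
Proof.
move=> mH H0.
pose I0 := `]0%R, +oo[%classic : set R.
pose K (w : 'rV[R]_n) (s : measurableTypeR R) :=
  ((\1_punctured_ball w * \1_I0 s) * (s ^+ n.-1 * enorm w ^+ n))%:E * H (s *: w)%R.
have K0 w s : 0 <= K w s.
  rewrite /K; have [s0|s0] := ltP 0%R s.
    by rewrite mule_ge0// lee_fin !mulr_ge0// exprn_ge0// ?enorm_ge0// ltW.
  by rewrite (indicE _ I0) memNset ?mulr0 ?mul0r ?mul0e// /I0/= in_itv/= andbT ltNge s0.
pose L (y : 'rV[R]_n) (s : measurableTypeR R) :=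
  (if (0 < enorm y)%R && (enorm y < s)%R then enorm y ^+ n * (s `^ (- n%:R - 1)) else 0)%:E * H y.
have L0 y s : 0 <= L y s.
  by rewrite /L mule_ge0// lee_fin; case: ifP => // _; rewrite mulr_ge0// ?powR_ge0// exprn_ge0// enorm_ge0.
have mK : measurable_fun [set: 'rV[R]_n * measurableTypeR R] (fun z => K z.1 z.2).
  apply: emeasurable_funM.
    apply/measurable_EFinP; apply: measurable_funM; apply: measurable_funM.
    - exact: (measurableT_comp (@measurable_indic _ _ R setT _ (@measurable_punctured_ball R n)) measurable_fst).
    - exact: (measurableT_comp (@measurable_indic _ (measurableTypeR R) R setT I0 (measurable_itv _)) measurable_snd).
    - exact: measurable_funX.
    - by apply: measurable_funX; exact: (measurableT_comp (@measurable_enorm R n) measurable_fst).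
  apply: (measurableT_comp mH).
  exact: measurable_rVZ.
have mL : measurable_fun [set: 'rV[R]_n * measurableTypeR R] (fun z => L z.1 z.2).
  apply: emeasurable_funM; last exact: (measurableT_comp mH measurable_fst).
  have me : measurable_fun [set: 'rV[R]_n * measurableTypeR R] (fun z => enorm z.1).
    exact: (measurableT_comp (@measurable_enorm R n) measurable_fst).
  apply/measurable_EFinP; apply: measurable_fun_ifT => //.
    by apply: measurable_and; exact: measurable_fun_ltr.
  apply: measurable_funM; first exact: measurable_funX.
  exact: (measurableT_comp (measurable_powR (- n%:R - 1)) measurable_snd).
have nR0 : (0 < n%:R :> R)%R by rewrite ltr0n.
have intL y : n%:R%:E * \int[leb]_s L y s = H y * (\1_(~` [set 0%R : 'rV[R]_n]) y)%:E.
  have [->|y0] := eqVneq y 0%R.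
    rewrite indicE memNset ?mule0; last by move/(_ erefl).
    rewrite integral0_eq ?mule0// => s _; rewrite /L (_ : enorm 0 = 0%R) ?ltxx ?mul0e//.
    by apply/eqP; rewrite enorm_eq0.
  rewrite indicE mem_set ?mule1; last by move=> /= yE; rewrite yE eqxx in y0.
  have e0 : (0 < enorm y)%R by rewrite enorm_gt0.
  transitivity (n%:R%:E * \int[leb]_s ((enorm y ^+ n)%:E * H y * ((s `^ (- n%:R - 1))%:E * (\1_`]enorm y, +oo[ s)%:E))).
    congr *%E; apply: eq_integral => s _; rewrite /L e0/= indicE mem_setE in_itv/= andbT.
    by case: ifPn => _; rewrite ?mule0 ?mul0e// mule1 EFinM muleAC.
  rewrite ge0_integralZl//; first last.
  - by rewrite mule_ge0// lee_fin exprn_ge0// enorm_ge0.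
  - by move=> s _; rewrite mule_ge0// lee_fin ?powR_ge0.
  - apply/measurable_EFinP/measurable_funM; first exact: measurable_powR.
    by apply: measurable_indic; exact: measurable_itv.
  rewrite -integral_mkcond_indic integral_powR_itvoy// powRN powR_mulrn ?enorm_ge0//.
  rewrite muleAC muleA -!EFinM -[RHS]mul1e; congr (_%:E * _).
  by field; rewrite expf_neq0 ?gt_eqF.
(* Substitution [y = s w]: the Jacobian [s^n] turns [(s |w|)^n s^(-n-1)] into [s^(n-1) |w|^n], and
   [|y| < s] becomes [|w| < 1]. *)
have intK s : \int[mu]_w K w s = \int[mu]_y (L y s).
  have [s0|s0] := ltP 0%R s; last first.
    rewrite !integral0_eq// => y _.
      rewrite /L (_ : _ && _ = false) ?mul0e//; apply/negP => /andP[_ /lt_le_trans /(_ s0)].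
      by rewrite ltNge enorm_ge0.
    rewrite /K (indicE _ I0) memNset ?mulr0 ?mul0r ?mul0e//.
    by rewrite /I0/= in_itv/= andbT ltNge s0.
  have mLs : measurable_fun [set: 'rV[R]_n] (L^~ s).
    exact: (measurableT_comp mL (pair2_measurable s)).
  rewrite (@ge0_integral_rV_affine _ n (L^~ s) 0%R s s0)//.
  rewrite -ge0_integralZl//; first last.
  - by rewrite lee_fin exprn_ge0// ltW.
  - exact: (measurableT_comp mLs (measurable_rV_affine 0%R s)).
  apply: eq_integral => w _; rewrite add0r /K /L enormZ gtr0_norm// muleA.
  congr *%E; rewrite -EFinM indicE mem_punctured_ballE indicE mem_set ?mulr1; last first.
    by rewrite /I0/= in_itv/= s0.
  rewrite pmulr_rgt0// gtr_pMr//; case: ifP => _; rewrite ?mulr0 ?mul0r// mul1r.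
  rewrite -opprD powRN powRD ?gt_eqF ?implybT// powRr1 ?ltW// powR_mulrn ?ltW//.
  rewrite exprMn; have -> : (s ^+ n = s ^+ n.-1 * s)%R by rewrite -exprSr prednK.
  by congr EFin; have := exprn_gt0 n.-1 s0; move: (s ^+ n.-1)%R => u u0; field; rewrite !gt_eqF.
have LE : \int[mu]_y \int[leb]_s L y s = \int[mu]_(w in punctured_ball)
    \int[leb]_(r in `]0%R, +oo[) ((r ^+ n.-1)%:E * H (r *: edir w)%R).
  transitivity (\int[leb]_s \int[mu]_y L y s).
    exact: (@tonelli_swap _ _ _ _ _ mu leb L mL L0).
  transitivity (\int[leb]_s \int[mu]_w K w s).
    by apply: eq_integral => s _; rewrite intK.
  transitivity (\int[mu]_w \int[leb]_s K w s).
    exact/esym/(@tonelli_swap _ _ _ _ _ mu leb K mK K0).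
  rewrite [RHS]integral_mkcond_indic.
  apply: eq_integral => w _.
  rewrite indicE mem_punctured_ballE; case: (boolP (0 < enorm w < 1)%R) => [/andP[e0 e1]|ew]; last first.
    rewrite mule0 integral0_eq// => s _.
    by rewrite /K indicE mem_punctured_ballE (negbTE ew) !mul0r mul0e.
  rewrite mule1 [RHS]integral_mkcond_indic.
  pose g (r : R) := (\1_I0 r * r ^+ n.-1)%:E * H (r *: edir w)%R.
  have g0 r : 0 <= g r.
    rewrite /g mule_ge0// lee_fin indicE; case: (boolP (r \in I0)) => [|_]; last by rewrite mul0r.
    by move=> /set_mem; rewrite /I0/= in_itv/= andbT => r0; rewrite mul1r exprn_ge0// ltW.
  have mg : measurable_fun [set: measurableTypeR R] g.
    apply: emeasurable_funM.
      apply/measurable_EFinP; apply: measurable_funM; last exact: measurable_funX.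
      by apply: measurable_indic; exact: measurable_itv.
    by apply: (measurableT_comp mH); exact: measurable_rVZ.
  rewrite [RHS](_ : _ = \int[leb]_r g r); last first.
    by apply: eq_integral => r _; rewrite /g muleC muleA EFinM.
  (* Substitution [r = s |w|]: [r^(n-1)] accounts for [|w|^(n-1)] and the Jacobian for the last
     factor [|w|]. *)
  rewrite (@ge0_integral_affine _ g 0%R (enorm w))//.
  rewrite -ge0_integralZl//; first last.
  - by rewrite lee_fin ltW.
  - exact: (measurableT_comp mg (measurable_affine _ _)).
  apply: eq_integral => s _; rewrite add0r /g /K (mulrC (enorm w)) -scalerA.
  rewrite enorm_edirK muleA -EFinM; congr (_%:E * _).
  rewrite indicE mem_punctured_ballE e0 e1/= mul1r !indicE !mem_setE !in_itv/= !andbT.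
  rewrite pmulr_lgt0//; case: (0 < s)%R; rewrite ?mul0r ?mulr0// !mul1r.
  by rewrite exprMn mulrCA -exprS prednK.
pose S y := \int[leb]_s L y s.
have mS : measurable_fun [set: 'rV[R]_n] S.
  exact: (@measurable_integral_param _ _ _ _ _ _ L).
have S0 y : 0 <= S y by exact: integral_ge0.
have {}intL y : n%:R%:E * S y = H y * (\1_(~` [set 0%R : 'rV[R]_n]) y)%:E := intL y.
have {}LE : \int[mu]_y S y = \int[mu]_(w in punctured_ball)
    \int[leb]_(r in `]0%R, +oo[) ((r ^+ n.-1)%:E * H (r *: edir w)%R) := LE.
rewrite -LE; move: S mS S0 intL {LE} => S mS S0 intL.
rewrite -ge0_integralZl//.
under [RHS]eq_integral do rewrite intL.
(* At the origin [L] vanishes while [H] need not; the two integrands differ at most on the null set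
   [{0}]. *)
apply: ge0_ae_eq_integral => //.
- apply: emeasurable_funM => //; apply/measurable_EFinP; apply: measurable_indic.
  apply: measurableC; apply: compact_measurable_rV; exact: compact_set1.
- by move=> x _; rewrite mule_ge0.
- exists [set 0%R]; split => [| |y /=].
  + by apply: compact_measurable_rV; exact: compact_set1.
  + exact: lebesgue_rV_set1_0.
  + apply: contra_notP => y0 _.
    by rewrite indicE mem_set ?mule1.
Qed.

Lemma ge0_polar (H : 'rV[R]_n -> \bar R) (x : 'rV[R]_n) :
  measurable_fun [set: 'rV[R]_n] H -> (forall x, 0 <= H x) ->
  \int[mu]_z H z = n%:R%:E * \int[mu]_(w in punctured_ball)
    \int[leb]_(r in `]0%R, +oo[) ((r ^+ n.-1)%:E * H (x + r *: edir w)%R).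
Proof.
move=> mH H0; rewrite (@ge0_integral_rV_affine _ _ _ x 1%R)//.
rewrite expr1n mul1e; under eq_integral do rewrite scale1r.
rewrite ge0_polar0//.
have := measurable_rV_affine x 1; under eq_fun do rewrite scale1r.
exact: measurableT_comp.
Qed.

End polar_coordinates.

(** * Integrals in polar coordinates and over spheres *)

Section polar_integrals.
Context {R : realType}.
Local Notation leb := (@lebesgue_measure R).
Local Open Scope ereal_scope.

Lemma ge0_integral_mrestr d (T : measurableType d) (m : {measure set T -> \bar R})
    (D : set T) (mD : measurable D) (f : T -> \bar R) :
  measurable_fun [set: T] f -> (forall x, 0 <= f x) ->
  \int[mrestr m mD]_x f x = \int[m]_(x in D) f x.
Proof.
move=> mf f0; transitivity (\int[mrestr m mD]_(x in D) f x).
  rewrite [RHS]integral_mkcond; apply: ge0_ae_eq_integral => //.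
  - by apply/(measurable_restrictT _ _).1 => //; exact: measurable_funTS.
  - by move=> x _; rewrite patchE; case: ifP.
  - exists (~` D); split; first exact: measurableC.
      by rewrite -[LHS]/(m (~` D `&` D)) setICl measure0.
    move=> x /=; apply: contra_notP; rewrite notK => Dx _.
    by rewrite patchE mem_set.
by apply: eq_measure_integral => A mA AD; rewrite -[LHS]/(m (A `&` D)) setIidl.
Qed.

Context {n : nat} (n_gt0 : (0 < n)%N).
Local Notation mu := (lebesgue_rV R n).
Implicit Types (x : 'rV[R]_n) (t : R).

Lemma measurable_esphere x t : measurable (esphere x t).
Proof.
have mf : measurable_fun [set: 'rV[R]_n] (fun z => enorm (z - x)).
  by apply: (measurableT_comp (@measurable_enorm R n)); exact: measurable_rVB.
by rewrite -[esphere x t]setTI; exact: (mf measurableT [set t] (measurable_set1 t)).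
Qed.

(** By construction the measure is a rescaled image of Lebesgue measure on the punctured ball under
    [w |-> x + t *: edir w]. The measures [m0] to [m4] retrace restriction, image, scaling, image,
    scaling, so that each operation can be moved onto the integrand. *)
Lemma ge0_integral_sphere_measure (h : 'rV[R]_n -> \bar R) x t :
  measurable_fun [set: 'rV[R]_n] h -> (forall z, 0 <= h z) -> (0 < t)%R ->
  \int[sphere_measure x t]_z h z =
  (t ^+ n.-1)%:E * (n%:R%:E * \int[mu]_(w in punctured_ball) h (x + t *: edir w)%R).
Proof.
move=> mh h0 t0.
pose m0 := mrestr mu (@measurable_punctured_ball R n).
pose m1 : {measure set 'rV[R]_n -> \bar R} :=
  measure_function_pushforward__canonical__measure_function_Measure m0 (@measurable_edir R n).
pose m2 : {measure set 'rV[R]_n -> \bar R} := mscale (NngNum (ler0n R n)) m1.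
pose m3 : {measure set 'rV[R]_n -> \bar R} :=
  measure_function_pushforward__canonical__measure_function_Measure m2 (measurable_rV_affine x t).
pose m4 : {measure set 'rV[R]_n -> \bar R} := mscale (NngNum (exprn_ge0 n.-1 (normr_ge0 t))) m3.
transitivity (\int[m4]_z h z); first exact: eq_measure_integral.
have mh1 : measurable_fun [set: 'rV[R]_n] (fun z => h (x + t *: z)%R).
  exact: (measurableT_comp mh (measurable_rV_affine x t)).
have mh2 : measurable_fun [set: 'rV[R]_n] (fun z => h (x + t *: edir z)%R).
  exact: (measurableT_comp mh1 (@measurable_edir R n)).
rewrite ge0_integral_mscale//= gtr0_norm//; congr (_ * _).
rewrite ge0_integral_pushforward//; last exact: measurable_rV_affine.
rewrite preimage_setT.
rewrite (@ge0_integral_mscale _ _ _ m1 setT measurableT _ _ mh1 (fun _ _ => h0 _)).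
congr (_ * _).
rewrite (@ge0_integral_pushforward _ _ _ _ _ _ (@measurable_edir R n) m0 setT _ measurableT mh1 (fun _ _ => h0 _)).
exact: (ge0_integral_mrestr _ (@measurable_punctured_ball R n) mh2 (fun=> h0 _)).
Qed.

(** The measure is carried by the sphere, because [x + t *: edir w] is at distance [t] from [x] for
    every nonzero [w]. *)
Lemma ge0_integral_esphere (h : 'rV[R]_n -> \bar R) x t :
  measurable_fun [set: 'rV[R]_n] h -> (forall z, 0 <= h z) -> (0 < t)%R ->
  \int[sphere_measure x t]_(z in esphere x t) h z = \int[sphere_measure x t]_z h z.
Proof.
move=> mh h0 t0; rewrite integral_mkcond !ge0_integral_sphere_measure//.
- congr (_ * (_ * _)); apply: eq_integral => w /set_mem /punctured_ballE w0.
  rewrite patchE mem_set// /esphere/= addrC addKr enormZ enorm_edir// mulr1.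
  by rewrite gtr0_norm.
- by apply/(measurable_restrictT _ _).1; [exact: measurable_esphere|exact: measurable_funTS].
- by move=> z; rewrite patchE; case: ifP.
Qed.

Lemma measurable_polar (H : 'rV[R]_n -> \bar R) x :
  measurable_fun [set: 'rV[R]_n] H -> (forall x, 0 <= H x) ->
  measurable_fun [set: 'rV[R]_n] (fun w =>
    \int[leb]_(r in `]0%R, +oo[) ((r ^+ n.-1)%:E * H (x + r *: edir w)%R)).
Proof.
move=> mH H0; under eq_fun do rewrite integral_mkcond_indic.
apply: (@measurable_integral_param _ _ _ _ _ _ (fun w r => _)) => [|w r].
  apply: emeasurable_funM; last first.
    apply/measurable_EFinP.
    exact: (measurableT_comp (@measurable_indic _ (measurableTypeR R) R setT _ (measurable_itv _)) measurable_snd).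
  apply: emeasurable_funM; first by apply/measurable_EFinP; exact: measurable_funX.
  apply: (measurableT_comp mH); apply: measurable_rVD => //; apply: measurable_rVZ => //.
  exact: (measurableT_comp (@measurable_edir R n) measurable_fst).
rewrite indicE mem_setE in_itv/= andbT; case: ltP => r0; last by rewrite mule0.
by rewrite mule1 mule_ge0// lee_fin exprn_ge0// ltW.
Qed.

(** The nonnegative formula is applied to the positive and negative parts; both have finite
    integrals, so the results may be subtracted. *)
Lemma integral_polar (H : 'rV[R]_n -> R) x : mu.-integrable setT (EFin \o H) ->
  mu.-integrable punctured_ball (fun w =>
    \int[leb]_(r in `]0%R, +oo[) (r ^+ n.-1 * H (x + r *: edir w))%:E) /\
  \int[mu]_z (H z)%:E = n%:R%:E * \int[mu]_(w in punctured_ball)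
    \int[leb]_(r in `]0%R, +oo[) (r ^+ n.-1 * H (x + r *: edir w))%:E.
Proof.
move=> iH; have [/measurable_EFinP mH _] := integrableP _ _ _ iH.
pose A (K : 'rV[R]_n -> \bar R) w := \int[leb]_(r in `]0%R, +oo[) ((r ^+ n.-1)%:E * K (x + r *: edir w)%R).
have mPB := @measurable_punctured_ball R n.
have iA (K : 'rV[R]_n -> \bar R) : (forall z, 0 <= K z) -> mu.-integrable setT K ->
    mu.-integrable punctured_ball (A K).
  move=> K0 iK; have mK := measurable_int _ iK.
  apply/integrableP; split; first by apply: measurable_funTS; exact: measurable_polar.
  have A0 w : 0 <= A K w.
    apply: integral_ge0 => r /=; rewrite in_itv/= andbT => r0.
    by rewrite mule_ge0// lee_fin exprn_ge0// ltW.
  under eq_integral do rewrite gee0_abs//.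
  have : \int[mu]_z K z < +oo.
    by have [_] := integrableP _ _ _ iK; under eq_integral do rewrite gee0_abs//.
  rewrite (ge0_polar n_gt0 x)// -/(A K).
  have [->|ny] := eqVneq (\int[mu]_(w in punctured_ball) A K w) +oo; last by move=> _; rewrite ltey.
  by rewrite gt0_muley// lte_fin ltr0n.
(* The integral is by definition the difference of the integrals of the two parts, so this holds on
   every ray, integrable or not. *)
have AE w : A (EFin \o H)^\+ w - A (EFin \o H)^\- w =
    \int[leb]_(r in `]0%R, +oo[) (r ^+ n.-1 * H (x + r *: edir w))%:E.
  rewrite [RHS]integralE; congr (_ - _); apply: eq_integral => r.
    rewrite inE/= in_itv/= andbT => r0.
    by rewrite !funeposE /= EFinM maxe_pMr ?mule0// lee_fin exprn_ge0// ltW.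
  rewrite inE/= in_itv/= andbT => r0.
  by rewrite !funenegE EFinM -muleN maxe_pMr ?mule0// lee_fin exprn_ge0// ltW.
have ip := integrable_funepos measurableT iH.
have im := integrable_funeneg measurableT iH.
have iAp := iA _ (funepos_ge0 _) ip; have iAm := iA _ (funeneg_ge0 _) im.
have AEf := funext AE; rewrite -AEf; split; first exact: integrableB.
rewrite (integralB mPB iAp iAm) muleBr//; last first.
  by rewrite fin_num_adde_defr// integrable_fin_num.
rewrite [LHS]integralE; congr (_ - _).
  exact: (ge0_polar n_gt0 x (measurable_int _ ip) (funepos_ge0 _)).
exact: (ge0_polar n_gt0 x (measurable_int _ im) (funeneg_ge0 _)).
Qed.

Lemma punctured_ball_sub_cube : punctured_ball `<=` (cube 1 : set 'rV[R]_n).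
Proof. by move=> z /andP[_ z1]; apply: le_trans (norm_le_enorm _) (ltW z1). Qed.

Lemma punctured_ball_lty : mu punctured_ball < +oo.
Proof.
apply: le_lt_trans (@cube_lty R n 1); apply: le_measure.
- by rewrite inE; exact: measurable_punctured_ball.
- by rewrite inE; exact: measurable_cube.
- exact: punctured_ball_sub_cube.
Qed.

(** In polar coordinates the integrand becomes [r^(n - 1 - a)] on [r >= t], integrable at infinity
    because [a > n]. *)
Lemma integral_radial_powR_lty x t (a : R) : (0 < t)%R -> (n%:R < a)%R ->
  \int[mu]_(z in [set z | t <= enorm (x - z)]%R) (enorm (x - z) `^ (- a))%:E < +oo.
Proof.
move=> t0 an; rewrite integral_mkcond.
have me : measurable_fun [set: 'rV[R]_n] (fun z => enorm (x - z)).
  by apply: (measurableT_comp (@measurable_enorm R n)); exact: measurable_rVB.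
have mS : measurable [set z | t <= enorm (x - z)]%R.
  rewrite -[X in measurable X]setTI.
  by apply: (@measurable_fun_ler _ _ _ _ (fun=> t)) => //.
rewrite (ge0_polar n_gt0 x); first last.
- by move=> z; rewrite patchE; case: ifP => // _; rewrite lee_fin powR_ge0.
- apply/(measurable_restrictT _ _).1 => //; apply: measurable_funTS.
  by apply/measurable_EFinP; apply: (measurableT_comp (measurable_powR (- a))).
rewrite (eq_integral (cst ((t `^ (- (a - n%:R)) / (a - n%:R))%:E))); last first.
  move=> w /set_mem /punctured_ballE w0.
  have an0 : (0 < a - n%:R)%R by rewrite subr_gt0.
  rewrite -integral_powR_itvcy// [RHS]integral_mkcond [LHS]integral_mkcond.
  have memS z : (z \in [set z | t <= enorm (x - z)]%R) = (t <= enorm (x - z))%R.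
    by apply/idP/idP => [/set_mem//|h]; exact/mem_set.
  apply: eq_integral => r _; rewrite !patchE memS !mem_setE !in_itv/= !andbT.
  rewrite opprD addrA subrr sub0r enormN enormZ enorm_edir// mulr1.
  have [r0|r0] := ltP 0%R r; last by rewrite leNgt (le_lt_trans r0 t0).
  rewrite gtr0_norm//; case: ifPn => tr; last by rewrite mule0.
  rewrite -EFinM -powR_mulrn ?(ltW r0)// -powRD; last by rewrite (gt_eqF r0) implybT.
  congr (_ `^ _)%:E; rewrite -subn1 natrB//; ring.
rewrite integral_cst//; last exact: measurable_punctured_ball.
by rewrite muleA -EFinM lte_mul_pinfty ?punctured_ball_lty// lee_fin mulr_ge0// divr_ge0 ?powR_ge0// subr_ge0 ltW.
Qed.

End polar_integrals.

(** * Smooth functions and mollification *)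

Section directional_derivatives.
Context {R : realType}.

Lemma is_derive_cvg (V : normedModType R) (f : V -> R) (a v : V) (df : R) :
  (h^-1 * (f (h *: v + a) - f a) @[h --> 0^'] --> df) <-> is_derive a v f df.
Proof.
split=> [h|[h <-]]; last exact: h.
by split; [apply/cvg_ex; exists df; exact: h|apply: cvg_lim => //; exact: h].
Qed.

(** Both sides are limits of one and the same difference quotient; one-variable calculus thus
    applies along lines. *)
Lemma is_derive_lineP (V : normedModType R) (f : V -> R) (a v : V) (df s : R) :
  is_derive (a + s *: v) v f df <-> is_derive s (1 : R) (fun h => f (a + h *: v)) df.
Proof.
rewrite -!is_derive_cvg.
rewrite (_ : (fun h : R => h^-1 * (f (h *: v + (a + s *: v)) - f (a + s *: v))) =
  (fun h : R => h^-1 * (f (a + (h *: (1 : R) + s) *: v) - f (a + s *: v))))//.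
apply/funext => h; congr (_ * (f _ - _)).
by rewrite [_ *: (1 : R)]mulr1 scalerDl addrCA.
Qed.

(** A quadratic remainder gives differentiability where no differentiation rule applies, as at the
    flat point of [flat_exp]. *)
Lemma is_derive_quadratic (f : R -> R) (x d C : R) :
  (forall h, `|h| <= 1 -> `|f (h + x) - f x - h * d| <= C * h ^+ 2) ->
  is_derive x (1 : R) f d.
Proof.
move=> fC; apply/is_derive_cvg; apply/cvgrPdist_le => e e0.
have C0 : 0 <= C.
  by have := fC 1; rewrite normr1 lexx expr1n mulr1 => /(_ erefl); apply: le_trans.
have eC : 0 < e / (C + 1) by rewrite divr_gt0// ltr_wpDl.
near=> h.
have h0 : h != 0 by near: h; exact: nbhs_dnbhs_neq.
have h1 : `|h| <= 1.
  by near: h; exact: dnbhs0_le.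
have he : `|h| <= e / (C + 1).
  by near: h; exact: dnbhs0_le.
rewrite [_ *: (1 : R)]mulr1.
rewrite -(ler_pM2l (_ : 0 < `|h|)) ?normr_gt0// -normrM mulrBr mulrA divff// mul1r.
rewrite -normrN opprB (le_trans (fC _ h1))//.
rewrite -(ger0_norm (sqr_ge0 h)) normrX expr2 mulrCA ler_wpM2l//.
rewrite (le_trans (ler_wpM2l C0 he))//.
by rewrite mulrCA ger_pMr// ler_pdivrMr ?ltr_wpDl// mul1r lerDl.
Unshelve. all: by end_near. Qed.

Lemma is_derive_affine (a b x : R) : is_derive x (1 : R) (fun h => a * h + b) a.
Proof.
apply: (@is_derive_quadratic _ _ _ 0) => h _.
by rewrite mul0r (_ : _ - _ = 0) ?normr0//; ring.
Qed.

End directional_derivatives.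

(** * The functions p(1/x) exp(-1/x), flat at the origin *)

Section exponential_bump.
Context {R : realType}.
Implicit Types (p : {poly R}) (x : R).

(* This family of functions is closed under derivation, which is what makes them
   smooth. *)
Definition flat_exp p x : R := if 0 < x then p.[x^-1] * expR (- x^-1) else 0.

Lemma horner_le_pow p y : 1 <= y ->
  `|p.[y]| <= (\sum_(i < size p) `|p`_i|) * y ^+ size p.
Proof.
move=> y1; rewrite horner_coef mulr_suml (le_trans (ler_norm_sum _ _ _))//.
apply: ler_sum => i _; rewrite normrM ler_wpM2l//.
rewrite normrX ger0_norm ?(le_trans ler01)//.
by rewrite ler_weXn2l// ltnW.
Qed.

(** From [expR (y / (m + 1)) >= y / (m + 1)], raised to the power [m + 1]. *)
Lemma pow_expRN_le (m : nat) (y : R) : 0 < y -> y ^+ m.+1 * expR (- y) <= m.+1%:R ^+ m.+1.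
Proof.
move=> y0; rewrite expRN ler_pdivrMr ?expR_gt0//.
have -> : expR y = expR (y / m.+1%:R) ^+ m.+1.
  by rewrite -expRM_natl mulrCA divff ?mulr1// pnatr_eq0.
rewrite -exprMn lerXn2r ?nnegrE ?mulr_ge0 ?expR_ge0//; first exact: ltW.
rewrite -ler_pdivrMl ?ltr0n// mulrC (le_trans _ (expR_ge1Dx _))//.
by rewrite lerDr.
Qed.

(** In the variable [y = 1 / x >= 1] the polynomial is at most a multiple of [y^(size p)], and
    [expR (- y)] absorbs [size p + 2] powers of [y]; the two spare ones give the factor [x^2]. *)
Lemma flat_exp_quadratic p : exists C, forall x, `|x| <= 1 -> `|flat_exp p x| <= C * x ^+ 2.
Proof.
set S := \sum_(i < size p) `|p`_i|.
have S0 : 0 <= S by apply: sumr_ge0.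
have [K hK] : exists K : R, forall y, 0 < y -> y ^+ (size p + 2) * expR (- y) <= K.
  by eexists => y y0; rewrite addn2; exact: pow_expRN_le.
exists (S * K) => x; rewrite ler_norml => /andP[_ x1].
have K0 : 0 <= K.
  by apply: le_trans (hK 1 ltr01); rewrite mulr_ge0 ?exprn_ge0 ?expR_ge0.
rewrite /flat_exp; case: ltP => x0; last first.
  by rewrite normr0; apply: mulr_ge0 (sqr_ge0 _); exact: mulr_ge0.
have y1 : 1 <= x^-1 by rewrite invr_ge1// unitfE gt_eqF.
rewrite normrM (ger0_norm (expR_ge0 _)).
apply: (@le_trans _ _ (S * x^-1 ^+ size p * expR (- x^-1))).
  by rewrite ler_wpM2r ?expR_ge0// horner_le_pow.
have -> : x^-1 ^+ size p = x^-1 ^+ (size p + 2) * x ^+ 2.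
  by rewrite exprD -mulrA -exprMn mulVf ?gt_eqF// expr1n mulr1.
have := hK x^-1; rewrite invr_gt0 => /(_ x0).
move: (_ ^+ (size p + 2)) (expR _) => u v uvK.
rewrite [leLHS](_ : _ = S * (u * v) * x ^+ 2); last by ring.
by apply: ler_wpM2r (sqr_ge0 _) _ _ _; exact: ler_wpM2l.
Qed.

(** With [y = 1 / x], whose derivative is [- y^2], differentiating [p(y) exp(- y)] gives
    [y^2 (p(y) - p'(y)) exp(- y)], again a member of the family. At 0 the quadratic bound yields the
    derivative 0. *)
Lemma is_derive_flat_exp p x :
  is_derive x (1 : R) (flat_exp p) (flat_exp ('X^2 * (p - p^`())) x).
Proof.
have [x0|x0|->] := ltgtP x 0.
- have -> : flat_exp ('X^2 * (p - p^`())) x = 0 by rewrite /flat_exp ltNge (ltW x0).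
  apply: (@near_eq_is_derive _ _ _ (cst 0)).
  near=> y; rewrite /flat_exp ltNge /=.
  by have /ltW -> : y < 0 by near: y; exact: lt_nbhsl.
- rewrite [X in is_derive _ _ _ X]/flat_exp x0.
  have xn0 : x != 0 by rewrite gt_eqF.
  have dV : is_derive x (1 : R) (fun y : R => y^-1) (- x ^- 2).
    by apply: is_derive_eq (is_deriveV xn0 (is_derive_id x 1)) _; rewrite [_ *: _]mulr1.
  have dp : is_derive x (1 : R) (fun y => p.[y^-1]) (p^`().[x^-1] * - x ^- 2).
    exact: (@is_derive1_comp R (horner p) (fun y => y^-1) x _ _ (is_derive_poly p x^-1) dV).
  have de : is_derive x (1 : R) (fun y => expR (- y^-1)) (expR (- x^-1) * (x ^- 2)).
    have dN : is_derive x (1 : R) (fun y : R => - y^-1) (x ^- 2).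
      by apply: is_derive_eq (is_deriveN dV) _; rewrite opprK.
    exact: (@is_derive1_comp R expR (fun y => - y^-1) x _ _ (is_derive_expR _) dN).
  have dpe : is_derive x (1 : R) (fun y => p.[y^-1] * expR (- y^-1))
      (('X^2 * (p - p^`())).[x^-1] * expR (- x^-1)).
    apply: is_derive_eq (is_deriveM dp de) _.
    rewrite /GRing.scale/= !hornerE/= exprVn; ring.
  apply: near_eq_is_derive dpe.
  near=> y; rewrite /flat_exp.
  by have -> : 0 < y by near: y; exact: lt_nbhsr.
- have -> : flat_exp ('X^2 * (p - p^`())) 0 = 0 by rewrite /flat_exp ltxx.
  have [C hC] := flat_exp_quadratic p.
  apply: (@is_derive_quadratic _ _ _ _ C) => h h1.
  rewrite addr0 mulr0 subr0 [X in _ - X](_ : _ = 0) ?subr0 ?hC//.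
  by rewrite /flat_exp ltxx.
Unshelve. all: by end_near. Qed.

Lemma flat_exp1_gt0 x : 0 < x -> 0 < flat_exp 1 x.
Proof. by move=> x0; rewrite /flat_exp x0 hornerE mul1r expR_gt0. Qed.

Lemma flat_exp1_ge0 x : 0 <= flat_exp 1 x.
Proof.
by have [/flat_exp1_gt0/ltW//|x0] := ltP 0 x; rewrite /flat_exp ltNge x0.
Qed.

Lemma flat_exp_eq0 p x : x <= 0 -> flat_exp p x = 0.
Proof. by move=> x0; rewrite /flat_exp ltNge x0. Qed.

End exponential_bump.

Section smooth_calculus.
Context {R : realType} {n : nat}.
Implicit Types (f g : 'rV[R]_n -> R) (i : 'I_n).
Local Notation e_ i := (delta_mx ord0 i : 'rV[R]_n).

(** [smooth] asks for all orders at once; exhibiting a class stable under partial derivatives avoids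
    carrying the order through each proof. *)
Lemma smooth_coind (S : set ('rV[R]_n -> R)) :
  (forall f, S f -> continuous f /\
     forall i, (forall x, derivable f x (e_ i)) /\ S (partial i f)) ->
  forall f, S f -> smooth f.
Proof.
move=> SP f Sf k; elim: k f Sf => [|k IH] f Sf /=; have [cf df] := SP f Sf.
  by move=> x _; exact: cf.
by move=> i; have [dfi Sfi] := df i; split => [x _|]; [exact: dfi|exact: IH].
Qed.

Lemma smooth_continuous f : smooth f -> continuous f.
Proof. by move=> /(_ 0) sf x; exact: sf. Qed.

Lemma smooth_derivable f i x : smooth f -> derivable f x (e_ i).
Proof. by move=> /(_ 1) /(_ i)[+ _]; exact. Qed.

Lemma smooth_partial f i : smooth f -> smooth (partial i f).
Proof. by move=> sf k; have [_] := sf k.+1 i. Qed.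

Lemma is_derive_partial f i x : smooth f -> is_derive x (e_ i) f (partial i f x).
Proof. by move=> sf; apply: DeriveDef => //; exact: smooth_derivable. Qed.

Lemma subr_continuous_rV (x : 'rV[R]_n) : continuous (fun z : 'rV[R]_n => z - x).
Proof. by move=> y; apply: (@cvgB R 'rV[R]_n _ (nbhs y) _ id (cst x) y x); [exact: cvg_id|exact: cvg_cst]. Qed.

Lemma smooth_translate f (x : 'rV[R]_n) : smooth f -> smooth (fun z => f (z - x)) /\
  forall i, partial i (fun z => f (z - x)) = (fun z => partial i f (z - x)).
Proof.
have dT g i : smooth g -> forall y, is_derive y (e_ i) (fun z => g (z - x)) (partial i g (y - x)).
  move=> sg y; have /is_derive_cvg h := is_derive_partial i (y - x) sg.
  by apply/is_derive_cvg; under eq_fun do rewrite -addrA.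
move=> sf; split; last first.
  by move=> i; apply/funext => y; have [] := dT f i sf y.
apply: (@smooth_coind [set h | exists g, smooth g /\ h = fun z => g (z - x)]); last by exists f.
move=> _ [g [sg ->]]; split.
  move=> y; apply: continuous_comp; last exact: smooth_continuous.
  exact: subr_continuous_rV.
move=> i; split; first by move=> y; have [] := dT g i sg y.
exists (partial i g); split; first exact: smooth_partial.
by apply/funext => y; have [] := dT g i sg y.
Qed.

(* Every member has partial derivatives that are again members, so all members
   are smooth by coinduction. *)
Inductive bump_algebra : ('rV[R]_n -> R) -> Prop :=
| bump_cst c : bump_algebra (fun=> c)
| bump_flat_exp p c d i : bump_algebra (fun z => flat_exp p (c * z ord0 i + d))
| bump_add f g : bump_algebra f -> bump_algebra g -> bump_algebra (fun z => f z + g z)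
| bump_mul f g : bump_algebra f -> bump_algebra g -> bump_algebra (fun z => f z * g z).

Lemma bump_algebra_derive f : bump_algebra f -> continuous f /\
  forall i, exists2 g, bump_algebra g & forall x, is_derive x (e_ i) f (g x).
Proof.
elim=> {f} [c|p c d j|f g bf [cf df] bg [cg dg]|f g bf [cf df] bg [cg dg]].
- split; first exact: cst_continuous.
  by move=> i; exists (fun=> 0) => [|x]; [exact: bump_cst|exact: is_derive_cst].
- split.
    move=> x; apply: (@continuous_comp _ _ _ (fun z : 'rV[R]_n => c * z ord0 j + d) (flat_exp p)).
      apply: (@cvgD R R _ (nbhs x) _ (fun z : 'rV[R]_n => c * z ord0 j) (cst d)); last exact: cvg_cst.
      by apply: (@cvgMr R _ (nbhs x) _ (fun z : 'rV[R]_n => z ord0 j)); exact: coord_continuous.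
    apply: differentiable_continuous; apply/derivable1_diffP.
    by have [] := is_derive_flat_exp p (c * x ord0 j + d).
  move=> i; exists (fun z => (c * (j == i)%:R) * flat_exp ('X^2 * (p - p^`())) (c * z ord0 j + d)).
    by apply: bump_mul; [exact: bump_cst|exact: bump_flat_exp].
  move=> x; rewrite -[X in is_derive X](addr0 x) -(scale0r (e_ i)).
  apply/is_derive_lineP.
  have dl : is_derive (0 : R) (1 : R) (fun h : R => c * (j == i)%:R * h + (c * x ord0 j + d)) (c * (j == i)%:R).
    exact: is_derive_affine.
  rewrite (_ : (fun h => _) = flat_exp p \o (fun h : R => c * (j == i)%:R * h + (c * x ord0 j + d))); last first.
    apply/funext => h /=; rewrite !mxE eqxx/=; congr flat_exp; ring.
  apply: is_derive_eq (@is_derive1_comp R (flat_exp p) _ 0 _ _ (is_derive_flat_exp _ _) dl) _.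
  by rewrite mulr0 add0r mulrC.
- split; first by move=> x; exact: (cvgD (cf x) (cg x)).
  move=> i; have [f' bf' df'] := df i; have [g' bg' dg'] := dg i.
  by exists (fun z => f' z + g' z); [exact: bump_add|move=> x; exact: is_deriveD].
- split; first by move=> x; exact: (cvgM (cf x) (cg x)).
  move=> i; have [f' bf' df'] := df i; have [g' bg' dg'] := dg i.
  exists (fun z => f z * g' z + g z * f' z); last by move=> x; exact: is_deriveM.
  by apply: bump_add; apply: bump_mul.
Qed.

Lemma bump_algebra_smooth f : bump_algebra f -> smooth f.
Proof.
apply: smooth_coind => {}f bf; have [cf df] := bump_algebra_derive bf.
split => // i; have [g bg dg] := df i; split; first by move=> x; have [] := dg x.
by rewrite /= (_ : partial i f = g)//; apply/funext => x; have [] := dg x.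
Qed.

Lemma bump_algebra_prod (I : Type) (s : seq I) (F : I -> 'rV[R]_n -> R) :
  (forall j, bump_algebra (F j)) -> bump_algebra (fun z => \prod_(j <- s) F j z).
Proof.
move=> bF; elim: s => [|j s IH].
  by under eq_fun do rewrite big_nil; exact: bump_cst.
by under eq_fun do rewrite big_cons; exact: bump_mul.
Qed.

End smooth_calculus.

(** * Test functions and local integrability *)

Section test_functions.
Context {R : realType} {n : nat}.
Implicit Types (f h : 'rV[R]_n -> R) (M : R).
Local Notation mu := (lebesgue_rV R n).
Local Notation e_ i := (delta_mx ord0 i : 'rV[R]_n).

Definition supported M h := forall z, M < `|z| -> h z = 0.

(** A compact set lies in a cube; conversely the closure of the nonvanishing set is a closed part of
    a compact cube. Supports are handled through the radius [M] from here on. *)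
Lemma test_functionP h : test_function h <-> smooth h /\ exists M, supported M h.
Proof.
split=> [[sh /compact_sub_cube[M M0 hM]]|[sh [M hM]]]; split => //.
  exists M => z zM; apply/eqP; apply: contraLR zM => hz.
  by rewrite -leNgt; apply: hM; exact: subset_closure.
have hMc : [set x | h x != 0] `<=` cube M.
  by move=> z /= hz; rewrite /cube/= leNgt; apply: contraNN hz => /hM ->.
apply: (@subclosed_compact _ _ (cube M)); first exact: closed_closure.
- exact: compact_cube.
- have -> : cube M = closure (cube M : set 'rV[R]_n).
    apply/closure_id; apply: compact_closed; last exact: compact_cube.
    exact: norm_hausdorff.
  exact: closureS.
Qed.

(** Beyond radius [M] the function vanishes in a whole neighbourhood, since [|y| > M] is an open
    condition. *)
Lemma supported_partial M h i : supported M h -> supported M (partial i h).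
Proof.
move=> hM z Mz; rewrite /partial (@near_eq_derive _ _ _ h (cst 0)).
  exact: derive_cst.
near=> y; apply: hM; near: y.
exact: (cvgr_gt `|z| (@norm_continuous _ _ z)).
Unshelve. all: by end_near. Qed.

Lemma test_function_partial h i : test_function h -> test_function (partial i h).
Proof.
move=> /test_functionP[sh [M hM]]; apply/test_functionP; split.
  exact: smooth_partial.
by exists M; exact: supported_partial.
Qed.

Lemma test_function_bounded h : test_function h -> exists C, forall z, `|h z| <= C.
Proof.
move=> /test_functionP[sh [M hM]].
have [M0|M0] := ltP M 0; first by exists 0 => z; rewrite hM ?normr0// (lt_le_trans M0).
have [| | |c _ hc] := @EVT_max_rV R n (fun z => `|h z|) (cube M).
- by exists 0; rewrite /cube/= normr0.
- exact: compact_cube.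
- apply: continuous_subspaceT => z; exact: (cvg_norm (@smooth_continuous _ _ _ sh z)).
exists `|h c| => z; have [zM|Mz] := leP `|z| M; first by rewrite hc// mem_set.
by rewrite hM// normr0.
Qed.

Lemma test_function_translate h x : test_function h ->
  test_function (fun z => h (z - x)).
Proof.
move=> /test_functionP[sh [M hM]]; apply/test_functionP; split.
  by have [] := smooth_translate x sh.
exists (M + `|x|) => z zM; apply: hM.
by rewrite (lt_le_trans _ (lerB_dist _ _))// ltrBrDr.
Qed.

Lemma test_function_measurable h : test_function h -> measurable_fun [set: 'rV[R]_n] h.
Proof. by move=> [sh _]; apply: continuous_measurable_rV; exact: smooth_continuous. Qed.

Lemma loc_integrable_cube f M : loc_integrable f -> mu.-integrable (cube M) (EFin \o f).
Proof. by move=> lf; apply: lf; exact: compact_cube. Qed.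

Lemma loc_integrableP f : (forall M, mu.-integrable (cube M) (EFin \o f)) -> loc_integrable f.
Proof.
move=> lf K cK; have [M _ KM] := compact_sub_cube cK.
by apply: integrableS (lf M) => //; [exact: measurable_cube|exact: compact_measurable_rV].
Qed.

Lemma loc_integrable_measurable f : loc_integrable f -> measurable_fun [set: 'rV[R]_n] f.
Proof.
move=> lf; rewrite -bigcup_cube; apply/measurable_fun_bigcup => [k|k].
  exact: measurable_cube.
by apply/measurable_EFinP; apply: measurable_int (loc_integrable_cube _ lf).
Qed.

Lemma integrable_cube_patch f M C : loc_integrable f ->
  mu.-integrable setT (EFin \o (fun z => C * `|f z| * \1_(cube M) z)).
Proof.
move=> lf; have mC := @measurable_cube R n M.
have i1 : mu.-integrable (cube M) (fun z => C%:E * (`|f z|)%:E)%E.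
  by apply: integrableZl => //; apply: integrable_norm; exact: loc_integrable_cube.
apply: (eq_integrable measurableT _ _ _ ((integrable_mkcond _ mC).1 i1)) => z _.
by rewrite epatch_indic/= !EFinM.
Qed.

Lemma integrable_mul_supported f h M C : loc_integrable f ->
  measurable_fun [set: 'rV[R]_n] h -> (forall z, `|h z| <= C) -> supported M h ->
  mu.-integrable setT (EFin \o (fun z => f z * h z)).
Proof.
move=> lf mh hC hM; apply: (le_integrable measurableT _ _ (integrable_cube_patch M C lf)).
  by apply/measurable_EFinP/measurable_funM => //; exact: loc_integrable_measurable.
move=> z _; rewrite /= lee_fin normrM.
have C0 : 0 <= C by exact: le_trans (hC 0).
rewrite [leRHS]ger0_norm ?mulr_ge0//.
have [zM|Mz] := leP `|z| M.
  by rewrite indicE mem_set// mulr1 mulrC ler_wpM2r.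
by rewrite hM// normr0 mulr0 mulr_ge0 ?mulr_ge0.
Qed.

End test_functions.

(** * Mollification: smoothness and weak derivatives *)

Section convolution.
Context {R : realType} {n : nat}.
Implicit Types (f h : 'rV[R]_n -> R) (M : R) (x : 'rV[R]_n) (i : 'I_n).
Local Notation mu := (lebesgue_rV R n).
Local Notation e_ i := (delta_mx ord0 i : 'rV[R]_n).

(** Needed because dominated convergence speaks of sequences. If continuity failed, points [u k]
    within [1 / (k + 1)] of [x] would form a convergent counterexample. *)
Lemma cvg_seq_continuous_rV f x :
  (forall u : nat -> 'rV[R]_n, u @ \oo --> x -> f (u k) @[k --> \oo] --> f x) ->
  {for x, continuous f}.
Proof.
move=> fu; apply/(@cvgrPdist_lt R R _ (nbhs x) _ f (f x)) => e e0; apply: contrapT => nn.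
have /choice[u uP] (k : nat) : exists u, `|x - u| < k.+1%:R^-1 /\ e <= `|f x - f u|.
  apply: contrapT => /forallNP nu; apply: nn; apply/(@nbhs_normP R 'rV[R]_n x).
  exists k.+1%:R^-1 => /=; first by rewrite invr_gt0.
  by move=> y xy; rewrite ltNge; apply/negP => ey; apply: (nu y).
have ux : u @ \oo --> x.
  apply/cvgrPdist_lt => d d0; near=> k.
  rewrite (lt_trans (uP k).1)//; near: k; exact: near_infty_natSinv_lt (PosNum d0).
have /cvgrPdist_lt/(_ e e0)[N _ /(_ N (leqnn N))/=] := fu u ux.
by rewrite ltNge (uP N).2.
Unshelve. all: by end_near. Qed.

Lemma dominated_Rintegral_cvg d (T : measurableType d) (m : {measure set T -> \bar R})
    (F : nat -> T -> R) (f g : T -> R) (D : set T) : measurable D ->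
  (forall k, measurable_fun D (F k)) -> measurable_fun D f ->
  (forall y, D y -> F k y @[k --> \oo] --> f y) ->
  m.-integrable D (EFin \o g) -> (forall k y, D y -> `|F k y| <= g y) ->
  m.-integrable D (EFin \o f) /\
  (\int[m]_(y in D) F k y @[k --> \oo] --> \int[m]_(y in D) f y).
Proof.
move=> mD mF mf Ff ig Fg.
have [| | | | |if_ _ cF] := @dominated_convergence _ T R m D mD (fun k => EFin \o F k) (EFin \o f) (EFin \o g).
- by move=> k; exact/measurable_EFinP.
- exact/measurable_EFinP.
- apply: aeW => x Dx; apply/fine_cvgP; split; first exact: nearW.
  exact: Ff.
- exact: ig.
- by apply: aeW => x k Dx; rewrite /= lee_fin; exact: Fg.
- split => //; apply: fine_cvg; rewrite fineK//; exact: integrable_fin_num.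
Qed.

(** A correlation rather than a convolution: the kernel is [h (z - x)]. Differentiating in [x] then
    produces a minus sign, which the one in the definition of the weak gradient cancels. *)
Definition mollify f h x : R := \int[mu]_z (f z * h (z - x)).

Lemma integrable_mollify f h x : loc_integrable f -> test_function h ->
  mu.-integrable setT (EFin \o (fun z => f z * h (z - x))).
Proof.
move=> lf th; have thx := test_function_translate x th.
have [C hC] := test_function_bounded thx.
have [_ [M hM]] := (test_functionP _).1 thx.
exact: (integrable_mul_supported lf (test_function_measurable thx) hC hM).
Qed.

Lemma continuous_mollify f h : loc_integrable f -> test_function h -> continuous (mollify f h).
Proof.
move=> lf th x; apply: cvg_seq_continuous_rV => u ux.
have [C hC] := test_function_bounded th.
have C0 : 0 <= C by exact: le_trans (hC 0).
have [sh [M hM]] := (test_functionP _).1 th.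
(* From rank [N] on, the translates by [u k] are supported in one cube of radius [M + |x| + 1],
   which provides a dominating function; the sequence is shifted by [N] accordingly. *)
have [N _ uN] : \forall k \near \oo, `|x - u k| <= 1 by move/cvgrPdist_le : ux; exact.
rewrite -(cvg_shiftn N).
have mf := loc_integrable_measurable lf.
have mh y : measurable_fun [set: 'rV[R]_n] (fun z => h (z - y)).
  by apply: test_function_measurable; exact: test_function_translate.
have [| | | | | |_ //] := @dominated_Rintegral_cvg _ _ mu (fun k z => f z * h (z - u (k + N)%N))
  (fun z => f z * h (z - x)) (fun z => C * `|f z| * \1_(cube (M + (`|x| + 1))) z) setT.
- exact: measurableT.
- by move=> k; apply: measurable_funM.
- exact: measurable_funM.
- move=> z _; apply: cvgMr.
  have uNx : u (k + N)%N @[k --> \oo] --> x by rewrite (cvg_shiftn N).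
  have zuNx : z - u (k + N)%N @[k --> \oo] --> z - x by apply: cvgB => //; exact: cvg_cst.
  exact: (cvg_comp _ _ zuNx (@smooth_continuous _ _ _ sh (z - x))).
- exact: integrable_cube_patch.
- move=> k z _; rewrite normrM.
  have [zM|Mz] := leP `|z| (M + (`|x| + 1)).
    by rewrite indicE mem_set// mulr1 mulrC ler_wpM2r.
  rewrite hM ?normr0 ?mulr0 ?mulr_ge0//.
  rewrite (lt_le_trans _ (lerB_dist _ _))// ltrBrDr (le_lt_trans _ Mz)// lerD2l.
  rewrite -(subrK x (u (k + N)%N)) addrC (le_trans (ler_normD _ _))// lerD2l distrC.
  by apply: uN; rewrite /= leq_addl.
Qed.

(** Differentiation under the integral sign along the line [x + s e_i]. For [|s| < 1] all supports
    lie in one cube, so a multiple of [|f|] on that cube dominates the derivatives in [s]. *)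
Lemma is_derive_mollify f h i x : loc_integrable f -> test_function h ->
  is_derive x (e_ i) (mollify f h) (- mollify f (partial i h) x).
Proof.
move=> lf th.
have th' := test_function_partial i th.
have [C hC] := test_function_bounded th'.
have C0 : 0 <= C by exact: le_trans (hC 0).
have [sh [M hM]] := (test_functionP _).1 th.
have dline z (s : R) : is_derive s (1 : R) (fun s : R => f z * h (z - (x + s *: e_ i)))
    (- (f z * partial i h (z - (x + s *: e_ i)))).
  have dl : is_derive s (1 : R) (fun s : R => (-1) * s + 0) (-1) by exact: is_derive_affine.
  have dh t : is_derive t (1 : R) (fun t => h ((z - x) + t *: e_ i)) (partial i h (z - x + t *: e_ i)).
    exact: ((is_derive_lineP h (z - x) (e_ i) _ t).1 (is_derive_partial i _ sh)).
  have zE t : z - x + ((-1) * t + 0) *: e_ i = z - (x + t *: e_ i).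
    by rewrite addr0 mulN1r scaleNr -addrA -opprD.
  rewrite (_ : (fun t : R => _) = f z \*: ((fun t => h (z - x + t *: e_ i)) \o (fun s : R => (-1) * s + 0))); last first.
    by apply/funext => t /=; rewrite zE.
  apply: is_derive_eq (is_deriveZ (f z) (@is_derive1_comp R _ _ s _ _ (dh ((-1) * s + 0)) dl)) _.
  by rewrite zE /GRing.scale/= mulrN1 mulrN.
rewrite -[X in is_derive X](addr0 x) -(scale0r (e_ i)).
apply: (is_derive_lineP _ x (e_ i) _ 0).2.
have intf (s : R) : `]-1, 1[%classic s -> mu.-integrable setT (EFin \o (fun z => f z * h (z - (x + s *: e_ i)))).
  by move=> _; exact: integrable_mollify.
have intG : mu.-integrable setT (EFin \o (fun z => C * `|f z| * \1_(cube (M + (`|x| + 1))) z)).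
  exact: integrable_cube_patch.
have G0 z : 0 <= C * `|f z| * \1_(cube (M + (`|x| + 1))) z by rewrite !mulr_ge0// indicE.
have Gub (s : R) z : `]-1, 1[%classic s -> setT z ->
    `|partial1of2 (fun s z => f z * h (z - (x + s *: e_ i))) s z| <= C * `|f z| * \1_(cube (M + (`|x| + 1))) z.
  rewrite /= in_itv/= => /andP[s1 s2] _.
  rewrite partial1of2E; have [_ ->] := dline z s; rewrite normrN normrM.
  have [zM|Mz] := leP `|z| (M + (`|x| + 1)).
    by rewrite indicE mem_set// mulr1 mulrC ler_wpM2r.
  rewrite (supported_partial i hM) ?normr0 ?mulr0//.
  rewrite (lt_le_trans _ (lerB_dist _ _))// ltrBrDr (le_lt_trans _ Mz)// lerD2l.
  rewrite (le_trans (ler_normD _ _))// lerD2l normrZ.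
  rewrite (@le_trans _ _ `|s|)//; last by rewrite ler_norml !ltW.
  rewrite ler_piMr//; apply/rV_norm_leP => // j; rewrite mxE eqxx/=.
  by case: eqP; rewrite ?normr1 ?normr0.
have dI : \int[mu]_z partial1of2 (fun s z => f z * h (z - (x + s *: e_ i))) 0 z =
    - mollify f (partial i h) x.
  rewrite /mollify -mulN1r -RintegralZl//; last exact: integrable_mollify.
  apply: eq_Rintegral => z _; rewrite partial1of2E.
  by have [_ ->] := dline z 0; rewrite mulN1r scale0r addr0.
have := @cvg_differentiation_under_integral R _ _ mu
  (fun s z => f z * h (z - (x + s *: e_ i))) setT measurableT 0 (-1) 1 _ intf _ _ G0 intG Gub.
rewrite dI.
move=> hcvg; apply/is_derive_cvg; under eq_fun do rewrite [_ *: (1 : R)]mulr1.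
apply: hcvg; first by rewrite /= in_itv/= ltrN10 ltr01.
by move=> s z _ _; have [] := dline z s.
Unshelve. all: by end_near. Qed.

Lemma partial_mollify f h i : loc_integrable f -> test_function h ->
  partial i (mollify f h) = (fun x => - mollify f (partial i h) x).
Proof. by move=> lf th; apply/funext => x; have [_] := is_derive_mollify i x lf th. Qed.

Lemma smooth_mollify f h : loc_integrable f -> test_function h -> smooth (mollify f h).
Proof.
(* Multiples of mollifications form a stable class: the factor [c] absorbs the sign that each
   derivative produces. *)
move=> lf th; apply: (@smooth_coind _ _
  [set g | exists c h, test_function h /\ g = fun x => c * mollify f h x]); last first.
  by exists 1, h; split => //; apply/funext => x; rewrite mul1r.
move=> _ [c [{}h [{}th ->]]]; split.
  by move=> x; exact: (cvgMr (continuous_mollify lf th (x:=x))).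
have dc i x : is_derive x (e_ i) (fun x => c * mollify f h x) (- c * mollify f (partial i h) x).
  by apply: is_derive_eq (is_deriveZ c (is_derive_mollify i x lf th)) _; rewrite /GRing.scale/= mulNr mulrN.
move=> i; split; first by move=> x; have [] := dc i x.
exists (- c), (partial i h); split; first exact: test_function_partial.
by apply/funext => x; have [] := dc i x.
Qed.

Lemma partial_mollify_weak f G h i : weak_gradient f G -> test_function h ->
  partial i (mollify f h) = mollify (fun z => G z ord0 i) h.
Proof.
move=> [lf lG fG] th; rewrite partial_mollify//; apply/funext => x.
have [_ /(_ i) pE] := smooth_translate x th.1.
have := fG _ (test_function_translate x th) i.
by rewrite pE /mollify => ->; rewrite opprK.
Qed.

End convolution.

(** * Continuity of translations in L^1 on bounded sets *)

Section translation_continuity.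
Context {R : realType} {n : nat}.
Implicit Types (f g h : 'rV[R]_n -> R) (M e d : R) (x y : 'rV[R]_n).
Local Notation mu := (lebesgue_rV R n).
Local Open Scope ereal_scope.

Lemma measurable_fun_translate dT (T : measurableType dT) (f : 'rV[R]_n -> T) y :
  measurable_fun [set: 'rV[R]_n] f -> measurable_fun [set: 'rV[R]_n] (fun x => f (x + y)%R).
Proof.
by move=> mf; apply: (measurableT_comp mf); exact: measurable_rVD.
Qed.

Lemma measurable_absB f g : measurable_fun [set: 'rV[R]_n] f ->
  measurable_fun [set: 'rV[R]_n] g ->
  measurable_fun [set: 'rV[R]_n] (fun x => `|f x - g x|%:E)%R.
Proof.
move=> mf mg; apply/measurable_EFinP; apply: measurableT_comp => //.
exact: measurable_funB.
Qed.

Lemma ge0_integral_translate (f : 'rV[R]_n -> \bar R) y :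
  measurable_fun [set: 'rV[R]_n] f -> (forall x, 0 <= f x) ->
  \int[mu]_x f (x + y)%R = \int[mu]_x f x.
Proof.
move=> mf f0; rewrite [RHS](@ge0_integral_rV_affine _ n f y 1)//.
rewrite expr1n mul1e; apply: eq_integral => x _.
by rewrite scale1r addrC.
Qed.

Lemma integral_cube_translate_le (f : 'rV[R]_n -> \bar R) M d y :
  measurable_fun [set: 'rV[R]_n] f -> (forall x, 0 <= f x) -> (`|y| <= d)%R ->
  \int[mu]_(x in cube M) f (x + y)%R <= \int[mu]_(x in cube (M + d)) f x.
Proof.
move=> mf f0 yd; rewrite [leRHS]integral_mkcond_indic.
have mi : measurable_fun [set: 'rV[R]_n] (fun x => f x * (\1_(cube (M + d)) x)%:E).
  apply: emeasurable_funM => //; apply/measurable_EFinP; apply: measurable_indic.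
  exact: measurable_cube.
have i0 x : 0 <= f x * (\1_(cube (M + d)) x)%:E by rewrite mule_ge0.
rewrite -(ge0_integral_translate y mi i0) integral_mkcond_indic.
apply: ge0_le_integral => //.
- by move=> x _; rewrite mule_ge0.
- apply: emeasurable_funM; first exact: measurable_fun_translate.
  by apply/measurable_EFinP; apply: measurable_indic; exact: measurable_cube.
- exact: (measurable_fun_translate y mi).
- move=> x _; rewrite lee_wpmul2l// lee_fin !indicE.
  case: (boolP (x \in cube M)) => // /set_mem xM; rewrite mem_set//.
  by rewrite /cube/= (le_trans (ler_normD _ _))// lerD.
Qed.

Definition translation_continuous f := forall M e, (0 < e)%R ->
  exists2 d, (0 < d)%R & forall y, (`|y| <= d)%R ->
    \int[mu]_(x in cube M) `|f (x + y) - f x|%:E <= e%:E.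

Local Notation tc := translation_continuous.

(** Phrased with a pointwise bound on increments so as to cover sums and indicators of unions
    alike. *)
Lemma tc_dom2 f g h : measurable_fun [set: 'rV[R]_n] f ->
  measurable_fun [set: 'rV[R]_n] g -> measurable_fun [set: 'rV[R]_n] h ->
  (forall x y, `|h x - h y| <= `|f x - f y| + `|g x - g y|)%R ->
  tc f -> tc g -> tc h.
Proof.
move=> mf mg mh hfg tf tg M e e0.
have e20 : (0 < e / 2)%R by rewrite divr_gt0.
have [d1 d10 fd] := tf M _ e20; have [d2 d20 gd] := tg M _ e20.
exists (minr d1 d2) => [|y]; first by rewrite lt_min d10.
rewrite le_min => /andP[y1 y2].
have mD (k : 'rV[R]_n -> R) : measurable_fun [set: 'rV[R]_n] k ->
    measurable_fun (cube M) (fun x => `|k (x + y) - k x|%:E)%R.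
  by move=> mk; apply: measurable_funTS; apply: measurable_absB => //; exact: measurable_fun_translate.
rewrite (splitr e) EFinD; apply: le_trans (leeD (fd y y1) (gd y y2)).
rewrite -ge0_integralD//; [|exact: measurable_cube|exact: mD|exact: mD].
apply: ge0_le_integral => //.
- exact: measurable_cube.
- exact: mD.
- by apply: emeasurable_funD; exact: mD.
- by move=> x _; rewrite -EFinD lee_fin; exact: hfg.
Qed.

(** A three-epsilon argument. The approximation is taken on the cube enlarged by 1, which contains
    every translate of the original cube by [|y| <= 1]. *)
Lemma tc_closed g : measurable_fun [set: 'rV[R]_n] g ->
  (forall M e, (0 < e)%R -> exists h, [/\ measurable_fun [set: 'rV[R]_n] h, tc h &
     \int[mu]_(x in cube M) `|g x - h x|%:E <= e%:E]) -> tc g.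
Proof.
move=> mg gh M e e0.
have e30 : (0 < e / 3)%R by rewrite divr_gt0.
have [h [mh th ghe]] := gh (M + 1)%R _ e30.
have [d d0 hd] := th M _ e30.
exists (minr d 1%R) => [|y]; first by rewrite lt_min d0/=.
rewrite le_min => /andP[yd y1].
have mC := @measurable_cube R n M.
have mgh := measurable_absB mg mh.
have mhh : measurable_fun [set: 'rV[R]_n] (fun x => `|h (x + y) - h x|%:E)%R.
  by apply: measurable_absB => //; exact: measurable_fun_translate.
apply: (@le_trans _ _ (\int[mu]_(x in cube M) (`|g (x + y) - h (x + y)|%:E +
    (`|h (x + y) - h x|%:E + `|g x - h x|%:E))%R)).
  apply: ge0_le_integral => //.
  - apply: measurable_funTS; apply: measurable_absB => //; exact: measurable_fun_translate.
  - apply: measurable_funTS; apply: emeasurable_funD.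
      exact: (measurable_fun_translate y mgh).
    exact: emeasurable_funD.
  - move=> x _; rewrite lee_fin.
    rewrite (_ : g (x + y) - g x = (g (x + y) - h (x + y)) + ((h (x + y) - h x) - (g x - h x)))%R; last by ring.
    rewrite (le_trans (ler_normD _ _))// lerD2l (le_trans (ler_normB _ _))//.
have m1 : measurable_fun (cube M) (fun x => `|g (x + y) - h (x + y)|%:E)%R.
  by apply: measurable_funTS; exact: (measurable_fun_translate y mgh).
have m2 : measurable_fun (cube M) (fun x => `|h (x + y) - h x|%:E)%R by exact: measurable_funTS.
have m3 : measurable_fun (cube M) (fun x => `|g x - h x|%:E)%R by exact: measurable_funTS.
have m4 : measurable_fun (cube M) (fun x => `|h (x + y) - h x|%:E%R + `|g x - h x|%:E%R).
  exact: emeasurable_funD.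
rewrite (ge0_integralD mu mC (fun _ _ => _) m1 (fun _ _ => _) m4)//; last first.
  by move=> x _; rewrite adde_ge0.
rewrite (ge0_integralD mu mC (fun _ _ => _) m2 (fun _ _ => _) m3)//.
rewrite (_ : e = e / 3 + (e / 3 + e / 3))%R; last by field.
rewrite !EFinD; apply: leeD.
  apply: le_trans ghe.
  exact: (@integral_cube_translate_le (fun x => `|g x - h x|%:E)%R).
apply: leeD; first exact: hd.
apply: le_trans ghe; apply: ge0_subset_integral => //.
- exact: measurable_cube.
- exact: measurable_funTS.
- by apply: le_cube; rewrite lerDl.
Qed.

Definition tc_set (A : set 'rV[R]_n) := measurable A /\ tc (\1_A).

(** A complement has the same increments up to sign. A countable union is approximated by its finite
    subunions [B m]: inside a cube, which has finite measure, the remainders [D m] decrease to the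
    empty set, so their measures tend to 0. *)
Lemma tc_set_sigma_algebra : sigma_algebra setT tc_set.
Proof.
have tc0 : tc_set set0.
  split => // M e e0; exists 1%R => // y _.
  by rewrite integral0_eq ?lee_fin ?ltW// => x _; rewrite !indicE !in_set0 subrr normr0.
have tcU A B : tc_set A -> tc_set B -> tc_set (A `|` B).
  move=> [mA tA] [mB tB]; split; first exact: measurableU.
  apply: tc_dom2 tA tB; try (apply: measurable_indic => //; exact: measurableU).
  move=> x y; rewrite !indicE !in_setU.
  by do 4!case: (_ \in _) => /=; rewrite ?subrr ?normr0 ?subr0 ?sub0r ?normrN ?normr1 ?addr0 ?add0r ?addr_ge0 ?ler01 ?lerDl ?lexx.
split => //.
- move=> A [mA tA]; rewrite setTD; split; first exact: measurableC.
  move=> M e e0; have [d d0 Ad] := tA M e e0; exists d => // y yd.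
  apply: le_trans (Ad y yd); rewrite le_eqVlt; apply/orP; left; apply/eqP.
  apply: eq_integral => x _; congr EFin; rewrite !indicE !in_setC.
  by do 2!case: (_ \in A); rewrite /= ?subrr ?subr0 ?sub0r ?normrN.
- move=> F tF.
  have mF k : measurable (F k) by have [] := tF k.
  have mU : measurable (\bigcup_k F k) by exact: bigcup_measurable.
  split => //; apply: tc_closed; first exact: measurable_indic.
  move=> M e e0.
  pose B m := \big[setU/set0]_(k < m) F k.
  have tB m : tc_set (B m).
    by rewrite /B; elim/big_ind : _.
  pose D m := cube M `&` (\bigcup_k F k `\` B m).
  have mD m : measurable (D m).
    by apply: measurableI; [exact: measurable_cube|apply: measurableD => //; case: (tB m)].
  have : mu (D m) @[m --> \oo] --> mu (\bigcap_m D m).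
    apply: nonincreasing_cvg_mu => //.
    - apply: le_lt_trans (@cube_lty R n M); apply: le_measure; rewrite ?inE//.
        exact: measurable_cube.
      by move=> x [].
    - exact: bigcap_measurable.
    - move=> a b ab; apply/subsetPset => x [xM [xF xB]]; split => //; split => //.
      by move: xB; apply: contra_not; exact: subset_bigsetU.
  rewrite (_ : \bigcap_m D m = set0); last first.
    apply/seteqP; split => // x xD.
    have [_ [[k _ Fkx] _]] := xD 0%N I.
    have [_ [_]] := xD k.+1 I; apply.
    by rewrite /B -bigcup_mkord; exists k => /=.
  rewrite measure0 => /fine_cvgP[Dfin /cvgrPdist_le/(_ e e0) De].
  have [m [Dmf Dme]] : exists m, mu (D m) \is a fin_num /\ (`|0 - fine (mu (D m))| <= e)%R.
    near \oo => m; exists m; split; near: m => //.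
  exists (\1_(B m)); have [mB tcB] := tB m; split => //.
  apply: (@le_trans _ _ (mu (D m))); last first.
    rewrite -(fineK Dmf) lee_fin; move: Dme.
    by rewrite sub0r normrN ger0_norm ?fine_ge0.
  rewrite le_eqVlt; apply/orP; left; apply/eqP.
  rewrite /D setIC -integral_indic//; last 2 first.
  - exact: measurable_cube.
  - exact: measurableD.
  apply: eq_integral => x _; congr EFin; rewrite !indicE in_setD.
  have [xB|_] := boolP (x \in B m); last by case: (_ \in _); rewrite ?subr0 ?normr1 ?normr0.
  rewrite (_ : x \in \bigcup_k F k) ?subrr ?normr0//.
  apply/mem_set; move/set_mem : xB; rewrite /B -bigcup_mkord => -[k _ Fk].
  by exists k.
Unshelve. all: by end_near. Qed.

(** Half-lines []a, +oo[] generate. For them a translation by [|y| <= d] changes the indicator only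
    in the slab [|z_i - a| <= d], whose part in the cube has measure proportional to [d]. *)
Lemma tc_set_coord (i : 'I_n) (Y : set R) : measurable Y ->
  tc_set [set z : 'rV[R]_n | Y (z ord0 i)].
Proof.
pose c (z : 'rV[R]_n) : R := z ord0 i.
have mE : (@measurable _ (measurableTypeR R)) = <<s @RGenOInfty.G R >> := RGenOInfty.measurableE R.
move=> mY; have {mY} : <<s @RGenOInfty.G R >> Y by rewrite -mE.
move: Y; apply: smallest_sub.
- have [t0 tC tU] := tc_set_sigma_algebra; split.
  + exact: t0.
  + by move=> A /tC; rewrite !setTD.
  + move=> F tF; have := tU (fun k => [set z : 'rV[R]_n | F k (z ord0 i)]) tF.
    rewrite (_ : \bigcup_k _ = [set z : 'rV[R]_n | (\bigcup_k F k) (z ord0 i)])//.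
- move=> _ [a ->].
  have mS (b : R) : measurable [set z : 'rV[R]_n | `]b, +oo[%classic (z ord0 i)].
    rewrite -[X in measurable X]setTI.
    by apply: (@measurable_coord R n i) => //; exact: measurable_itv.
  split => // M e e0.
  have [M0|M0] := ltP M 0%R.
    exists 1%R => // y _; rewrite (_ : cube M = set0) ?integral_set0 ?lee_fin ?ltW//.
    by apply/seteqP; split => // z /= /(le_trans (normr_ge0 _)); rewrite leNgt M0.
  pose K := (\prod_(j < n | j != i) (2 * M))%R.
  have K0 : (0 <= K)%R by apply: prodr_ge0 => j _; rewrite mulr_ge0.
  (* [K] is the measure of a face of the cube, so the slab has measure [2 d K = e K / (K + 1)];
     adding 1 keeps the denominator positive. *)
  exists (e / (2 * (K + 1)))%R => [|y yd]; first by rewrite divr_gt0// mulr_gt0// ltr_wpDl.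
  set d := (e / (2 * (K + 1)))%R in yd *.
  have d0 : (0 < d)%R by rewrite divr_gt0// mulr_gt0// ltr_wpDl.
  pose A (j : 'I_n) : set (measurableTypeR R) := if j == i then `[(a - d)%R, (a + d)%R]%classic else `[(- M)%R, M]%classic.
  have mA j : measurable (A j) by rewrite /A; case: ifP => _; exact: measurable_itv.
  pose S := [set z : 'rV[R]_n | forall j, A j (z ord0 j)].
  have mSS : measurable S.
    rewrite (_ : S = \bigcap_(j in [set: 'I_n]) [set z : 'rV[R]_n | A j (z ord0 j)]).
      apply: fin_bigcap_measurable => // j _; rewrite -[X in measurable X]setTI.
      by apply: (@measurable_coord R n j) => //; exact: mA.
    by apply/seteqP; split => z h; [move=> j _|move=> j]; exact: h.
  apply: (@le_trans _ _ (mu S)).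
    rewrite integral_mkcond_indic -(setIT S) -integral_indic//.
    apply: ge0_le_integral => //.
    - apply: emeasurable_funM.
        apply: measurable_absB; last exact: measurable_indic.
        by apply: measurable_fun_translate; exact: measurable_indic.
      by apply/measurable_EFinP; apply: measurable_indic; exact: measurable_cube.
    - by apply/measurable_EFinP; exact: measurable_indic.
    - move=> x _; rewrite -EFinM lee_fin.
      have [xM|xM] := boolP (x \in cube M); last by rewrite [X in (_ * X)%R]indicE (negbTE xM) mulr0.
      rewrite [X in (_ * X)%R]indicE xM mulr1.
      have [xS|xS] := boolP (x \in S).
        by rewrite [leRHS]indicE xS !indicE; do 2!case: (_ \in _); rewrite ?subrr ?normr0 ?subr0 ?sub0r ?normrN ?normr1.
      rewrite !indicE (negbTE xS).
      suff -> : ((x + y)%R \in [set z : 'rV[R]_n | `]a, +oo[%classic (z ord0 i)]) = (x \in [set z : 'rV[R]_n | `]a, +oo[%classic (z ord0 i)]).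
        by rewrite subrr normr0.
      have xa : (d < `|x ord0 i - a|)%R.
        rewrite ltNge; apply: contraNN xS => xa; apply/mem_set => j.
        rewrite /A; case: eqP => [->|_]; first by rewrite /= in_itv/= -ler_distl.
        move/set_mem : xM => /rV_norm_leP => /(_ M0 j).
        by rewrite /= in_itv/= ler_norml.
      have yi : (`|y ord0 i| <= d)%R by exact: le_trans (ler_coord_norm _ _) yd.
      apply/idP/idP => /set_mem /=; rewrite in_itv/= andbT => h; apply/mem_set => /=; rewrite in_itv/= andbT; move: h; rewrite mxE.
        by move: xa yi; rewrite ltr_normr ler_norml => /orP[|]; lra.
      by move: xa yi; rewrite ltr_normr ler_norml => /orP[|]; lra.
  rewrite /S (lebesgue_rV_prod mA) (bigD1 i)//= {1}/A eqxx lebesgue_measure_itv/= lte_fin.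
  have -> : (a - d < a + d)%R by lra.
  rewrite -EFinD.
  rewrite (eq_bigr (fun j => (2 * M)%R%:E)); last first.
    move=> j ji; rewrite /A (negbTE ji) lebesgue_measure_itv/= lte_fin.
    case: ltP => [_|MM]; first by rewrite -EFinD; congr EFin; ring.
    by congr EFin; lra.
  rewrite prodEFin -EFinM lee_fin -/K.
  rewrite (_ : (a + d - (a - d)) * K = e * (K / (K + 1)))%R; last first.
    by rewrite /d; field; rewrite gt_eqF ?ltr_wpDl.
  by rewrite ger_pMr// ler_pdivrMr ?ltr_wpDl// mul1r lerDl.
Qed.

Lemma tc_measurable_set (A : set 'rV[R]_n) : measurable A -> tc_set A.
Proof.
apply: smallest_sub; first exact: tc_set_sigma_algebra.
rewrite -bigcup_seq; apply: bigcup_sub => i _.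
by move=> _ [B mB <-]; rewrite setTI; exact: tc_set_coord.
Qed.

End translation_continuity.

(** * Mollifiers and approximation in local L^1 *)

Section mollification.
Context {R : realType} {n : nat}.
Implicit Types (f g h rho : 'rV[R]_n -> R) (M e d : R) (x y : 'rV[R]_n).
Local Notation mu := (lebesgue_rV R n).
Local Open Scope ereal_scope.
Local Notation tc := translation_continuous.
Import HBSimple.

Lemma tcZ (c : R) f : measurable_fun [set: 'rV[R]_n] f -> tc f -> tc (fun x => c * f x)%R.
Proof.
move=> mf tf M e e0.
have c10 : (0 < `|c| + 1)%R by rewrite ltr_wpDl.
have [d d0 fd] := tf M (e / (`|c| + 1))%R (divr_gt0 e0 c10).
exists d => // y yd; under eq_integral do rewrite -mulrBr normrM EFinM.
have mB : measurable_fun (cube M) (fun x => `|f (x + y) - f x|%:E)%R.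
  by apply: measurable_funTS; apply: measurable_absB => //; exact: measurable_fun_translate.
rewrite ge0_integralZl//; last exact: measurable_cube.
apply: (@le_trans _ _ (`|c|%:E * (e / (`|c| + 1))%:E)).
  by rewrite lee_wpmul2l// fd.
rewrite -EFinM lee_fin mulrCA ger_pMr// ler_pdivrMr// mul1r lerDl//.
Qed.

Lemma tc_sum (I : Type) (s : seq I) (F : I -> 'rV[R]_n -> R) :
  (forall i, measurable_fun [set: 'rV[R]_n] (F i)) -> (forall i, tc (F i)) ->
  tc (fun x => \sum_(i <- s) F i x)%R.
Proof.
move=> mF tF; elim: s => [|i s IH].
  move=> M e e0; exists 1%R => // y _.
  by rewrite integral0_eq ?lee_fin ?ltW// => x _; rewrite !big_nil subrr normr0.
under eq_fun do rewrite big_cons.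
apply: (tc_dom2 _ _ _ _ (tF i) IH) => //.
- exact: measurable_sum.
- by apply: measurable_funD => //; exact: measurable_sum.
- move=> x y; rewrite opprD addrACA; exact: ler_normD.
Qed.

Lemma tc_sfun (g : {sfun 'rV[R]_n >-> R}) : tc g.
Proof.
rewrite (funext (fimfunEord g)).
have mg (y : R) : measurable (g @^-1` [set y]) by exact: measurable_sfunP.
apply: tc_sum => i; first by apply: measurable_funM => //; exact: measurable_indic.
apply: tcZ; first exact: measurable_indic.
have mA : measurable (g @^-1` [set (finmap.enum_fset (fset_set (range g)))`_i])%R by exact: mg.
by have [_ tA] := tc_measurable_set mA; exact: tA.
Qed.

(** Indicators give simple functions by linearity, and simple functions are dense in L^1 of a
    cube. *)
Lemma tc_loc_integrable f : loc_integrable f -> tc f.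
Proof.
move=> lf; apply: tc_closed; first exact: loc_integrable_measurable.
move=> M e e0.
have [g_ [_ _]] := approximation_sfun_integrable (@measurable_cube R n M) (loc_integrable_cube M lf).
move=> /fine_cvgP[gfin /cvgrPdist_le/(_ e e0) ge].
have [k [gk1 gk2]] : exists k, (\int[mu]_(z in cube M) `|(EFin \o f) z - (g_ k z)%:E|) \is a fin_num /\
   (`|0 - fine (\int[mu]_(z in cube M) `|(EFin \o f) z - (g_ k z)%:E|)| <= e)%R.
  by near \oo => k; exists k; split; near: k.
exists (g_ k : 'rV[R]_n -> R); split => //; first exact: tc_sfun.
move: gk2; rewrite sub0r normrN ger0_norm ?fine_ge0 ?integral_ge0//.
by rewrite -lee_fin fineK.
Unshelve. all: by end_near. Qed.

Lemma loc_integrable_cst (c : R) : loc_integrable (cst c : 'rV[R]_n -> R).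
Proof.
apply: loc_integrableP => M; apply/integrableP; split.
  by apply/measurable_EFinP; exact: measurable_cst.
rewrite /= integral_cst; last exact: measurable_cube.
by rewrite lte_mul_pinfty// cube_lty.
Qed.

Lemma integrable_test_function h : test_function h -> mu.-integrable setT (EFin \o h).
Proof.
move=> th; have [C hC] := test_function_bounded th.
have [_ [M hM]] := (test_functionP _).1 th.
have := integrable_mul_supported (loc_integrable_cst 1) (test_function_measurable th) hC hM.
by under eq_fun do rewrite mul1r.
Qed.

Definition mollifier (a : R) rho := [/\ test_function rho, forall z, (0 <= rho z)%R,
  supported a rho & \int[mu]_x (rho x)%:E = 1].

(** A product of one-variable bumps, positive exactly when every [|z_i| < a], divided by its
    integral. *)
Lemma mollifier_exists (a : R) : (0 < a)%R -> exists rho, mollifier a rho.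
Proof.
move=> a0.
pose b (z : 'rV[R]_n) := (\prod_(i < n) (flat_exp 1 (a^-1 * z ord0 i + 1) * flat_exp 1 (- a^-1 * z ord0 i + 1)))%R.
have bb : bump_algebra b.
  by apply: bump_algebra_prod => i; apply: bump_mul; exact: bump_flat_exp.
have b0 z : (0 <= b z)%R by apply: prodr_ge0 => i _; rewrite mulr_ge0 ?flat_exp1_ge0.
have sb : supported a b.
  move=> z az; have : ~ (forall i, `|z ord0 i| <= a)%R.
    by move=> h; move: az; rewrite ltNge; apply/negP; rewrite negbK; apply/rV_norm_leP => //; exact: ltW.
  move=> /existsNP[i /negP]; rewrite -ltNge ltr_normr => ai.
  rewrite /b (bigD1 i)//=.
  suff -> : (flat_exp 1 (a^-1 * z ord0 i + 1) * flat_exp 1 (- a^-1 * z ord0 i + 1) = 0)%R by rewrite mul0r.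
  case/orP: ai => zi; apply/eqP; rewrite mulf_eq0; apply/orP; [right|left]; apply/eqP; apply: flat_exp_eq0.
    rewrite mulNr addrC subr_le0 -ler_pdivrMl ?invr_gt0// invrK mulr1; exact: ltW.
  by rewrite -lerBrDr sub0r -ler_pdivlMl ?invr_gt0// invrK mulrN1 lerNr ltW.
have tb : test_function b by apply/test_functionP; split; [exact: bump_algebra_smooth|exists a].
have mb := test_function_measurable tb.
have [C bC] := test_function_bounded tb.
have ib := integrable_test_function tb.
(* A zero integral would make [b] vanish almost everywhere, whereas [b] is positive on the cube [S]
   of measure [(2 a)^n]. *)
have I0 : 0 < \int[mu]_x (b x)%:E.
  rewrite lt_neqAle integral_ge0 ?andbT//; last by move=> x _; rewrite lee_fin.
  apply/eqP => /esym I0.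
  have mbE : measurable_fun [set: 'rV[R]_n] (EFin \o b) by exact/measurable_EFinP.
  have /(ae_eq_integral_abs mu measurableT mbE).1 : \int[mu]_x `|(EFin \o b) x| = 0.
    by rewrite -I0; apply: eq_integral => x _; rewrite gee0_abs ?lee_fin.
  move=> [N [mN N0 bN]].
  pose S := [set z : 'rV[R]_n | forall i, `](- a)%R, a[%classic (z ord0 i)].
  have mS : mu S = \prod_(i < n) (2 * a)%:E%R.
    rewrite (lebesgue_rV_prod (fun=> measurable_itv `](- a)%R, a[)); apply: eq_bigr => i _.
    rewrite lebesgue_measure_itv/= lte_fin; have -> : (- a < a)%R by lra.
    by rewrite -EFinD; congr EFin; ring.
  have SN : S `<=` N.
    move=> z Sz; apply: bN => /= /(_ I) /eqP; apply/negP; rewrite eqe gt_eqF//.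
    apply: prodr_gt0 => i _; have := Sz i; rewrite /= in_itv/= => /andP[az za].
    have ai : (0 < a^-1)%R by rewrite invr_gt0.
    rewrite mulr_gt0// flat_exp1_gt0//.
      by rewrite -(mulVf (lt0r_neq0 a0)) -mulrDr mulr_gt0// -ltrBlDr sub0r.
    by rewrite -(mulVf (lt0r_neq0 a0)) mulNr addrC -mulrBr mulr_gt0// subr_gt0.
  have : mu S <= mu N.
    apply: le_measure; rewrite ?inE//.
    rewrite (_ : S = \bigcap_(i in [set: 'I_n]) [set z : 'rV[R]_n | `](- a)%R, a[%classic (z ord0 i)]).
      apply: fin_bigcap_measurable => // i _; rewrite -[X in measurable X]setTI.
      by apply: (@measurable_coord R n i) => //; exact: measurable_itv.
    by apply/seteqP; split => z h; [move=> i _|move=> i]; exact: h.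
  rewrite N0 mS prodEFin lee_fin leNgt => /negP; apply.
  by apply: prodr_gt0 => i _; rewrite mulr_gt0.
pose I := fine (\int[mu]_x (b x)%:E).
have IE : \int[mu]_x (b x)%:E = I%:E by rewrite fineK//; exact: integrable_fin_num.
have I0' : (0 < I)%R by rewrite -lte_fin -IE.
exists (fun z => I^-1 * b z)%R; split.
- apply/test_functionP; split; last by exists a => z az; rewrite sb// mulr0.
  by apply: bump_algebra_smooth; apply: bump_mul => //; exact: bump_cst.
- by move=> z; rewrite mulr_ge0// invr_ge0 ltW.
- by move=> z az; rewrite sb// mulr0.
- under eq_integral do rewrite EFinM.
  by rewrite integralZl// IE -EFinM mulVf// gt_eqF.
Qed.

(** As [rho] has mass 1, the error at [x] is at most the [rho]-average over [y] of
    [|f (x + y) - f x|]. Tonelli's theorem exchanges this average with the integral over the cube,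
    which continuity of translations bounds for each [y] with [|y| <= d]; elsewhere [rho]
    vanishes. *)
Lemma mollify_near f M e : loc_integrable f -> (0 < e)%R -> exists2 d, (0 < d)%R &
  forall rho, mollifier d rho ->
  \int[mu]_(x in cube M) `|mollify f rho x - f x|%:E <= e%:E.
Proof.
move=> lf e0; have [d d0 fd] := @tc_loc_integrable f lf M e e0.
exists d => // rho [trho rho0 srho irho].
have mf := loc_integrable_measurable lf.
have mrho := test_function_measurable trho.
have mC := @measurable_cube R n M.
pose F x y := (`|f (x + y) - f x| * rho y)%:E.
have F0 x y : 0 <= F x y by rewrite lee_fin mulr_ge0.
have mF : measurable_fun [set: 'rV[R]_n * 'rV[R]_n] (fun z => F z.1 z.2).
  apply/measurable_EFinP; apply: measurable_funM; last exact: (measurableT_comp mrho measurable_snd).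
  apply: measurableT_comp => //; apply: measurable_funB.
    by apply: (measurableT_comp mf); exact: measurable_rVD.
  exact: (measurableT_comp mf measurable_fst).
have cF x : `|mollify f rho x - f x|%:E <= \int[mu]_y F x y.
  have i1 := integrable_mollify x lf trho.
  have trx := test_function_translate x trho.
  have i2 : mu.-integrable setT (EFin \o (fun z => f x * rho (z - x))%R).
    exact: (integrableZl measurableT (f x) (integrable_test_function trx)).
  have r1 : (\int[mu]_z rho (z - x) = 1)%R.
    rewrite /Rintegral (ge0_integral_translate (f := EFin \o rho) (- x)) ?irho//.
    by apply/measurable_EFinP.
  have -> : (mollify f rho x - f x = \int[mu]_z ((f z - f x) * rho (z - x)))%R.
    rewrite -[X in (_ - X)%R]mulr1 -r1 -RintegralZl//; last exact: integrable_test_function.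
    rewrite /mollify -RintegralB//; apply: eq_Rintegral => z _; ring.
  have i3 : mu.-integrable setT (EFin \o (fun z => (f z - f x) * rho (z - x))%R).
    apply: eq_integrable (integrableB measurableT i1 i2) => // z _.
    by rewrite /= -EFinB mulrBl.
  rewrite EFin_normr_Rintegral//.
  apply: (le_trans (le_abse_integral _ measurableT (measurable_int _ i3))).
  have m4 : measurable_fun [set: 'rV[R]_n] (fun z => (`|f z - f x| * rho (z - x))%:E)%R.
    apply/measurable_EFinP; apply: measurable_funM; last exact: test_function_measurable.
    by apply: measurableT_comp => //; exact: measurable_funB.
  rewrite le_eqVlt; apply/orP; left; apply/eqP.
  transitivity (\int[mu]_z (`|f z - f x| * rho (z - x))%R%:E).
    by apply: eq_integral => z _; rewrite /= normrM (ger0_norm (rho0 _)).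
  rewrite -(ge0_integral_translate x m4); last by move=> z; rewrite lee_fin mulr_ge0.
  by apply: eq_integral => y _; rewrite addrK /F (addrC y).
have mG : measurable_fun [set: 'rV[R]_n] (fun x => \int[mu]_y F x y).
  exact: (@measurable_integral_param _ _ _ _ _ _ F).
apply: (@le_trans _ _ (\int[mu]_(x in cube M) \int[mu]_y F x y)).
  apply: ge0_le_integral => //; last exact: measurable_funTS.
  apply: measurable_funTS; apply: measurable_absB => //.
  by apply: continuous_measurable_rV; exact: continuous_mollify.
pose K x y := F x y * (\1_(cube M) x)%:E.
have K0 x y : 0 <= K x y by rewrite /K mule_ge0.
have mK : measurable_fun [set: 'rV[R]_n * 'rV[R]_n] (fun z => K z.1 z.2).
  apply: emeasurable_funM => //; apply/measurable_EFinP.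
  exact: (measurableT_comp (@measurable_indic _ _ R setT _ mC) measurable_fst).
have -> : \int[mu]_(x in cube M) \int[mu]_y F x y = \int[mu]_x \int[mu]_y K x y.
  rewrite integral_mkcond_indic; apply: eq_integral => x _.
  rewrite /K indicE; case: (x \in _); last by rewrite mule0 integral0_eq// => y _; rewrite mule0.
  by rewrite mule1; apply: eq_integral => y _; rewrite mule1.
rewrite (tonelli_swap mu mu mK K0).
have mKy : measurable_fun [set: 'rV[R]_n] (fun y => \int[mu]_x K x y).
  have mK' : measurable_fun [set: 'rV[R]_n * 'rV[R]_n] (fun z => K z.2 z.1).
    exact: (measurableT_comp mK (@measurable_swap _ _ _ _)).
  exact: (@measurable_integral_param _ _ _ _ _ mu (fun y x => K x y) mK').
have <- : \int[mu]_y (e%:E * (rho y)%:E) = e%:E.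
  by rewrite integralZl ?irho ?mule1//; exact: integrable_test_function.
have Ky y : \int[mu]_x K x y <= e%:E * (rho y)%:E.
  have -> : \int[mu]_x K x y = (rho y)%:E * \int[mu]_(x in cube M) `|f (x + y) - f x|%:E.
    rewrite -ge0_integralZl//; last 2 first.
    - apply: measurable_funTS; apply: measurable_absB => //.
      exact: measurable_fun_translate.
    - by rewrite lee_fin.
    rewrite [RHS]integral_mkcond_indic; apply: eq_integral => x _.
    by rewrite /K /F EFinM (muleC (rho y)%:E).
  have [yd|dy] := leP `|y|%R d; last by rewrite srho// mule0 mul0e.
  by rewrite muleC lee_wpmul2r ?lee_fin// fd.
have L0 y : 0 <= \int[mu]_x K x y by exact: integral_ge0.
apply: (@ge0_le_integral _ _ _ mu setT measurableT _ _ (fun y _ => L0 y) mKy _ (fun y _ => Ky y)).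
by apply: emeasurable_funM => //; exact/measurable_EFinP.
Qed.

End mollification.

(** * Smooth approximation and uniqueness of the weak gradient *)

Section smooth_approximation.
Context {R : realType} {n : nat}.
Implicit Types (f : 'rV[R]_n -> R) (G : 'rV[R]_n -> 'rV[R]_n) (M e d : R) (x y : 'rV[R]_n) (i : 'I_n).
Local Notation mu := (lebesgue_rV R n).
Local Notation e_ i := (delta_mx ord0 i : 'rV[R]_n).

Lemma ge0_cvge0P (u : nat -> \bar R) : (forall k, 0 <= u k)%E ->
  (u @ \oo --> 0%E) <-> (forall e, 0 < e -> \forall k \near \oo, (u k <= e%:E)%E).
Proof.
move=> u0; split=> [/fine_cvgP[ufin /cvgrPdist_le ul] e e0|ul].
  near=> k; have uk : u k \is a fin_num by near: k.
  rewrite -(fineK uk) lee_fin -[leLHS]ger0_norm ?fine_ge0//.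
  by rewrite -normrN -sub0r; near: k; exact: ul.
apply/fine_cvgP; split.
  near=> k; rewrite ge0_fin_numE//; apply: (@le_lt_trans _ _ 1%:E); last exact: ltry.
  by near: k; exact: ul.
apply/cvgrPdist_le => e e0; near=> k.
have ue : (u k <= e%:E)%E by near: k; exact: ul.
rewrite sub0r normrN ger0_norm ?fine_ge0// -lee_fin fineK// ge0_fin_numE//.
by apply: le_lt_trans ue _; exact: ltry.
Unshelve. all: by end_near. Qed.

Lemma mollifier_le a b (rho : 'rV[R]_n -> R) : a <= b -> mollifier a rho -> mollifier b rho.
Proof. by move=> ab [t p s i]; split => // z bz; apply: s; exact: le_lt_trans bz. Qed.

(** The sequence is chosen before [G], [i] and [M]: one sequence serves every weak gradient of [f],
    and uniqueness of the gradient rests on this order of quantifiers. *)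
Lemma smooth_approximation f : loc_integrable f -> exists phi : nat -> 'rV[R]_n -> R,
  [/\ forall k, smooth (phi k),
     forall M, (\int[mu]_(x in cube M) `|phi k x - f x|%:E)%E @[k --> \oo] --> 0%E &
     forall G, weak_gradient f G -> forall i M,
       (\int[mu]_(x in cube M) `|partial i (phi k) x - G x ord0 i|%:E)%E @[k --> \oo] --> 0%E].
Proof.
move=> lf.
have /choice[rho rhoP] (k : nat) : exists rho : 'rV[R]_n -> R, mollifier k.+1%:R^-1 rho.
  by apply: mollifier_exists; rewrite invr_gt0.
have cvgM g M : loc_integrable g ->
    (\int[mu]_(x in cube M) `|mollify g (rho k) x - g x|%:E)%E @[k --> \oo] --> 0%E.
  move=> lg; apply/ge0_cvge0P => [k|e e0]; first exact: integral_ge0.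
  have [d d0 gd] := mollify_near M lg e0.
  near=> k; apply: gd; apply: mollifier_le (rhoP k).
  by apply: ltW; near: k; exact: near_infty_natSinv_lt (PosNum d0).
exists (fun k => mollify f (rho k)); split.
- by move=> k; apply: smooth_mollify => //; have [] := rhoP k.
- by move=> M; exact: cvgM.
- move=> G fG i M; have [_ lG _] := fG.
  under eq_fun => k.
    have [tk _ _ _] := rhoP k.
    by rewrite (partial_mollify_weak i fG tk); over.
  exact: (cvgM (fun x => G x ord0 i)).
Unshelve. all: by end_near. Qed.

(** Both gradients are L^1 limits of the partial derivatives of a single approximating sequence. *)
Lemma weak_gradient_unique f G H i M : weak_gradient f G -> weak_gradient f H ->
  (\int[mu]_(x in cube M) `|G x ord0 i - H x ord0 i|%:E = 0)%E.
Proof.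
move=> fG fH; have [lf lG _] := fG; have [_ lH _] := fH.
have [phi [sphi _ phiG]] := smooth_approximation lf.
apply/eqP; rewrite eq_le integral_ge0 ?andbT//.
apply/lee_addgt0Pr => e e0; rewrite add0e.
have e2 : 0 < e / 2 by rewrite divr_gt0.
have p0 (K : 'rV[R]_n -> 'rV[R]_n) k :
    (0 <= \int[mu]_(x in cube M) `|partial i (phi k) x - K x ord0 i|%:E)%E by exact: integral_ge0.
have h1 := (ge0_cvge0P (p0 G)).1 (phiG G fG i M) _ e2.
have h2 := (ge0_cvge0P (p0 H)).1 (phiG H fH i M) _ e2.
have [k [k1 k2]] : exists k, (\int[mu]_(x in cube M) `|partial i (phi k) x - G x ord0 i|%:E <= (e / 2)%:E)%E /\
    (\int[mu]_(x in cube M) `|partial i (phi k) x - H x ord0 i|%:E <= (e / 2)%:E)%E.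
  near \oo => k; exists k; split; near: k; [apply: h1|apply: h2] => //.
have mp : measurable_fun [set: 'rV[R]_n] (partial i (phi k)).
  by apply: continuous_measurable_rV; apply: smooth_continuous; exact: smooth_partial.
have mG := loc_integrable_measurable (lG i).
have mH := loc_integrable_measurable (lH i).
rewrite (splitr e) EFinD; apply: le_trans (leeD k1 k2).
have mpG := measurable_funTS (D := cube M) (measurable_absB mp mG).
have mpH := measurable_funTS (D := cube M) (measurable_absB mp mH).
have mC := @measurable_cube R n M.
rewrite -(ge0_integralD mu mC (fun _ _ => _) mpG (fun _ _ => _) mpH)//.
apply: ge0_le_integral => //.
- by apply: measurable_funTS; exact: measurable_absB.
- exact: emeasurable_funD.
- move=> x _; rewrite -EFinD lee_fin.
  rewrite (_ : _ - _ = (partial i (phi k) x - H x ord0 i) - (partial i (phi k) x - G x ord0 i)); last by ring.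
  by rewrite (le_trans (ler_normB _ _))// addrC.
Unshelve. all: by end_near. Qed.

Lemma MVT_coordinate f a (t : R) i : smooth f -> exists2 q : R, `|q| <= `|t| &
  f (a + t *: e_ i) - f a = t * partial i f (a + q *: e_ i).
Proof.
move=> sf.
have df (s : R) : is_derive s (1 : R) (fun s => f (a + s *: e_ i)) (partial i f (a + s *: e_ i)).
  exact: ((is_derive_lineP f a (e_ i) _ s).1 (is_derive_partial i _ sf)).
have cf : continuous (fun s : R => f (a + s *: e_ i)).
  by move=> s; apply: differentiable_continuous; apply/derivable1_diffP; have [] := df s.
have [t0|t0] := leP 0 t.
  have [q qt] := MVT_segment t0 (fun s _ => df s) (continuous_subspaceT cf).
  rewrite subr0 mulrC scale0r addr0 => fE; exists q => //.
  by move: qt; rewrite in_itv/= => /andP[q0 qt]; rewrite !ger0_norm.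
have [q qt] := MVT_segment (ltW t0) (fun s _ => df s) (continuous_subspaceT cf).
rewrite sub0r scale0r addr0 => fE; exists q.
  by move: qt; rewrite in_itv/= => /andP[tq q0]; rewrite !ler0_norm ?lerN2// ltW.
by rewrite -opprB fE mulrN opprK mulrC.
Qed.

(** Smoothness directly provides partial derivatives only. The increment along [h v] is split into
    [n] coordinate steps, each treated by the mean value theorem, and continuity of the partial
    derivatives at [a] concludes. *)
Lemma is_derive_grad f a v : smooth f -> is_derive a v f (dot (grad f a) v).
Proof.
move=> sf; apply/is_derive_cvg; apply/cvgrPdist_le => e e0.
pose V := \sum_i `|v ord0 i| + 1.
have V0 : 0 < V by rewrite ltr_wpDl// sumr_ge0.
have eV : 0 < e / V by rewrite divr_gt0.
have : \forall w \near a, forall i, `|partial i f a - partial i f w| <= e / V.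
  apply: (@filter_forall _ _ (fun i w => `|partial i f a - partial i f w| <= e / V) (nbhs a) _) => i.
  by have /(@cvgrPdist_le R R _ (nbhs a)) := smooth_continuous (smooth_partial i sf) (x := a); exact.
move=> /(@nbhs_normP R 'rV[R]_n)[d /= d0 ad].
have v10 : 0 < `|v| + 1 by rewrite ltr_wpDl.
near=> h.
have h0 : h != 0 by near: h; exact: nbhs_dnbhs_neq.
have hd : `|h| < d / (`|v| + 1).
  by near: h; apply: dnbhs0_lt; rewrite divr_gt0.
(* [p k] keeps the first [k] coordinates of [h v], so the path runs from [p 0 = 0] to
   [p n = h v]. *)
pose p (k : nat) : 'rV[R]_n := \row_j (if (j < k)%N then h * v ord0 j else 0).
have pS i : p i.+1 = p i + (h * v ord0 i) *: e_ i.
  apply/rowP => j; rewrite !mxE ltnS leq_eqVlt eqxx/=.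
  rewrite [_ == _](_ : (_ == _) = (j == i)); last by [].
  case: eqVneq => [->|_]/=; first by rewrite ltnn add0r mulr1.
  by rewrite mulr0 addr0.
have /choice[q qP] i : exists q : R, `|q| <= `|h * v ord0 i| /\
    f (a + p i.+1) - f (a + p i) = h * v ord0 i * partial i f (a + p i + q *: e_ i).
  by have [q q1 q2] := MVT_coordinate (a + p i) (h * v ord0 i) i sf; exists q; rewrite pS addrA.
have -> : f (h *: v + a) - f a = \sum_(i < n) (f (a + p i.+1) - f (a + p i)).
  have := @telescope_sumr R 0 n (fun k => f (a + p k)) (leq0n n).
  rewrite big_mkord => ->; congr (f _ - f _).
    by rewrite addrC; congr (_ + _); apply/rowP => j; rewrite !mxE ltn_ord.
  by rewrite -[LHS]addr0; congr (_ + _); apply/rowP => j; rewrite !mxE ltn0.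
under eq_bigr => i _ do rewrite (qP i).2 -mulrA.
rewrite -mulr_sumr mulrA mulVf// mul1r /dot -sumrB.
rewrite (le_trans (ler_norm_sum _ _ _))//.
rewrite (@le_trans _ _ (\sum_i `|v ord0 i| * (e / V)))//.
  apply: ler_sum => i _; rewrite mxE (mulrC (v ord0 i)) -mulrBl normrM mulrC ler_wpM2l//.
  apply: ad; rewrite /= -addrA opprD addrA subrr sub0r normrN.
  apply: le_lt_trans (_ : `|h| * `|v| < d).
    apply/rV_norm_leP => [|j]; first by rewrite mulr_ge0.
    rewrite !mxE eqxx/=; have [->|ji] := eqVneq j i.
      rewrite ltnn add0r mulr1 (le_trans (qP i).1)// normrM ler_wpM2l//.
      exact: ler_coord_norm.
    rewrite mulr0 addr0; case: ifP => _; last by rewrite normr0 mulr_ge0.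
    by rewrite normrM ler_wpM2l// ler_coord_norm.
  rewrite (@le_lt_trans _ _ (`|h| * (`|v| + 1)))//; first by rewrite ler_wpM2l// lerDl.
  by rewrite -ltr_pdivlMr.
rewrite -mulr_suml mulrCA ger_pMr// ler_pdivrMr// mul1r lerDl//.
Unshelve. all: by end_near. Qed.

Lemma is_derive_ray f x v (r : R) : smooth f ->
  is_derive r (1 : R) (fun r => f (x + r *: v)) (dot (grad f (x + r *: v)) v).
Proof. by move=> sf; exact: ((is_derive_lineP f x v _ r).1 (is_derive_grad _ _ sf)). Qed.

End smooth_approximation.

(** * Traces on spheres *)

Section trace_on_spheres.
Context {R : realType} {n : nat} (n_gt0 : (0 < n)%N).
Implicit Types (f g phi : 'rV[R]_n -> R) (G : 'rV[R]_n -> 'rV[R]_n) (x theta z w : 'rV[R]_n).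
Local Notation mu := (lebesgue_rV R n).
Local Notation leb := (@lebesgue_measure R).

(* [d/dr (r^n phi(x + r theta))] when [G] is the gradient of [phi]; its integral
   over [0, t] recovers [t^n phi(x + t theta)]. *)
Definition radial_density f G x theta (r : R) : R :=
  n%:R * r ^+ n.-1 * f (x + r *: theta) + r ^+ n * dot (G (x + r *: theta)) theta.

(** For [z] on the sphere, [t^-1 *: (z - x)] is its unit direction, and for smooth [f] with gradient
    [G] the value is [f z]. Both terms of the density carry at least [r^(n-1)], the weight of polar
    coordinates, so volume integrals over the ball control the formula. *)
Definition sphere_trace f G x (t : R) z : R :=
  t ^- n * \int[leb]_(r in `]0, t[) radial_density f G x (t^-1 *: (z - x)) r.

Lemma continuous_bigsum (I : Type) (s : seq I) (F : I -> R -> R) :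
  (forall i, continuous (F i)) -> continuous (fun r => \sum_(i <- s) F i r).
Proof.
move=> cF; elim: s => [|i s IH].
  by under eq_fun do rewrite big_nil; exact: cst_continuous.
under eq_fun do rewrite big_cons.
by move=> r; exact: (cvgD (cF i r) (IH r)).
Qed.

Lemma continuous_ray phi x theta : smooth phi -> continuous (fun r : R => phi (x + r *: theta)).
Proof.
move=> sp r; apply: differentiable_continuous; apply/derivable1_diffP.
by have [] := is_derive_ray x theta r sp.
Qed.

Lemma continuous_ray_grad phi x theta : smooth phi ->
  continuous (fun r : R => dot (grad phi (x + r *: theta)) theta).
Proof.
move=> sp; apply: continuous_bigsum => i; under eq_fun do rewrite mxE.
by move=> r; apply: cvgMl; apply: continuous_ray; exact: smooth_partial.
Qed.

Lemma continuous_radial_density phi x theta : smooth phi ->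
  continuous (radial_density phi (grad phi) x theta).
Proof.
move=> sp r; apply: cvgD; apply: cvgM.
- by apply: cvgMr; exact: exprn_continuous.
- exact: continuous_ray.
- exact: exprn_continuous.
- exact: continuous_ray_grad.
Qed.

Lemma integrable_continuous_itvoo (a b : R) (h : R -> R) : continuous h ->
  leb.-integrable `]a, b[ (EFin \o h).
Proof.
move=> ch; apply: (@integrableS _ _ _ leb `[a, b]%classic) => //.
  by apply: subset_itv_oo_cc.
apply: continuous_compact_integrable; first exact: segment_compact.
by apply: continuous_subspaceT.
Qed.

Lemma FTC2_oo (a b : R) (F h : R -> R) : a < b -> continuous h ->
  (forall r, is_derive r (1 : R) F (h r)) ->
  \int[leb]_(r in `]a, b[) h r = F b - F a.
Proof.
move=> ab ch dF.
have cF : continuous F.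
  by move=> r; apply: differentiable_continuous; apply/derivable1_diffP; have [] := dF r.
have iab := integrable_continuous_itvoo a b ch.
rewrite Rintegral_itv_bndo_bndc//.
have ic : leb.-integrable `[a, b] (EFin \o h).
  apply: continuous_compact_integrable; first exact: segment_compact.
  exact: continuous_subspaceT.
rewrite Rintegral_itv_obnd_cbnd; last first.
  by apply: integrableS ic => //; exact: subset_itv_oc_cc.
rewrite /Rintegral (continuous_FTC2 (F := F) ab)//.
- exact: continuous_subspaceT.
- split.
  + by move=> r _; have [] := dF r.
  + by apply: cvg_at_right_filter; exact: cF.
  + by apply: cvg_at_left_filter; exact: cF.
- by move=> r _; rewrite derive1E; have [_ ->] := dF r.
Qed.

(** Fundamental theorem of calculus; as [n > 0], the factor [r^n] kills the endpoint at the
    centre. *)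
Lemma smooth_radial_density phi x theta (t : R) : 0 < t -> smooth phi ->
  \int[leb]_(r in `]0, t[) radial_density phi (grad phi) x theta r = t ^+ n * phi (x + t *: theta).
Proof.
move=> t0 sp.
have dX (r : R) : is_derive r (1 : R) (fun r : R => r ^+ n) (n%:R * r ^+ n.-1).
  apply: DeriveDef; first exact: exprn_derivable.
  by rewrite exp_derive [_ *: _]mulr1.
have dF (r : R) : is_derive r (1 : R) (fun r => r ^+ n * phi (x + r *: theta))
    (radial_density phi (grad phi) x theta r).
  apply: is_derive_eq (is_deriveM (dX r) (is_derive_ray x theta r sp)) _.
  by rewrite /radial_density /GRing.scale/= addrC; congr (_ + _); rewrite mulrC.
rewrite (FTC2_oo t0 (@continuous_radial_density phi x theta sp) dF).
by rewrite expr0n gtn_eqF// mul0r subr0.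
Qed.

Lemma measurable_integral_itv (K : 'rV[R]_n -> R -> R) (I : interval R) :
  measurable_fun [set: 'rV[R]_n * measurableTypeR R] (fun u => K u.1 u.2) ->
  measurable_fun [set: 'rV[R]_n] (fun z => \int[leb]_(r in [set` I]) K z r).
Proof.
move=> mK; apply: measurableT_comp; first exact: fine_measurable.
have mI : measurable_fun [set: 'rV[R]_n * measurableTypeR R] (fun u => (\1_[set` I] u.2)%:E : \bar R).
  apply/measurable_EFinP.
  exact: (measurableT_comp (@measurable_indic _ (measurableTypeR R) R setT _ (measurable_itv I)) measurable_snd).
have mKE : measurable_fun [set: 'rV[R]_n * measurableTypeR R] (fun u => (K u.1 u.2)%:E) by exact/measurable_EFinP.
under eq_fun do rewrite integralE.
apply: emeasurable_funB.
  under eq_fun do rewrite integral_mkcond_indic.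
  apply: (@measurable_integral_param _ _ _ _ _ leb (fun z r => ((EFin \o K z)^\+ r * (\1_[set` I] r)%:E)%E)).
    have mp : measurable_fun [set: 'rV[R]_n * measurableTypeR R] (fun u => (EFin \o K u.1)^\+ u.2)%E.
      under eq_fun do rewrite funeposE.
      exact: (measurable_maxe mKE (measurable_cst 0%E)).
    exact: (emeasurable_funM mp mI).
  by move=> z r; rewrite mule_ge0.
under eq_fun do rewrite integral_mkcond_indic.
apply: (@measurable_integral_param _ _ _ _ _ leb (fun z r => ((EFin \o K z)^\- r * (\1_[set` I] r)%:E)%E)).
  have mn : measurable_fun [set: 'rV[R]_n * measurableTypeR R] (fun u => (EFin \o K u.1)^\- u.2)%E.
    under eq_fun do rewrite funenegE.
    by apply: (measurable_maxe _ (measurable_cst 0%E)); exact: (measurableT_comp _ mKE).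
  exact: (emeasurable_funM mn mI).
by move=> z r; rewrite mule_ge0.
Qed.

End trace_on_spheres.

(** * The trace inequality on a sphere *)

Section trace_estimate.
Context {R : realType} {n : nat} (n_gt0 : (0 < n)%N).
Variables (f : 'rV[R]_n -> R) (G : 'rV[R]_n -> 'rV[R]_n).
Hypothesis mf : measurable_fun [set: 'rV[R]_n] f.
Hypothesis mG : forall i, measurable_fun [set: 'rV[R]_n] (fun z => G z ord0 i).
Variables (x : 'rV[R]_n) (t : R) (t_gt0 : 0 < t).
Local Notation mu := (lebesgue_rV R n).
Local Notation leb := (@lebesgue_measure R).
Local Notation g := (sphere_trace f G x t).

Let mGv : measurable_fun [set: 'rV[R]_n] G.
Proof. by apply: (@measurable_fun_rVP R _ _ n) => i; exact: mG. Qed.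

Lemma measurable_eball : measurable (eball x t).
Proof.
have me : measurable_fun [set: 'rV[R]_n] (fun z => enorm (z - x)).
  by apply: (measurableT_comp (@measurable_enorm R n)); exact: measurable_rVB.
rewrite -[X in measurable X]setTI.
exact: (measurable_fun_ltr me (measurable_cst t)).
Qed.

Lemma measurable_radial_density : measurable_fun [set: 'rV[R]_n * measurableTypeR R]
  (fun z => radial_density f G x z.1 z.2).
Proof.
have mxr : measurable_fun [set: 'rV[R]_n * measurableTypeR R] (fun z => x + (z.2 : R) *: z.1).
  apply: (@measurable_rVD R n _ _ (fun=> x)) => //.
  exact: (measurable_rVZ measurable_snd measurable_fst).
apply: measurable_funD.
  apply: measurable_funM; last exact: (measurableT_comp mf mxr).
  by apply: measurable_funM => //; exact: measurable_funX.
apply: measurable_funM; first exact: measurable_funX.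
by apply: measurable_dot => //; exact: (measurableT_comp mGv mxr).
Qed.

Lemma measurable_sphere_trace : measurable_fun [set: 'rV[R]_n] g.
Proof.
apply: measurable_funM => //.
apply: (@measurable_integral_itv _ _ (fun z r => radial_density f G x (t^-1 *: (z - x)) r)).
have m1 : measurable_fun [set: 'rV[R]_n * measurableTypeR R] (fun z => (t^-1 *: (z.1 - x), z.2)).
  apply/measurable_fun_pairP; split; last exact: measurable_snd.
  have mB := measurable_rVB (@measurable_fst _ _ 'rV[R]_n (measurableTypeR R)) (measurable_cst x).
  exact: (measurable_rVZ (measurable_cst t^-1) mB).
exact: (measurableT_comp measurable_radial_density m1).
Qed.

(** For [r < t] it dominates the difference of the two radial densities once [r^(n-1)] is taken out:
    [n] comes from the derivative of [r^n] and [t] bounds the remaining factor [r]. *)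
Definition sobolev_gap (phi : 'rV[R]_n -> R) z : R :=
  n%:R * `|phi z - f z| + t * \sum_i `|partial i phi z - G z ord0 i|.

Lemma measurable_sobolev_gap phi : smooth phi -> measurable_fun [set: 'rV[R]_n] (sobolev_gap phi).
Proof.
move=> sp; apply: measurable_funD; apply: measurable_funM => //.
  apply: measurableT_comp => //; apply: measurable_funB => //.
  by apply: continuous_measurable_rV; exact: smooth_continuous.
apply: measurable_sum => i; apply: measurableT_comp => //; apply: measurable_funB => //.
by apply: continuous_measurable_rV; apply: smooth_continuous; exact: smooth_partial.
Qed.

Lemma sobolev_gap_ge0 phi z : 0 <= sobolev_gap phi z.
Proof.
by apply: addr_ge0; apply: mulr_ge0 => //; [exact: ltW|exact: sumr_ge0].
Qed.

Lemma sphere_trace_gap_ray phi w : smooth phi -> w != 0 ->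
  (`|phi (x + t *: edir w) - g (x + t *: edir w)|%:E <=
   (t ^- n)%:E * \int[leb]_(r in `]0%R, +oo[)
     ((r ^+ n.-1)%:E * (\1_(eball x t) (x + r *: edir w) * sobolev_gap phi (x + r *: edir w))%:E))%E.
Proof.
move=> sp w0; set th := edir w.
have th1 : enorm th = 1 by exact: enorm_edir.
pose a := radial_density phi (grad phi) x th.
pose b := radial_density f G x th.
have tn0 : 0 < t ^+ n by rewrite exprn_gt0.
have gE : g (x + t *: th) = t ^- n * \int[leb]_(r in `]0, t[) b r.
  by rewrite /sphere_trace addrC addKr scalerA mulVf ?gt_eqF// scale1r.
have pE : phi (x + t *: th) = t ^- n * \int[leb]_(r in `]0, t[) a r.
  by rewrite smooth_radial_density// mulrA mulVf ?mul1r// gt_eqF.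
rewrite gE pE -mulrBr normrM gtr0_norm ?invr_gt0// EFinM.
apply: lee_wpmul2l; first by rewrite lee_fin invr_ge0 ltW.
set J := (\int[leb]_(r in _) _)%E.
have mray : measurable_fun [set: measurableTypeR R] (fun r : R => x + r *: th).
  apply: (@measurable_rVD R n _ _ (fun=> x)) => //.
  by apply: (@measurable_rVZ R n _ _ _ (fun=> th)).
pose k (r : R) := r ^+ n.-1 * (\1_(eball x t) (x + r *: th) * sobolev_gap phi (x + r *: th)).
have mk : measurable_fun [set: measurableTypeR R] (EFin \o k).
  apply/measurable_EFinP; apply: measurable_funM; first exact: measurable_funX.
  apply: measurable_funM; last exact: (measurableT_comp (measurable_sobolev_gap sp) mray).
  exact: (measurableT_comp (@measurable_indic _ _ R setT _ measurable_eball) mray).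
have k0 (r : R) : 0 <= r -> 0 <= k r.
  by move=> r0; rewrite mulr_ge0 ?exprn_ge0// mulr_ge0// sobolev_gap_ge0.
have JE : J = (\int[leb]_(r in `]0%R, +oo[) (k r)%:E)%E.
  by apply: eq_integral => r _; rewrite -EFinM.
have [Jy|Jy] := eqVneq J +oo%E; first by rewrite Jy leey.
have J0t : (\int[leb]_(r in `]0%R, t[) (k r)%:E <= J)%E.
  rewrite JE; apply: ge0_subset_integral => //.
  - by apply: measurable_funTS.
  - by move=> r /=; rewrite in_itv/= andbT => /ltW r0; rewrite lee_fin k0.
  - by move=> r /=; rewrite !in_itv/= andbT => /andP[].
have ik : leb.-integrable `]0%R, t[ (EFin \o k).
  apply/integrableP; split; first exact: measurable_funTS.
  have -> : (\int[leb]_(r in `]0%R, t[) `|(EFin \o k) r| = \int[leb]_(r in `]0%R, t[) (k r)%:E)%E.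
    apply: eq_integral => r /set_mem /=; rewrite in_itv/= => /andP[r0 _].
    by rewrite ger0_norm// k0// ltW.
  by apply: le_lt_trans J0t _; rewrite ltey.
have ca := @continuous_radial_density _ _ phi x th sp.
have ia : leb.-integrable `]0%R, t[ (EFin \o a) := integrable_continuous_itvoo 0 t ca.
have mb : measurable_fun [set: measurableTypeR R] b.
  exact: (measurableT_comp measurable_radial_density (pair1_measurable th)).
have ab (r : R) : 0 < r < t -> `|a r - b r| <= k r.
  move=> /andP[r0 rt].
  have xB : eball x t (x + r *: th).
    by rewrite /eball/= addrC addKr enormZ th1 mulr1 gtr0_norm.
  rewrite /k indicE mem_set// mul1r /a /b /radial_density.
  rewrite (_ : _ - _ = n%:R * r ^+ n.-1 * (phi (x + r *: th) - f (x + r *: th)) +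
     r ^+ n * (dot (grad phi (x + r *: th)) th - dot (G (x + r *: th)) th)); last by ring.
  rewrite (le_trans (ler_normD _ _))// /sobolev_gap [leRHS]mulrDr; apply: lerD.
    by rewrite !normrM normr_nat (ger0_norm (exprn_ge0 _ (ltW r0))) [leRHS]mulrCA mulrA.
  have rn : r ^+ n = r * r ^+ n.-1 by rewrite -exprS prednK.
  rewrite normrM (ger0_norm (exprn_ge0 _ (ltW r0))) rn (mulrC r) -mulrA.
  apply: ler_wpM2l; first by rewrite exprn_ge0// ltW.
  apply: ler_pM; [exact: ltW|by []|exact: ltW|].
  rewrite /dot -sumrB (le_trans (ler_norm_sum _ _ _))//; apply: ler_sum => i _.
  rewrite mxE -mulrBl normrM ler_piMr// (le_trans (ler_coord_enorm _ _))// th1//.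
have iab : leb.-integrable `]0%R, t[ (EFin \o (fun r => a r - b r)).
  apply: (le_integrable _ _ _ ik) => //.
    apply/measurable_EFinP; apply: measurable_funB; last exact: measurable_funTS.
    by apply: measurable_funTS; exact: continuous_measurable_fun.
  move=> r /=; rewrite in_itv/= => r0t; rewrite lee_fin (le_trans (ab r r0t))//.
  exact: ler_norm.
(* Integrability of the density of [f] is recovered as [b = a - (a - b)]; without it the two real
   integrals could not be subtracted. *)
have ib : leb.-integrable `]0%R, t[ (EFin \o b).
  apply: eq_integrable (integrableB _ ia iab) => // r _.
  by rewrite /= -EFinB opprB addrC subrK.
rewrite -RintegralB//.
rewrite EFin_normr_Rintegral//.
apply: (le_trans (le_abse_integral _ _ (measurable_int _ iab))) => //.
apply: le_trans J0t; apply: ge0_le_integral => //.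
- by apply: measurableT_comp => //; exact: measurable_int iab.
- exact: measurable_funTS.
Qed.

(** The estimate on rays is integrated over directions, and the polar formula turns its right-hand
    side into a volume integral. This is the trace inequality from W^(1,1) of the ball to L^1 of the
    sphere. *)
Lemma sphere_trace_gap phi : smooth phi ->
  (n%:R%:E * \int[mu]_(w in punctured_ball) `|phi (x + t *: edir w) - g (x + t *: edir w)|%:E <=
   (t ^- n)%:E * \int[mu]_(z in eball x t) (sobolev_gap phi z)%:E)%E.
Proof.
move=> sp.
pose H z : \bar R := (\1_(eball x t) z * sobolev_gap phi z)%:E.
have mH : measurable_fun [set: 'rV[R]_n] H.
  apply/measurable_EFinP; apply: measurable_funM; last exact: measurable_sobolev_gap.
  by apply: measurable_indic; exact: measurable_eball.
have H0 z : (0 <= H z)%E by rewrite lee_fin mulr_ge0// sobolev_gap_ge0.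
have -> : (\int[mu]_(z in eball x t) (sobolev_gap phi z)%:E = \int[mu]_z H z)%E.
  rewrite integral_mkcond_indic; apply: eq_integral => z _.
  by rewrite -EFinM mulrC.
rewrite (ge0_polar n_gt0 x mH H0) muleCA.
apply: lee_wpmul2l; first by rewrite lee_fin.
have mP := measurable_polar x mH H0.
have mPB := @measurable_punctured_ball R n.
have tn0 : (0 <= (t ^- n)%:E)%E by rewrite lee_fin invr_ge0 exprn_ge0// ltW.
have P0 w : (0 <= \int[leb]_(r in `]0%R, +oo[) ((r ^+ n.-1)%:E * H (x + r *: edir w)%R))%E.
  apply: integral_ge0 => r /=; rewrite in_itv/= andbT => r0.
  by rewrite mule_ge0// lee_fin exprn_ge0// ltW.
have ray := fun w (w0 : w != 0) => sphere_trace_gap_ray sp w0.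
rewrite -[X in (_ <= X)%E](ge0_integralZl mu mPB (measurable_funTS mP) (fun w _ => P0 w) tn0).
have mL : measurable_fun [set: 'rV[R]_n] (fun w => `|phi (x + t *: edir w) - g (x + t *: edir w)|%:E).
  have me : measurable_fun [set: 'rV[R]_n] (fun w => x + t *: edir w).
    exact: (measurableT_comp (measurable_rV_affine x t) (@measurable_edir R n)).
  apply/measurable_EFinP; apply: measurableT_comp => //; apply: measurable_funB.
    apply: (measurableT_comp _ me).
    by apply: continuous_measurable_rV; exact: smooth_continuous.
  exact: (measurableT_comp measurable_sphere_trace me).
have mR := measurable_funTS (D := punctured_ball) (emeasurable_funM (measurable_cst (t ^- n)%:E) mP).
apply: (@ge0_le_integral _ _ _ mu _ mPB _ _ _ (measurable_funTS mL) mR) => //.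
by move=> w /punctured_ballE w0; exact: ray.
Qed.

End trace_estimate.

Lemma integral_abs_triangle d (T : measurableType d) (R : realType)
    (m : {measure set T -> \bar R}) (D : set T) (a b c : T -> R) : measurable D ->
  measurable_fun [set: T] a -> measurable_fun [set: T] b -> measurable_fun [set: T] c ->
  (\int[m]_(z in D) `|a z - c z|%:E <=
   \int[m]_(z in D) `|a z - b z|%:E + \int[m]_(z in D) `|b z - c z|%:E)%E.
Proof.
move=> mD ma mb mc.
have mabs (f g : T -> R) : measurable_fun [set: T] f -> measurable_fun [set: T] g ->
    measurable_fun D (fun z => `|f z - g z|%:E).
  move=> mf mg; apply: measurable_funTS; apply/measurable_EFinP; apply: measurableT_comp => //.
  exact: measurable_funB.
have m1 := mabs _ _ ma mb; have m2 := mabs _ _ mb mc.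
rewrite -(ge0_integralD m mD (fun _ _ => _) m1 (fun _ _ => _) m2)//.
apply: ge0_le_integral => //.
- exact: mabs.
- exact: emeasurable_funD.
- by move=> z _; rewrite -EFinD lee_fin -(subrKA (b z)) ler_normD.
Qed.

(** * Existence and uniqueness of the trace *)

Section trace_identification.
Context {R : realType} {n : nat} (n_gt0 : (0 < n)%N).
Variables (f : 'rV[R]_n -> R) (G : 'rV[R]_n -> 'rV[R]_n).
Hypothesis fG : weak_gradient f G.
Variables (x : 'rV[R]_n) (t : R) (t_gt0 : 0 < t).
Local Notation mu := (lebesgue_rV R n).
Local Notation g := (sphere_trace f G x t).
Local Notation gap := (sobolev_gap f G t).

Let lf : loc_integrable f. Proof. by have [] := fG. Qed.
Let lG i : loc_integrable (fun z => G z ord0 i). Proof. by have [_ + _] := fG. Qed.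
Let mf := loc_integrable_measurable lf.
Let mG i := loc_integrable_measurable (lG i).
Let mB : measurable (eball x t) := @measurable_eball R n x t.
Let mg : measurable_fun [set: 'rV[R]_n] g := @measurable_sphere_trace R n f G mf mG x t.

Lemma eball_sub_cube : eball x t `<=` cube (`|x| + t).
Proof.
move=> z /ltW zt; rewrite /cube/= -(subrK x z) addrC (le_trans (ler_normD _ _))// lerD2l.
exact: le_trans (norm_le_enorm _) zt.
Qed.

Lemma ge0_le_integral_eball_cube (h : 'rV[R]_n -> R) :
  measurable_fun [set: 'rV[R]_n] h -> (forall z, 0 <= h z) ->
  (\int[mu]_(z in eball x t) (h z)%:E <= \int[mu]_(z in cube (`|x| + t)) (h z)%:E)%E.
Proof.
move=> mh h0; apply: ge0_subset_integral => //.
- exact: measurable_cube.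
- by apply: measurable_funTS; exact/measurable_EFinP.
- by move=> z _; rewrite lee_fin.
- exact: eball_sub_cube.
Qed.

Lemma integral_sobolev_gap phi : smooth phi ->
  (\int[mu]_(z in eball x t) (gap phi z)%:E =
   n%:R%:E * \int[mu]_(z in eball x t) `|phi z - f z|%:E +
   t%:E * \sum_i \int[mu]_(z in eball x t) `|partial i phi z - G z ord0 i|%:E)%E.
Proof.
move=> sp.
have mp : measurable_fun [set: 'rV[R]_n] phi.
  by apply: continuous_measurable_rV; exact: smooth_continuous.
have mdp i : measurable_fun [set: 'rV[R]_n] (partial i phi).
  by apply: continuous_measurable_rV; apply: smooth_continuous; exact: smooth_partial.
have m1 := measurable_funTS (D := eball x t) (measurable_absB mp mf).
have m2 i := measurable_funTS (D := eball x t) (measurable_absB (mdp i) (mG i)).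
have m3 : measurable_fun (eball x t) (fun z => (\sum_i `|partial i phi z - G z ord0 i|%:E)%E).
  by apply: emeasurable_sum => i; exact: m2.
have s0 z : (0 <= \sum_i `|partial i phi z - G z ord0 i|%:E)%E.
  by apply: sume_ge0 => i _; rewrite lee_fin.
rewrite -(ge0_integral_sum mu mB m2)//.
have n0 : (0 <= n%:R%:E :> \bar R)%E by rewrite lee_fin.
have t0 : (0 <= t%:E)%E by rewrite lee_fin ltW.
rewrite -(ge0_integralZl mu mB m1 (fun _ _ => _) n0)//.
rewrite -(ge0_integralZl mu mB m3 (fun z _ => s0 z) t0)//.
have m4 := emeasurable_funM (measurable_cst n%:R%:E) m1.
have m5 := emeasurable_funM (measurable_cst t%:E) m3.
rewrite -(ge0_integralD mu mB (fun _ _ => _) m4 (fun _ _ => _) m5)//.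
- by apply: eq_integral => z _; rewrite /sobolev_gap EFinD !EFinM -sumEFin.
- by move=> z _; rewrite mule_ge0// lee_fin.
- by move=> z _; rewrite mule_ge0.
Qed.

Lemma sobolev_gap_cvg0 (phi : nat -> 'rV[R]_n -> R) : (forall k, smooth (phi k)) ->
  (\int[mu]_(z in eball x t) `|phi k z - f z|%:E)%E @[k --> \oo] --> 0%E ->
  (forall i, (\int[mu]_(z in eball x t) `|partial i (phi k) z - G z ord0 i|%:E)%E @[k --> \oo] --> 0%E) ->
  (\int[mu]_(z in eball x t) (gap (phi k) z)%:E)%E @[k --> \oo] --> 0%E.
Proof.
move=> sp c0 c1; apply/ge0_cvge0P => [k|e e0].
  by apply: integral_ge0 => z _; rewrite lee_fin sobolev_gap_ge0// ltW.
(* If each of the integrals is at most [e / c], their weighted sum is at most [(n + t n) e / c]; the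
   1 keeps [c] positive. *)
pose c := n%:R + t * n%:R + 1.
have c_gt0 : 0 < c by rewrite ltr_wpDl// addr_ge0// mulr_ge0// ltW.
have ec : 0 < e / c by rewrite divr_gt0.
have I0 k : (0 <= \int[mu]_(z in eball x t) `|phi k z - f z|%:E)%E by apply: integral_ge0 => ? _; rewrite lee_fin.
have J0 i k : (0 <= \int[mu]_(z in eball x t) `|partial i (phi k) z - G z ord0 i|%:E)%E by apply: integral_ge0 => ? _; rewrite lee_fin.
have n0 := (ge0_cvge0P I0).1 c0 _ ec.
have n1 : \forall k \near \oo, forall i,
    (\int[mu]_(z in eball x t) `|partial i (phi k) z - G z ord0 i|%:E <= (e / c)%:E)%E.
  by apply: filter_forall => i; exact: ((ge0_cvge0P (J0 i)).1 (c1 i) _ ec).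
near=> k; rewrite integral_sobolev_gap//.
apply: (@le_trans _ _ (n%:R%:E * (e / c)%:E + t%:E * \sum_(i < n) (e / c)%:E)%E).
  apply: leeD; apply: lee_wpmul2l.
  - by rewrite lee_fin.
  - by near: k.
  - by rewrite lee_fin ltW.
  - by apply: lee_sum => i _; move: i; near: k.
rewrite sumEFin -!EFinM -EFinD lee_fin sumr_const card_ord -mulr_natr.
rewrite (_ : _ + _ = e * ((n%:R + t * n%:R) / c)); last by ring.
by rewrite ger_pMr// ler_pdivrMr// mul1r /c lerDl.
Unshelve. all: by end_near. Qed.

Lemma integral_esphere_gap phi : smooth phi ->
  (\int[sphere_measure x t]_(z in esphere x t) `|phi z - g z|%:E <=
   (t ^+ n.-1 * t ^- n)%:E * \int[mu]_(z in eball x t) (gap phi z)%:E)%E.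
Proof.
move=> sp; have mp : measurable_fun [set: 'rV[R]_n] phi.
  by apply: continuous_measurable_rV; exact: smooth_continuous.
have mpg := measurable_absB mp mg.
rewrite ge0_integral_esphere// ge0_integral_sphere_measure//.
rewrite EFinM -muleA; apply: lee_wpmul2l; first by rewrite lee_fin exprn_ge0// ltW.
exact: sphere_trace_gap.
Qed.

Lemma integral_esphere_cvg0 (phi : nat -> 'rV[R]_n -> R) : (forall k, smooth (phi k)) ->
  (\int[mu]_(z in eball x t) (gap (phi k) z)%:E)%E @[k --> \oo] --> 0%E ->
  (\int[sphere_measure x t]_(z in esphere x t) `|phi k z - g z|%:E)%E @[k --> \oo] --> 0%E.
Proof.
move=> sp c0; apply: (squeeze_cvge _ (cvg_cst 0%E)).
  apply: nearW => k; apply/andP; split; first by apply: integral_ge0 => ? _; rewrite lee_fin.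
  exact: integral_esphere_gap.
rewrite -[X in _ --> X](mule0 (t ^+ n.-1 * t ^- n)%:E).
by apply: cvgeZl.
Qed.

Lemma smooth_approximation_eball : exists phi : nat -> 'rV[R]_n -> R,
  [/\ forall k, smooth (phi k),
    (\int[mu]_(z in eball x t) `|phi k z - f z|%:E)%E @[k --> \oo] --> 0%E &
    forall i, (\int[mu]_(z in eball x t) `|partial i (phi k) z - G z ord0 i|%:E)%E @[k --> \oo] --> 0%E].
Proof.
have [phi [sp pf pG]] := smooth_approximation lf.
have mp k : measurable_fun [set: 'rV[R]_n] (phi k).
  by apply: continuous_measurable_rV; exact: smooth_continuous.
have mdp i k : measurable_fun [set: 'rV[R]_n] (partial i (phi k)).
  by apply: continuous_measurable_rV; apply: smooth_continuous; exact: smooth_partial.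
have c0 : (\int[mu]_(z in eball x t) `|phi k z - f z|%:E)%E @[k --> \oo] --> 0%E.
  apply: (squeeze_cvge _ (cvg_cst 0%E) (pf (`|x| + t))).
  apply: nearW => k; apply/andP; split; first by apply: integral_ge0 => ? _; rewrite lee_fin.
  apply: ge0_le_integral_eball_cube => //.
  by apply: measurableT_comp => //; exact: measurable_funB.
have c1 i : (\int[mu]_(z in eball x t) `|partial i (phi k) z - G z ord0 i|%:E)%E @[k --> \oo] --> 0%E.
  apply: (squeeze_cvge _ (cvg_cst 0%E) (pG G fG i (`|x| + t))).
  apply: nearW => k; apply/andP; split; first by apply: integral_ge0 => ? _; rewrite lee_fin.
  apply: ge0_le_integral_eball_cube => //.
  by apply: measurableT_comp => //; exact: measurable_funB.
by exists phi.
Qed.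

Lemma is_trace_sphere_trace : is_trace f x t g.
Proof.
split.
  apply/integrableP; split; first exact/measurable_EFinP.
  (* Integrability is read off the trace inequality for the zero function, whose gap is
     [n |f| + t sum_i |G_i|]. *)
  have s0 : smooth (cst 0 : 'rV[R]_n -> R) by apply: bump_algebra_smooth; exact: bump_cst.
  have p0 i : partial i (cst 0 : 'rV[R]_n -> R) = cst 0.
    by apply/funext => z; exact: derive_cst.
  have mag : measurable_fun [set: 'rV[R]_n] (fun z => `|(EFin \o g) z|%E).
    by apply/measurable_EFinP; apply: measurableT_comp.
  rewrite -ge0_integral_esphere//.
  apply: (@le_lt_trans _ _ (\int[sphere_measure x t]_(z in esphere x t) `|cst 0 z - g z|%:E)%E).
    by rewrite le_eqVlt; apply/orP; left; apply/eqP; apply: eq_integral => z _; rewrite /= sub0r normrN.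
  apply: le_lt_trans (integral_esphere_gap s0) _.
  have cfin (h : 'rV[R]_n -> R) : loc_integrable h ->
      (\int[mu]_(z in eball x t) `|0 - h z|%:E < +oo)%E.
    move=> lh; have mh := loc_integrable_measurable lh.
    apply: (@le_lt_trans _ _ (\int[mu]_(z in cube (`|x| + t)) `|0 - h z|%:E)%E).
      apply: ge0_le_integral_eball_cube => //.
      by apply: measurableT_comp => //; exact: measurable_funB.
    have [_] := integrableP _ _ _ (loc_integrable_cube (`|x| + t) lh).
    by under eq_integral do rewrite /= -normrN -sub0r.
  rewrite integral_sobolev_gap// lte_mul_pinfty//.
    by rewrite lee_fin mulr_ge0 ?invr_ge0 ?exprn_ge0// ltW.
  apply: lte_add_pinfty; apply: lte_mul_pinfty; rewrite ?lee_fin ?ler0n// ?ltW//.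
    exact: cfin.
  by apply: lte_sum_pinfty => i _; rewrite p0; exact: cfin.
exists G; split => //.
have [phi [sp c0 c1]] := smooth_approximation_eball.
have mp k : measurable_fun [set: 'rV[R]_n] (phi k).
  by apply: continuous_measurable_rV; exact: smooth_continuous.
have mdp i k : measurable_fun [set: 'rV[R]_n] (partial i (phi k)).
  by apply: continuous_measurable_rV; apply: smooth_continuous; exact: smooth_partial.
exists phi; split => //; last by apply: integral_esphere_cvg0 => //; exact: sobolev_gap_cvg0.
(* The Euclidean norm of the gradient error is at most the sum of its coordinates, hence at most
   [t^-1] times the gap. *)
apply: (@squeeze_cvge _ _ _ _ (cst 0%E) _ (fun k => t^-1%:E * \int[mu]_(z in eball x t) (gap (phi k) z)%:E)%E).
- apply: nearW => k; apply/andP; split.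
    by apply: integral_ge0 => z _; rewrite lee_fin enorm_ge0.
  rewrite -ge0_integralZl//; first last.
  + by rewrite lee_fin invr_ge0 ltW.
  + by move=> z _; rewrite lee_fin sobolev_gap_ge0.
  + by apply: measurable_funTS; apply/measurable_EFinP; exact: measurable_sobolev_gap.
  apply: ge0_le_integral => //.
  + by move=> z _; rewrite lee_fin enorm_ge0.
  + apply: measurable_funTS; apply/measurable_EFinP; apply: (measurableT_comp (@measurable_enorm R n)).
    apply: measurable_rVB; apply: (@measurable_fun_rVP R _ _ n) => i; last exact: mG.
    by under eq_fun do rewrite mxE; exact: mdp.
  + apply: measurable_funTS; apply: emeasurable_funM => //.
    by apply/measurable_EFinP; exact: measurable_sobolev_gap.
  + move=> z _; rewrite -EFinM lee_fin /sobolev_gap mulrDr mulKf ?gt_eqF//.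
    rewrite (le_trans (enorm_le_sum _))//.
    under eq_bigr do rewrite !mxE.
    by rewrite lerDr !mulr_ge0// invr_ge0 ltW.
- exact: cvg_cst.
- rewrite -[X in _ --> X](mule0 t^-1%:E); apply: cvgeZl => //.
  exact: sobolev_gap_cvg0.
Qed.

(** The functions approximating [h] also approximate [f] on the ball, so the trace inequality makes
    them converge to [g] on the sphere; limits in L^1 of the sphere agree. *)
Lemma is_trace_unique h : is_trace f x t h ->
  (\int[sphere_measure x t]_(z in esphere x t) `|h z|%:E =
   \int[sphere_measure x t]_(z in esphere x t) `|g z|%:E)%E.
Proof.
move=> [/integrableP[/measurable_EFinP mh _] [H [fH [phi [sp c0 cH ch]]]]].
have [_ lH _] := fH.
have mH i := loc_integrable_measurable (lH i).
have mp k : measurable_fun [set: 'rV[R]_n] (phi k).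
  by apply: continuous_measurable_rV; exact: smooth_continuous.
have mdp i k : measurable_fun [set: 'rV[R]_n] (partial i (phi k)).
  by apply: continuous_measurable_rV; apply: smooth_continuous; exact: smooth_partial.
have mHv : measurable_fun [set: 'rV[R]_n] H.
  by apply: (@measurable_fun_rVP R _ _ n) => i; exact: mH.
have mgr k : measurable_fun [set: 'rV[R]_n] (grad (phi k)).
  by apply: (@measurable_fun_rVP R _ _ n) => i; under eq_fun do rewrite mxE; exact: mdp.
(* The definition of a trace allows a weak gradient [H] of its own; it differs from [G] by a
   function of zero L^1 norm on the ball. *)
have c1 i : (\int[mu]_(z in eball x t) `|partial i (phi k) z - G z ord0 i|%:E)%E @[k --> \oo] --> 0%E.
  apply: (squeeze_cvge _ (cvg_cst 0%E) cH).
  apply: nearW => k; apply/andP; split; first by apply: integral_ge0 => ? _; rewrite lee_fin.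
  have HG0 : (\int[mu]_(z in eball x t) `|H z ord0 i - G z ord0 i|%:E = 0)%E.
    apply/eqP; rewrite eq_le integral_ge0 ?andbT//.
    rewrite -(weak_gradient_unique i (`|x| + t) fH fG).
    apply: ge0_le_integral_eball_cube => //.
    by apply: measurableT_comp => //; exact: measurable_funB.
  have m1 : measurable_fun (eball x t) (fun z => (enorm (grad (phi k) z - H z))%:E).
    apply: measurable_funTS; apply/measurable_EFinP; apply: (measurableT_comp (@measurable_enorm R n)).
    exact: measurable_rVB.
  have m2 := measurable_funTS (D := eball x t) (measurable_absB (mH i) (mG i)).
  rewrite -[leRHS]adde0 -HG0 -(ge0_integralD mu mB (fun _ _ => _) m1 (fun _ _ => _) m2)//; last first.
    by move=> z _; rewrite lee_fin enorm_ge0.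
  apply: ge0_le_integral => //.
  - by apply: measurable_funTS; exact: measurable_absB.
  - exact: emeasurable_funD.
  - move=> z _; rewrite -EFinD lee_fin -(subrKA (H z ord0 i)) (le_trans (ler_normD _ _))//.
    rewrite lerD2r (le_trans _ (ler_coord_enorm _ i))// !mxE//.
have S0h (k : nat -> 'rV[R]_n -> R) j : (0 <= \int[sphere_measure x t]_(z in esphere x t) `|k j z|%:E)%E.
  by apply: integral_ge0 => z _; rewrite lee_fin.
have cg := integral_esphere_cvg0 sp (sobolev_gap_cvg0 sp c0 c1).
have mhg := measurable_absB mh mg.
have mS := @measurable_esphere R n x t.
have hg0 : (\int[sphere_measure x t]_(z in esphere x t) `|h z - g z|%:E = 0)%E.
  apply/eqP; rewrite eq_le integral_ge0 ?andbT//.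
  apply/lee_addgt0Pr => e e0; rewrite add0e.
  have e2 : 0 < e / 2 by rewrite divr_gt0.
  have n1 := (ge0_cvge0P (S0h (fun k z => phi k z - h z))).1 ch _ e2.
  have n2 := (ge0_cvge0P (S0h (fun k z => phi k z - g z))).1 cg _ e2.
  have [k [k1 k2]] := @filter_ex _ \oo _ _ (filterI n1 n2).
  apply: (le_trans (integral_abs_triangle (sphere_measure x t) mS mh (mp k) mg)).
  rewrite [e]splitr EFinD; apply: leeD => //.
  by under eq_integral do rewrite distrC.
have abs0 (k : 'rV[R]_n -> R) : (\int[sphere_measure x t]_(z in esphere x t) `|k z|%:E =
    \int[sphere_measure x t]_(z in esphere x t) `|k z - cst 0 z|%:E)%E.
  by apply: eq_integral => z _; rewrite /= subr0.
have m0 : measurable_fun [set: 'rV[R]_n] (cst 0 : 'rV[R]_n -> R) by exact: measurable_cst.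
rewrite (abs0 h) (abs0 g); apply/eqP; rewrite eq_le; apply/andP; split.
  have := integral_abs_triangle (sphere_measure x t) mS mh mg m0.
  by rewrite hg0 add0e.
have := integral_abs_triangle (sphere_measure x t) mS mg mh m0.
by under [X in (_ <= X + _)%E -> _]eq_integral do rewrite distrC; rewrite hg0 add0e.
Qed.

(** Existence makes [get] return some trace, and uniqueness identifies the integral of its absolute
    value. *)
Lemma integral_trace :
  (\int[sphere_measure x t]_(z in esphere x t) `|trace f x t z|%:E =
   (t ^+ n.-1)%:E * (n%:R%:E * \int[mu]_(w in punctured_ball) `|g (x + t *: edir w)|%:E))%E.
Proof.
rewrite (is_trace_unique (getPex (P := is_trace f x t) (ex_intro _ _ is_trace_sphere_trace))).
have mag : measurable_fun [set: 'rV[R]_n] (fun z => `|g z|%:E).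
  by apply/measurable_EFinP; exact: measurableT_comp.
by rewrite ge0_integral_esphere// ge0_integral_sphere_measure.
Qed.

Lemma integrable_sphere_trace : mu.-integrable punctured_ball (fun w => (g (x + t *: edir w))%:E).
Proof.
have me : measurable_fun [set: 'rV[R]_n] (fun w => x + t *: edir w).
  exact: (measurableT_comp (measurable_rV_affine x t) (@measurable_edir R n)).
have mag : measurable_fun [set: 'rV[R]_n] (fun z => `|g z|%:E).
  by apply/measurable_EFinP; exact: measurableT_comp.
apply/integrableP; split.
  by apply: measurable_funTS; apply/measurable_EFinP; exact: (measurableT_comp mg me).
have [/integrableP[_ +] _] := is_trace_sphere_trace; rewrite /comp/=.
rewrite ge0_integral_sphere_measure//= => I; rewrite ltey; apply/eqP => Ioo; move: I.
by rewrite Ioo gt0_muley ?lte_fin ?ltr0n// gt0_muley// lte_fin exprn_gt0.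
Qed.

End trace_identification.

(** * The exterior identity *)

Section soft_absolute_value.
Context {R : realType}.
Implicit Types a b s : R.

Definition softnorm (e s : R) : R := Num.sqrt (s ^+ 2 + e ^+ 2).

(** Subtracting [e] makes the value at 0 vanish, so that [softabs e s] lies between 0 and [|s|] and
    [|s|] serves as a dominating function. *)
Definition softabs (e s : R) : R := softnorm e s - e.

Definition softsgn (e s : R) : R := s / softnorm e s.

Variables (e : R) (e_gt0 : 0 < e).
Local Notation w := (softnorm e).

Let sum_gt0 s : 0 < s ^+ 2 + e ^+ 2.
Proof. by rewrite ltr_wpDl ?sqr_ge0// exprn_gt0. Qed.

Lemma softnorm_gt0 s : 0 < w s. Proof. by rewrite sqrtr_gt0. Qed.

Lemma sqr_softnorm s : w s ^+ 2 = s ^+ 2 + e ^+ 2.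
Proof. by rewrite sqr_sqrtr// ltW. Qed.

Lemma ler_softnorm s : `|s| <= w s.
Proof. by rewrite -sqrtr_sqr ler_sqrt ?(ltW (sum_gt0 _))// lerDl sqr_ge0. Qed.

Lemma softnorm_ge s : e <= w s.
Proof.
by rewrite -{1}(ger0_norm (ltW e_gt0)) -sqrtr_sqr ler_sqrt ?(ltW (sum_gt0 _))// lerDr sqr_ge0.
Qed.

Lemma softnorm_le s : w s <= `|s| + e.
Proof.
have se0 : 0 <= `|s| + e by rewrite addr_ge0// ltW.
rewrite (_ : `|s| + e = Num.sqrt ((`|s| + e) ^+ 2)); last by rewrite sqrtr_sqr (ger0_norm se0).
rewrite ler_sqrt ?sqr_ge0// sqrrD real_normK ?num_real//.
rewrite lerD2r lerDl mulrn_wge0// mulr_ge0//; exact: ltW.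
Qed.

(** After multiplication by [w a + w b] the left side is [|a^2 - b^2|], and
    [|a + b| <= w a + w b]. *)
Lemma softnorm_lipschitz a b : `|w a - w b| <= `|a - b|.
Proof.
have wab : 0 < w a + w b by rewrite addr_gt0 ?softnorm_gt0.
rewrite -(ler_pM2r wab) -[X in _ * X <= _](gtr0_norm wab) -normrM -subr_sqr.
rewrite !sqr_softnorm opprD addrACA subrr addr0 subr_sqr normrM ler_wpM2l//.
by rewrite (le_trans (ler_normD _ _))// lerD// ler_softnorm.
Qed.

Lemma softabs_lipschitz a b : `|softabs e a - softabs e b| <= `|a - b|.
Proof. by rewrite /softabs opprB addrA subrK softnorm_lipschitz. Qed.

Lemma softabs_ge0 s : 0 <= softabs e s.
Proof. by rewrite subr_ge0 softnorm_ge. Qed.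

Lemma softabs_le s : softabs e s <= `|s|.
Proof. by rewrite lerBlDr softnorm_le. Qed.

Lemma softabs_near s : `| `|s| - softabs e s | <= e.
Proof.
rewrite ger0_norm ?subr_ge0 ?softabs_le// lerBlDr /softabs addrC subrK.
exact: ler_softnorm.
Qed.

Lemma norm_softsgn s : `|softsgn e s| <= 1.
Proof.
rewrite normrM normfV (gtr0_norm (softnorm_gt0 s)) ler_pdivrMr ?softnorm_gt0// mul1r.
exact: ler_softnorm.
Qed.

(** The difference equals [(w a)^-1 ((a - b) + softsgn e b (w b - w a))]: two terms of size at most
    [|a - b|], and [w a >= e]. The constant blows up as [e] tends to 0, so [e] stays fixed while [f]
    is approximated. *)
Lemma softsgn_lipschitz a b : `|softsgn e a - softsgn e b| <= 2 / e * `|a - b|.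
Proof.
have wa := softnorm_gt0 a; have wb := softnorm_gt0 b.
have -> : softsgn e a - softsgn e b = (w a)^-1 * ((a - b) + softsgn e b * (w b - w a)).
  by rewrite /softsgn; field; rewrite !gt_eqF.
have wai : 0 < (w a)^-1 by rewrite invr_gt0.
rewrite normrM (gtr0_norm wai).
apply: (@le_trans _ _ ((w a)^-1 * (2 * `|a - b|))).
  rewrite ler_wpM2l ?invr_ge0 ?(ltW wa)// (le_trans (ler_normD _ _))// mulr_natl mulr2n lerD2l.
  rewrite normrM -[leRHS]mul1r ler_pM// ?norm_softsgn// distrC.
  exact: softnorm_lipschitz.
by rewrite mulrAC mulrC ler_wpM2l ?mulr_ge0// lef_pV2 ?posrE// softnorm_ge.
Qed.

Lemma softsgn_near s : `|Num.sg s - softsgn e s| <= e / `|s|.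
Proof.
(* At 0 both sides are 0, the right one because [0^-1 = 0]. *)
have [->|s0] := eqVneq s 0.
  by rewrite sgr0 /softsgn mul0r subr0 normr0 invr0 mulr0.
have ws := softnorm_gt0 s; have s1 : 0 < `|s| by rewrite normr_gt0.
have -> : Num.sg s - softsgn e s = Num.sg s * ((w s - `|s|) / w s).
  by rewrite /softsgn {2}[s]numEsg; field; rewrite gt_eqF.
rewrite normrM normr_sg s0 mul1r normrM normfV (gtr0_norm ws).
rewrite ger0_norm ?subr_ge0 ?ler_softnorm//.
apply: ler_pM; rewrite ?subr_ge0 ?ler_softnorm ?invr_ge0 ?(ltW ws)//.
  by rewrite lerBlDl softnorm_le.
by rewrite lef_pV2 ?posrE// ler_softnorm.
Qed.

Lemma is_derive_softabs s : is_derive s (1 : R) (softabs e) (softsgn e s).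
Proof.
have dX0 : is_derive s (1 : R) (fun s : R => s ^+ 2) (2%:R * s).
  apply: DeriveDef; first exact: exprn_derivable.
  by rewrite exp_derive [_ *: _]mulr1 expr1.
have dX : is_derive s (1 : R) (fun s : R => s ^+ 2 + e ^+ 2) (2%:R * s).
  by apply: is_derive_eq (is_deriveD dX0 (is_derive_cst (e ^+ 2) s (1 : R))) _; rewrite addr0.
have dq := is_derive1_sqrt (sum_gt0 s).
have dc := @is_derive1_comp R Num.sqrt (fun s => s ^+ 2 + e ^+ 2) s _ _ dq dX.
apply: is_derive_eq (is_deriveB dc (is_derive_cst e s (1 : R))) _.
rewrite subr0 /softsgn /softnorm /GRing.scale/=.
by field; rewrite gt_eqF// sqrtr_gt0.
Qed.

Lemma continuous_softabs : continuous (softabs e).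
Proof.
by move=> s; apply: differentiable_continuous; apply/derivable1_diffP; have [] := is_derive_softabs s.
Qed.

Lemma continuous_softsgn : continuous (softsgn e).
Proof.
have -> : softsgn e = fun s => s * (softabs e s + e)^-1.
  by apply/funext => s; rewrite /softabs subrK.
move=> s; apply: cvgM; first exact: cvg_id.
apply: cvgV; first by rewrite /softabs subrK gt_eqF// softnorm_gt0.
by apply: cvgD; [exact: continuous_softabs|exact: cvg_cst].
Qed.

End soft_absolute_value.

(** * The identity on a ray for smooth functions *)

Section exterior_identity.
Context {R : realType} {n : nat} (n_gt0 : (0 < n)%N).
Implicit Types (f phi : 'rV[R]_n -> R) (G : 'rV[R]_n -> 'rV[R]_n) (z w : 'rV[R]_n).
Local Notation mu := (lebesgue_rV R n).
Local Notation leb := (@lebesgue_measure R).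
Variables (x : 'rV[R]_n) (t T : R) (t_gt0 : 0 < t) (tT : t < T) (e : R) (e_gt0 : 0 < e).

Definition shell : set 'rV[R]_n := [set z | t <= enorm (z - x) < T].

(* On the ray [r |-> x + r theta] and for [G = grad f], [r ^+ n.-1] times this is
   the derivative of [(1 - r / T) * softabs e (f (x + r theta))] on [t <= r < T]. *)
Definition exterior_density f G z : R :=
  \1_shell z * ((enorm (z - x) ^+ n.-1)^-1 *
    ((1 - enorm (z - x) / T) * (softsgn e (f z) * dot (G z) (edir (z - x))) - softabs e (f z) / T)).

Let T_gt0 : 0 < T := lt_trans t_gt0 tT.

Lemma measurable_enormB : measurable_fun [set: 'rV[R]_n] (fun z => enorm (z - x)).
Proof. by apply: (measurableT_comp (@measurable_enorm R n)); exact: measurable_rVB. Qed.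

Lemma measurable_enormBXV : measurable_fun [set: 'rV[R]_n] (fun z => (enorm (z - x) ^+ n.-1)^-1).
Proof.
rewrite (_ : (fun _ => _) = (fun z => enorm (z - x) `^ (- n.-1%:R))); last first.
  by apply/funext => z; rewrite powRN powR_mulrn// enorm_ge0.
exact: (measurableT_comp (@measurable_powR R _) measurable_enormB).
Qed.

Lemma measurable_shell : measurable shell.
Proof.
rewrite (_ : shell = setT `&` (fun z => enorm (z - x)) @^-1` `[t, T[).
  by apply: measurable_enormB => //; exact: measurable_itv.
by rewrite setTI; apply/seteqP; split => z /=; rewrite in_itv.
Qed.

Lemma measurable_exterior_density f G : measurable_fun [set: 'rV[R]_n] f ->
  (forall i, measurable_fun [set: 'rV[R]_n] (fun z => G z ord0 i)) ->
  measurable_fun [set: 'rV[R]_n] (exterior_density f G).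
Proof.
move=> mf mG; have mGv : measurable_fun [set: 'rV[R]_n] G by exact: (@measurable_fun_rVP R _ _ n).
have m1 := @measurable_indic _ _ R setT _ measurable_shell.
have md : measurable_fun [set: 'rV[R]_n] (fun z => edir (z - x)).
  by apply: (measurableT_comp (@measurable_edir R n)); exact: measurable_rVB.
have ms : measurable_fun [set: 'rV[R]_n] (fun z => softsgn e (f z)).
  by apply: (measurableT_comp _ mf); apply: continuous_measurable_fun; exact: continuous_softsgn.
have ma : measurable_fun [set: 'rV[R]_n] (fun z => softabs e (f z)).
  by apply: (measurableT_comp _ mf); apply: continuous_measurable_fun; exact: continuous_softabs.
apply: measurable_funM => //; apply: measurable_funM; first exact: measurable_enormBXV.
apply: measurable_funB; last by apply: measurable_funM.
apply: measurable_funM.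
  by apply: measurable_funB => //; apply: measurable_funM => //; exact: measurable_enormB.
by apply: measurable_funM => //; exact: measurable_dot.
Qed.

(** The Jacobian [r^(n-1)] cancels the weight of the density, and the fundamental theorem of
    calculus on [[t, T]] leaves only the endpoint [t], because [1 - r / T] vanishes at [T]. *)
Lemma exterior_ray phi w : smooth phi -> w != 0 ->
  (\int[leb]_(r in `]0%R, +oo[) (r ^+ n.-1 * exterior_density phi (grad phi) (x + r *: edir w))%:E =
   (- ((1 - t / T) * softabs e (phi (x + t *: edir w))))%:E)%E.
Proof.
move=> sp w0; set theta := edir w.
have e1 : enorm theta = 1 by exact: enorm_edir.
pose F r := (1 - r / T) * softabs e (phi (x + r *: theta)).
pose h r := (1 - r / T) * (softsgn e (phi (x + r *: theta)) * dot (grad phi (x + r *: theta)) theta) -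
  softabs e (phi (x + r *: theta)) / T.
have dF r : is_derive r (1 : R) F (h r).
  have d1 : is_derive r (1 : R) (fun r : R => 1 - r / T) (- T^-1).
    apply: is_derive_eq (is_deriveB (is_derive_cst (1 : R) r 1)
      (is_deriveM (is_derive_id r (1 : R)) (is_derive_cst T^-1 r (1 : R)))) _.
    by rewrite sub0r scaler0 add0r [_ *: _]mulr1.
  have d2 := @is_derive1_comp R (softabs e) (fun r => phi (x + r *: theta)) r _ _
    (is_derive_softabs e_gt0 _) (is_derive_ray x theta r sp).
  apply: is_derive_eq (is_deriveM d1 d2) _.
  by rewrite /h /GRing.scale/= mulrN.
have ch : continuous h.
  have cp := @continuous_ray R n phi x theta sp.
  have cu := @continuous_ray_grad R n phi x theta sp.
  move=> r; apply: cvgB.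
    apply: cvgM.
      by apply: cvgB; [exact: cvg_cst|apply: cvgMl; exact: cvg_id].
    apply: cvgM; last exact: cu.
    exact: (continuous_comp (cp r) (@continuous_softsgn R e e_gt0 _)).
  apply: cvgMl.
  exact: (continuous_comp (cp r) (@continuous_softabs R e e_gt0 _)).
have sub r : x + r *: theta - x = r *: theta by rewrite addrC addKr.
have en r : 0 < r -> enorm (x + r *: theta - x) = r.
  by move=> r0; rewrite sub enormZ e1 mulr1 gtr0_norm.
have ed r : 0 < r -> edir (x + r *: theta - x) = theta.
  by move=> r0; rewrite sub edirZ// /theta edir_edir.
have FT := FTC2_oo tT ch dF.
have -> : - ((1 - t / T) * softabs e (phi (x + t *: theta))) = \int[leb]_(r in `]t, T[) h r.
  by rewrite FT /F divff ?gt_eqF// subrr mul0r sub0r.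
rewrite /Rintegral fineK; last exact: (integrable_fin_num _ (integrable_continuous_itvoo t T ch)).
have mh : measurable_fun [set: R] (EFin \o h).
  by apply/measurable_EFinP; exact: continuous_measurable_fun.
rewrite -(integral_itv_bndoo true true (measurable_funTS mh)).
rewrite integral_mkcond_indic [RHS]integral_mkcond_indic; apply: eq_integral => r _.
rewrite -!EFinM; congr EFin; rewrite !indicE !mem_setE.
have [rJ|rJ] := boolP (r \in `[t, T[).
  have /andP[tr rT] : t <= r < T by move: rJ; rewrite in_itv.
  have r0 : 0 < r := lt_le_trans t_gt0 tr.
  have rI : r \in `]0%R, +oo[ by rewrite in_itv/= r0.
  have sr : shell (x + r *: theta) by rewrite /shell/= en// tr.
  rewrite rI /exterior_density indicE mem_set// mul1r en// ed// !mulr1.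
  by rewrite mulVKf// expf_neq0// gt_eqF.
have [rI|rI] := boolP (r \in `]0%R, +oo[); last by rewrite !mulr0.
have r0 : 0 < r by move: rI; rewrite in_itv/= andbT.
rewrite /exterior_density indicE memNset ?(mul0r, mulr0)//.
by rewrite /shell/= en//; move: rJ; rewrite in_itv => /negP.
Qed.

End exterior_identity.

Lemma continuous_loc_integrable (R : realType) (n : nat) (f : 'rV[R]_n -> R) :
  continuous f -> loc_integrable f.
Proof.
move=> cf K cK; have mK := compact_measurable_rV cK.
have /compact_bounded[M [Mr hM]] : compact (f @` K).
  by apply: continuous_compact => //; exact: continuous_subspaceT.
apply: (le_integrable mK _ _ (loc_integrable_cst (M + 1) cK)).
  by apply: measurable_funTS; apply/measurable_EFinP; exact: continuous_measurable_rV.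
move=> z Kz /=; rewrite lee_fin; apply: le_trans (ler_norm _).
by apply: (hM (M + 1)); [rewrite ltrDl|exists z].
Qed.

(** * Bounds for the exterior density and its boundary term *)

Section exterior_estimates.
Context {R : realType} {n : nat} (n_gt0 : (0 < n)%N).
Implicit Types (f phi : 'rV[R]_n -> R) (G H : 'rV[R]_n -> 'rV[R]_n) (z w y : 'rV[R]_n).
Local Notation mu := (lebesgue_rV R n).
Local Notation leb := (@lebesgue_measure R).
Local Notation PB := (punctured_ball : set 'rV[R]_n).
Variables (x : 'rV[R]_n) (t T : R) (t_gt0 : 0 < t) (tT : t < T) (e : R) (e_gt0 : 0 < e).

Definition l1norm y : R := \sum_i `|y ord0 i|.

Local Notation ext := (exterior_density x t T e).
Local Notation shl := (shell x t T).
Local Notation ball := (eball x T).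

Let T_gt0 : 0 < T := lt_trans t_gt0 tT.

Lemma l1norm_ge0 y : 0 <= l1norm y. Proof. exact: sumr_ge0. Qed.

Lemma dotBl y y' z : dot (y - y') z = dot y z - dot y' z.
Proof. by rewrite /dot -sumrB; apply: eq_bigr => i _; rewrite !mxE mulrBl. Qed.

(** Three errors are separated: that of the gradient, that of the sign factor against the gradient
    [G] of the limit, and that of the function through the cutoff term. *)
Lemma exterior_density_gap f G phi H z :
  `|ext phi H z - ext f G z| <= \1_shl z * ((enorm (z - x) ^+ n.-1)^-1 *
    (l1norm (H z - G z) + `|softsgn e (phi z) - softsgn e (f z)| * l1norm (G z) + `|phi z - f z| / T)).
Proof.
rewrite /exterior_density indicE; have [/set_mem zS|_] := boolP (z \in shl); last first.
  by rewrite !mul0r subr0 normr0.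
rewrite !mul1r; have /andP[tr rT] := zS.
have r0 : 0 < enorm (z - x) := lt_le_trans t_gt0 tr.
have e1 : enorm (edir (z - x)) = 1 by rewrite enorm_edir// -enorm_gt0.
have w0 : 0 <= (enorm (z - x) ^+ n.-1)^-1 by rewrite invr_ge0 exprn_ge0// ltW.
set r := enorm (z - x) in tr rT r0 w0 *; set theta := edir (z - x) in e1 *.
rewrite -mulrBr normrM (ger0_norm w0) ler_wpM2l//.
have c0 : 0 <= 1 - r / T by rewrite subr_ge0 ler_pdivrMr// mul1r ltW.
have c1 : `|1 - r / T| <= 1 by rewrite ger0_norm// gerBl divr_ge0// ltW.
have nT : `|T^-1| = T^-1 by rewrite ger0_norm// invr_ge0 ltW.
set b1 := softsgn e (phi z); set b2 := softsgn e (f z).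
set u1 := softabs e (phi z); set u2 := softabs e (f z).
(* Adding and subtracting [b1 (G z . theta)] lets the bounded factor [b1] multiply the gradient
   error. *)
have -> : (1 - r / T) * (b1 * dot (H z) theta) - u1 / T - ((1 - r / T) * (b2 * dot (G z) theta) - u2 / T) =
    (1 - r / T) * (b1 * dot (H z - G z) theta + (b1 - b2) * dot (G z) theta) - (u1 - u2) / T.
  by rewrite dotBl; ring.
rewrite (le_trans (ler_normB _ _))// lerD//.
  rewrite normrM -[leRHS]mul1r ler_pM// (le_trans (ler_normD _ _))// lerD// normrM.
    rewrite -[leRHS]mul1r ler_pM// ?norm_softsgn//.
    by rewrite (le_trans (dot_le_sum _ _))// e1 mulr1.
  by rewrite ler_wpM2l// (le_trans (dot_le_sum _ _))// e1 mulr1.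
rewrite normrM nT ler_wpM2r ?invr_ge0 ?(ltW T_gt0)//; exact: softabs_lipschitz.
Qed.

(** The gap estimate relative to the zero function with zero gradient, whose density vanishes since
    [softabs e 0 = 0]. *)
Lemma exterior_density_le f G z : `|ext f G z| <=
  \1_shl z * ((enorm (z - x) ^+ n.-1)^-1 * (l1norm (G z) + `|f z| / T)).
Proof.
have l0 : l1norm (0 : 'rV[R]_n) = 0.
  by rewrite /l1norm big1// => i _; rewrite mxE normr0.
have d0 y : dot (0 : 'rV[R]_n) y = 0.
  by rewrite /dot big1// => i _; rewrite mxE mul0r.
have s0 : softabs e 0 = 0.
  by rewrite /softabs /softnorm expr0n add0r sqrtr_sqr gtr0_norm// subrr.
have := exterior_density_gap (fun=> 0) (fun=> 0) f G z.
by rewrite {2}/exterior_density d0 s0 !mulr0 mul0r !subr0 mulr0 mulr0 subr0 l0 mulr0 addr0.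
Qed.

Lemma shell_weight_ge0 z : 0 <= \1_shl z * (enorm (z - x) ^+ n.-1)^-1.
Proof. by rewrite mulr_ge0// invr_ge0 exprn_ge0// enorm_ge0. Qed.

Lemma shell_weight_le z : \1_shl z * (enorm (z - x) ^+ n.-1)^-1 <= (t ^+ n.-1)^-1 * \1_ball z.
Proof.
rewrite !indicE; have [/set_mem /andP[tr rT]|_] := boolP (z \in shl); last first.
  by rewrite mul0r mulr_ge0// invr_ge0 exprn_ge0// ltW.
rewrite mem_set// mul1r mulr1 lef_pV2 ?posrE ?exprn_gt0//; last exact: lt_le_trans tr.
by apply: lerXn2r => //; rewrite nnegrE ?enorm_ge0 ?(ltW t_gt0).
Qed.

Lemma integrable_exterior_density f G : loc_integrable f ->
  (forall i, loc_integrable (fun z => G z ord0 i)) -> mu.-integrable setT (EFin \o ext f G).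
Proof.
move=> lf lG; have mf := loc_integrable_measurable lf.
have mG i := loc_integrable_measurable (lG i).
pose C := (t ^+ n.-1)^-1; pose M := `|x| + T.
have C0 : 0 <= C by rewrite invr_ge0 exprn_ge0// ltW.
have iG : mu.-integrable setT (fun z => \sum_i (C * `|G z ord0 i| * \1_(cube M) z)%:E)%E.
  by apply: (integrable_sum measurableT) => i _; exact: (integrable_cube_patch M C (lG i)).
have iS := integrableD measurableT iG (integrable_cube_patch M (C / T) lf).
apply: (le_integrable measurableT _ _ iS).
  by apply/measurable_EFinP; exact: measurable_exterior_density.
move=> z _; rewrite /= sumEFin -EFinD /= lee_fin.
have -> : \sum_i C * `|G z ord0 i| * \1_(cube M) z + C / T * `|f z| * \1_(cube M) z =
    C * \1_(cube M) z * (l1norm (G z) + `|f z| / T).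
  by rewrite -mulr_suml -mulr_sumr -/(l1norm _); ring.
have q0 : 0 <= l1norm (G z) + `|f z| / T by rewrite addr_ge0 ?l1norm_ge0// divr_ge0// ltW.
rewrite [leRHS]ger0_norm; last by rewrite mulr_ge0// mulr_ge0.
rewrite (le_trans (exterior_density_le _ _ _))// mulrA ler_wpM2r//.
rewrite (le_trans (shell_weight_le z))// ler_wpM2l// !indicE.
case: (boolP (z \in ball)) => // /set_mem zb.
by rewrite mem_set//; exact: (@eball_sub_cube R n x T z zb).
Qed.

Lemma abs_RintegralB_le d (X : measurableType d) (m : {measure set X -> \bar R}) (D : set X)
    (a b : X -> R) : measurable D -> m.-integrable D (EFin \o a) -> m.-integrable D (EFin \o b) ->
  (`| \int[m]_(z in D) a z - \int[m]_(z in D) b z |%:E <= \int[m]_(z in D) `|a z - b z|%:E)%E.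
Proof.
move=> mD ia ib; have iab := integrableB mD ia ib.
rewrite -RintegralB// /Rintegral -abse_EFin fineK; last exact: (integrable_fin_num mD iab).
by apply: le_abse_integral => //; exact: measurable_int iab.
Qed.

(** The boundary term left by the fundamental theorem of calculus on the ray through [w], as a
    function of the values of [g] on the sphere. *)
Definition sphere_potential (g : 'rV[R]_n -> R) w : R :=
  - ((1 - t / T) * softabs e (g (x + t *: edir w))).

Lemma sphere_potential_lipschitz g h w : `|sphere_potential g w - sphere_potential h w| <=
  `|g (x + t *: edir w) - h (x + t *: edir w)|.
Proof.
have c0 : 0 <= 1 - t / T by rewrite subr_ge0 ler_pdivrMr// mul1r ltW.
rewrite /sphere_potential opprK addrC -mulrBr normrM (distrC (softabs e _)) -[leRHS]mul1r ler_pM//.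
  by rewrite ger0_norm// gerBl divr_ge0// ltW.
exact: softabs_lipschitz.
Qed.

Lemma integrable_sphere_potential (g : 'rV[R]_n -> R) : measurable_fun [set: 'rV[R]_n] g ->
  mu.-integrable PB (fun w => (g (x + t *: edir w))%:E) ->
  mu.-integrable PB (EFin \o sphere_potential g).
Proof.
move=> mg ig; apply: (le_integrable (@measurable_punctured_ball R n) _ _ ig).
  have me : measurable_fun [set: 'rV[R]_n] (fun w => x + t *: edir w).
    exact: (measurableT_comp (measurable_rV_affine x t) (@measurable_edir R n)).
  apply: measurable_funTS; apply/measurable_EFinP; apply: measurableT_comp => //.
  apply: measurable_funM => //; apply: (measurableT_comp (f := softabs e)); last exact: (measurableT_comp mg me).
  by apply: continuous_measurable_fun; exact: continuous_softabs.
have s0 : softabs e 0 = 0.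
  by rewrite /softabs /softnorm expr0n add0r sqrtr_sqr gtr0_norm// subrr.
move=> w _; rewrite /= lee_fin; have := sphere_potential_lipschitz g (fun=> 0) w.
by rewrite /sphere_potential s0 mulr0 oppr0 !(subr0, addr0).
Qed.

Lemma exterior_identity_smooth phi : smooth phi ->
  mu.-integrable PB (EFin \o sphere_potential phi) /\
  \int[mu]_z ext phi (grad phi) z = n%:R * \int[mu]_(w in PB) sphere_potential phi w.
Proof.
move=> sp.
have lp (f : 'rV[R]_n -> R) : smooth f -> loc_integrable f.
  by move=> sf; apply: continuous_loc_integrable; exact: smooth_continuous.
have ie : mu.-integrable setT (EFin \o ext phi (grad phi)).
  apply: integrable_exterior_density; first exact: lp.
  by move=> i; under eq_fun do rewrite mxE; exact/lp/smooth_partial.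
have [i1 E] := integral_polar n_gt0 x ie.
have V w : PB w -> (\int[leb]_(r in `]0%R, +oo[) (r ^+ n.-1 * ext phi (grad phi) (x + r *: edir w))%:E)%E =
    (sphere_potential phi w)%:E.
  by move=> /punctured_ballE w0; exact: exterior_ray.
have VE : {in PB, (fun w => \int[leb]_(r in `]0%R, +oo[)
    (r ^+ n.-1 * ext phi (grad phi) (x + r *: edir w))%:E)%E =1 EFin \o sphere_potential phi}.
  by move=> w /set_mem /V.
have i2 : mu.-integrable PB (EFin \o sphere_potential phi).
  exact: (eq_integrable (@measurable_punctured_ball R n) _ _ VE i1).
have EI := @eq_integral _ _ _ mu PB _ _ VE.
split => //; rewrite /Rintegral [X in fine X]E EI fineM//.
exact: (integrable_fin_num (@measurable_punctured_ball R n) i2).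
Qed.

End exterior_estimates.

(** * Passage from smooth to Sobolev functions *)

Section exterior_identity_sobolev.
Context {R : realType} {n : nat} (n_gt0 : (0 < n)%N).
Variables (f : 'rV[R]_n -> R) (G : 'rV[R]_n -> 'rV[R]_n).
Hypothesis fG : weak_gradient f G.
Variables (x : 'rV[R]_n) (t T : R) (t_gt0 : 0 < t) (tT : t < T) (e : R) (e_gt0 : 0 < e).
Implicit Types (phi : 'rV[R]_n -> R) (z : 'rV[R]_n).
Local Notation mu := (lebesgue_rV R n).
Local Notation PB := (punctured_ball : set 'rV[R]_n).
Local Notation ext := (exterior_density x t T e).
Local Notation ball := (eball x T).
Local Notation g := (sphere_trace f G x t).
Local Notation tail K z := (Num.max (l1norm (G z) - K) 0).

Let T_gt0 : 0 < T := lt_trans t_gt0 tT.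
Let lf : loc_integrable f. Proof. by have [] := fG. Qed.
Let lG i : loc_integrable (fun z => G z ord0 i). Proof. by have [_ + _] := fG. Qed.
Let mf := loc_integrable_measurable lf.
Let mG i := loc_integrable_measurable (lG i).
Let mball : measurable ball := @measurable_eball R n x T.

Let ml1 : measurable_fun [set: 'rV[R]_n] (fun z => l1norm (G z)).
Proof. by apply: measurable_sum => i; exact: measurableT_comp. Qed.

Let mtail K : measurable_fun [set: 'rV[R]_n] (fun z => tail K z).
Proof. by apply: measurable_maxr => //; exact: measurable_funB. Qed.

(** The product of a sign error with [G] is not controlled by the L^1 distance of the functions, as
    [G] is unbounded. Its part above a level [K] is made small here by dominated convergence; below
    [K] the Lipschitz bound applies. *)
Lemma gradient_tail_small d : 0 < d ->
  exists K : nat, (\int[mu]_(z in ball) (tail K%:R z)%:E <= d%:E)%E.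
Proof.
move=> d0.
have il : mu.-integrable ball (EFin \o (fun z => l1norm (G z))).
  have iG : mu.-integrable ball (fun z => \sum_i `|G z ord0 i|%:E)%E.
    apply: (integrable_sum mball) => i _; apply: (integrable_abse (f := fun z => (G z ord0 i)%:E)).
    exact: (integrableS (@measurable_cube R n _) mball (@eball_sub_cube R n x T)
      (loc_integrable_cube (`|x| + T) (lG i))).
  apply: (eq_integrable mball _ _ _ iG) => z _.
  by rewrite /= /l1norm sumEFin.
have dom (K : nat) z : ball z -> `|tail K%:R z| <= l1norm (G z).
  move=> _; rewrite ger0_norm ?le_max ?lexx ?orbT// ge_max l1norm_ge0 andbT.
  by rewrite gerBl.
have ptw z : ball z -> tail K%:R z @[K --> \oo] --> (cst 0 z : R).
  move=> _; apply: (@cvg_near_cst _ _ (cst 0 z : R)).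
  near=> K; rewrite /cst; apply: max_r; rewrite subr_le0.
  by near: K; exact: nbhs_infty_ger.
have mK (K : nat) : measurable_fun ball (fun z => tail K%:R z) by apply: measurable_funTS.
have m0 : measurable_fun ball (cst 0 : 'rV[R]_n -> R) by exact: measurable_cst.
have [_ /cvgrPdist_le h] := dominated_Rintegral_cvg mball mK m0 ptw il dom.
have [K hK] := @filter_ex _ \oo _ _ (h d d0).
exists K; have iK : mu.-integrable ball (EFin \o (fun z => tail K%:R z)).
  apply: (le_integrable mball _ _ il); first exact/measurable_EFinP.
  by move=> z Bz; rewrite /= lee_fin (le_trans (dom K z Bz))// ler_norm.
have := hK; rewrite /Rintegral integral0 sub0r normrN => h1.
rewrite -(fineK (integrable_fin_num mball iK)) lee_fin; exact: le_trans (ler_norm _) h1.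
Unshelve. all: by end_near. Qed.

Let c0 : R := (t ^+ n.-1)^-1.
(** One [T^-1] comes from recovering the gradient error from the gap, the other from the cutoff term
    [|phi - f| / T], and [2 / e * K] from the Lipschitz bound on [softsgn] against a gradient of
    size at most [K]. The constant [c0] bounds the radial weight on the shell. *)
Let cK (K : R) : R := T^-1 + T^-1 + 2 / e * K.

Lemma exterior_density_gap_le phi (K : R) z : 0 <= K ->
  `|ext phi (grad phi) z - ext f G z| <= c0 * (cK K * sobolev_gap f G T phi z + 2 * tail K z) * \1_ball z.
Proof.
move=> K0; rewrite (le_trans (exterior_density_gap x t_gt0 tT e_gt0 _ _ _ _ _))//.
rewrite mulrA [leRHS]mulrAC.
have gp0 := @sobolev_gap_ge0 R n f G T T_gt0 phi z.
have tl0 : 0 <= tail K z by rewrite le_max lexx orbT.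
have cK0 : 0 <= cK K by rewrite !addr_ge0 ?invr_ge0 ?(ltW T_gt0)// mulr_ge0// divr_ge0// ltW.
apply: ler_pM.
- exact: shell_weight_ge0.
- by rewrite !addr_ge0 ?l1norm_ge0// ?mulr_ge0 ?l1norm_ge0// invr_ge0 ltW.
- exact: shell_weight_le.
set b := `|softsgn e _ - _|; set l := l1norm (G z); set d := `|phi z - f z|.
have b2 : b <= 2.
  by rewrite (le_trans (ler_normB _ _))// (_ : 2 = 1 + 1)// lerD// norm_softsgn.
have bd : b <= 2 / e * d by exact: softsgn_lipschitz.
have lK : l <= K + tail K z by rewrite -lerBlDl le_max lexx.
have d0 : 0 <= d by exact: normr_ge0.
have b0 : 0 <= b by exact: normr_ge0.
have gapE : sobolev_gap f G T phi z = n%:R * d + T * l1norm (grad phi z - G z).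
  by rewrite /sobolev_gap /l1norm; congr (_ + _ * _); apply: eq_bigr => i _; rewrite !mxE.
have S0 := l1norm_ge0 (grad phi z - G z).
set S := l1norm (grad phi z - G z) in gapE S0 *.
set gp := sobolev_gap f G T phi z in gapE gp0 *.
have Sg : S <= T^-1 * gp by rewrite mulrC ler_pdivlMr// mulrC gapE lerDr mulr_ge0.
have dg : d <= gp.
  rewrite gapE (@le_trans _ _ (n%:R * d))//; last by rewrite lerDl mulr_ge0// ltW.
  by rewrite ler_peMl// ler1n.
have dT : d / T <= T^-1 * gp by rewrite mulrC ler_wpM2l// invr_ge0 ltW.
(* [l] is split at level [K]: below it [b <= (2 / e) d] is used, above it [b <= 2]. *)
have bl : b * l <= 2 / e * K * gp + 2 * tail K z.
  rewrite (@le_trans _ _ (b * (K + tail K z)))//; first by rewrite ler_wpM2l.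
  rewrite mulrDr lerD//; last by rewrite ler_wpM2r.
  have e2 : 0 <= 2 / e by rewrite divr_ge0// ltW.
  by rewrite [leRHS]mulrAC ler_wpM2r// (le_trans bd)// ler_wpM2l.
rewrite (_ : cK K * gp + _ = T^-1 * gp + (2 / e * K * gp + 2 * tail K z) + T^-1 * gp); last first.
  by rewrite /cK; ring.
by rewrite !lerD.
Qed.

Lemma integral_exterior_density_gap phi (K : R) : 0 <= K -> smooth phi ->
  (\int[mu]_z `|ext phi (grad phi) z - ext f G z|%:E <=
   (c0 * cK K)%:E * \int[mu]_(z in ball) (sobolev_gap f G T phi z)%:E +
   (c0 * 2)%:E * \int[mu]_(z in ball) (tail K z)%:E)%E.
Proof.
move=> K0 sp.
have mp : measurable_fun [set: 'rV[R]_n] phi.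
  by apply: continuous_measurable_rV; exact: smooth_continuous.
have mdp i : measurable_fun [set: 'rV[R]_n] (fun z => grad phi z ord0 i).
  under eq_fun do rewrite mxE.
  by apply: continuous_measurable_rV; apply: smooth_continuous; exact: smooth_partial.
have mgap := @measurable_sobolev_gap R n f G mf mG T phi sp.
have c00 : 0 <= c0 by rewrite invr_ge0 exprn_ge0// ltW.
have cK0 : 0 <= cK K by rewrite !addr_ge0 ?invr_ge0 ?(ltW T_gt0)// mulr_ge0// divr_ge0// ltW.
have gp0 z := @sobolev_gap_ge0 R n f G T T_gt0 phi z.
have tl0 z : 0 <= tail K z by rewrite le_max lexx orbT.
have m1 : measurable_fun ball (fun z => (sobolev_gap f G T phi z)%:E).
  by apply: measurable_funTS; exact/measurable_EFinP.
have m2 : measurable_fun ball (fun z => (tail K z)%:E).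
  by apply: measurable_funTS; exact/measurable_EFinP.
have a1 : (0 <= (c0 * cK K)%:E)%E by rewrite lee_fin mulr_ge0.
have a2 : (0 <= (c0 * 2)%:E)%E by rewrite lee_fin mulr_ge0.
have p1 z : ball z -> (0 <= (sobolev_gap f G T phi z)%:E)%E by rewrite lee_fin.
have p2 z : ball z -> (0 <= (tail K z)%:E)%E by rewrite lee_fin.
rewrite -(ge0_integralZl mu mball m1 p1 a1) -(ge0_integralZl mu mball m2 p2 a2).
have m3 := emeasurable_funM (measurable_cst (c0 * cK K)%:E) m1.
have m4 := emeasurable_funM (measurable_cst (c0 * 2)%:E) m2.
have p3 z : ball z -> (0 <= (c0 * cK K)%:E * (sobolev_gap f G T phi z)%:E)%E by move=> Bz; rewrite mule_ge0// p1.
have p4 z : ball z -> (0 <= (c0 * 2)%:E * (tail K z)%:E)%E by move=> Bz; rewrite mule_ge0// p2.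
rewrite -(ge0_integralD mu mball p3 m3 p4 m4) integral_mkcond_indic.
apply: ge0_le_integral => //.
- apply/measurable_EFinP; apply: measurableT_comp => //.
  by apply: measurable_funB; exact: measurable_exterior_density.
- apply: emeasurable_funM.
    apply: emeasurable_funD; apply: emeasurable_funM => //; exact/measurable_EFinP.
  by apply/measurable_EFinP; exact: (@measurable_indic _ _ R setT _ mball).
- move=> z _; rewrite -!EFinM lee_fin.
  rewrite (le_trans (exterior_density_gap_le phi z K0))//.
  by rewrite mulrDr !mulrA.
Qed.

(** The identity holds for smooth functions; on the left the error is a volume integral of the gap
    plus a gradient tail, on the right the trace inequality gives a volume integral of the gap
    again. The two sides thus differ by less than any [d > 0]. *)
Lemma exterior_identity :
  \int[mu]_z ext f G z = n%:R * \int[mu]_(w in PB) sphere_potential x t T e g w.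
Proof.
have mPB := @measurable_punctured_ball R n.
have mg := @measurable_sphere_trace R n f G mf mG x t.
have ig := integrable_sphere_potential t_gt0 tT e_gt0 mg (integrable_sphere_trace n_gt0 fG x t_gt0).
have ie := integrable_exterior_density x t_gt0 tT e_gt0 lf lG.
have c00 : 0 < c0 by rewrite invr_gt0 exprn_gt0.
set A := LHS; set B := RHS.
suff AB d : 0 < d -> `|A - B| <= d.
  apply/eqP; rewrite -subr_eq0 -normr_le0; apply/ler_addgt0Pr => d d0.
  by rewrite add0r; exact: AB.
move=> d0.
(* The level [K] is fixed first, spending [d / 2] on the tail; the coefficient of the gap depends on
   [K], so the smooth approximation is chosen afterwards. *)
have d1 : 0 < d / 2 / (c0 * 2) by rewrite !divr_gt0// mulr_gt0.
have [K tK] := gradient_tail_small d1.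
have K0 : 0 <= K%:R :> R by [].
(* Total coefficient of the gap: [c0 * cK K] from the volume side and [t ^- n] from the sphere
   side. *)
pose a := c0 * cK K%:R + t ^- n.
have cK0 : 0 < cK K%:R.
  by rewrite ltr_pwDl ?addr_gt0 ?invr_gt0// mulr_ge0// divr_ge0// ltW.
have a0 : 0 < a by rewrite addr_gt0 ?mulr_gt0// invr_gt0 exprn_gt0.
have d2 : 0 < d / 2 / a by rewrite !divr_gt0.
have [phi [sp q0 q1]] := smooth_approximation_eball fG x T.
have q := sobolev_gap_cvg0 fG T_gt0 sp q0 q1.
have gap0 k : (0 <= \int[mu]_(z in ball) (sobolev_gap f G T (phi k) z)%:E)%E.
  by apply: integral_ge0 => z _; rewrite lee_fin sobolev_gap_ge0.
have [k gk] := @filter_ex _ \oo _ _ ((ge0_cvge0P gap0).1 q _ d2).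
have [ip Ep] := exterior_identity_smooth n_gt0 x t_gt0 tT e_gt0 (sp k).
have lp (h : 'rV[R]_n -> R) : smooth h -> loc_integrable h.
  by move=> sh; apply: continuous_loc_integrable; exact: smooth_continuous.
have iep : mu.-integrable setT (EFin \o ext (phi k) (grad (phi k))).
  apply: (integrable_exterior_density x t_gt0 tT e_gt0); first exact: lp.
  by move=> i; under eq_fun do rewrite mxE; exact/lp/smooth_partial.
have B1 := abs_RintegralB_le measurableT iep ie.
have B2 := abs_RintegralB_le mPB ip ig.
have B1' := le_trans B1 (integral_exterior_density_gap K0 (sp k)).
set P := \int[mu]_z ext (phi k) (grad (phi k)) z in B1 B1' Ep.
rewrite -lee_fin.
have step : (`|A - B|%:E <= `|P - A|%:E + n%:R%:E *
    `|\int[mu]_(w in PB) sphere_potential x t T e (phi k) w - \int[mu]_(w in PB) sphere_potential x t T e g w|%:E)%E.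
  rewrite -EFinM -EFinD lee_fin -[X in X * `|_|]ger0_norm// -normrM mulrBr -Ep -/B.
  by rewrite (distrC P A) (le_trans _ (ler_normD _ _))// addrA subrK.
apply: (le_trans step).
have B2' : (n%:R%:E * `|\int[mu]_(w in PB) sphere_potential x t T e (phi k) w - \int[mu]_(w in PB) sphere_potential x t T e g w|%:E <=
    (t ^- n)%:E * \int[mu]_(z in ball) (sobolev_gap f G T (phi k) z)%:E)%E.
  apply: le_trans (le_trans (sphere_trace_gap n_gt0 mf mG x t_gt0 (sp k)) _).
    apply: lee_wpmul2l; first by rewrite lee_fin.
    apply: (le_trans B2); apply: ge0_le_integral => //.
    - by have /integrableP[+ _] := integrable_abse (integrableB mPB ip ig).
    - have me : measurable_fun [set: 'rV[R]_n] (fun w => x + t *: edir w).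
        exact: (measurableT_comp (measurable_rV_affine x t) (@measurable_edir R n)).
      apply: measurable_funTS; apply/measurable_EFinP; apply: measurableT_comp => //.
      apply: measurable_funB; last exact: (measurableT_comp mg me).
      apply: (measurableT_comp _ me); apply: continuous_measurable_rV; exact: smooth_continuous.
    - by move=> w _; rewrite lee_fin; exact: (sphere_potential_lipschitz x t_gt0 tT e_gt0).
  apply: lee_wpmul2l; first by rewrite lee_fin invr_ge0 exprn_ge0// ltW.
  apply: (@le_trans _ _ (\int[mu]_(z in eball x t) (sobolev_gap f G T (phi k) z)%:E)%E).
    apply: ge0_le_integral => //.
    - exact: measurable_eball.
    - by move=> z _; rewrite lee_fin sobolev_gap_ge0.
    - by apply: measurable_funTS; apply/measurable_EFinP; exact: measurable_sobolev_gap.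
    - by apply: measurable_funTS; apply/measurable_EFinP; exact: measurable_sobolev_gap.
    - move=> z _; rewrite lee_fin /sobolev_gap lerD2l ler_wpM2r ?sumr_ge0//.
      exact: ltW.
  apply: ge0_subset_integral => //.
  - exact: measurable_eball.
  - by apply: measurable_funTS; apply/measurable_EFinP; exact: measurable_sobolev_gap.
  - by move=> z _; rewrite lee_fin sobolev_gap_ge0.
  - by move=> z zt; exact: lt_trans zt tT.
apply: (le_trans (leeD B1' B2')).
apply: (@le_trans _ _ (((c0 * cK K%:R)%:E * (d / 2 / a)%:E + (c0 * 2)%:E * (d / 2 / (c0 * 2))%:E) +
    (t ^- n)%:E * (d / 2 / a)%:E)%E).
  apply: leeD; first apply: leeD.
  - by apply: lee_wpmul2l => //; rewrite lee_fin mulr_ge0// ltW.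
  - by apply: lee_wpmul2l => //; rewrite lee_fin mulr_ge0// ltW.
  - by apply: lee_wpmul2l => //; rewrite lee_fin invr_ge0 exprn_ge0// ltW.
rewrite -!EFinM -!EFinD lee_fin addrAC -mulrDl -/a.
rewrite (mulrC a) divfK ?gt_eqF// (mulrC (c0 * 2)) divfK ?gt_eqF ?mulr_gt0//.
by rewrite -splitr.
Qed.

End exterior_identity_sobolev.

Lemma LfunE d (X : measurableType d) (R : realType) (m : {measure set X -> \bar R}) (p : \bar R)
    (h : X -> R) :
  h \in Lfun m p <-> measurable_fun [set: X] h /\ ('N[m]_p[EFin \o h] < +oo)%E.
Proof.
split => [hL|[mh fh]].
  split; first by have := sub_Lfun_mfun hL; rewrite inE.
  by have := sub_Lfun_finLfun hL; rewrite inE.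
by rewrite inE; apply/andP; split; rewrite inE.
Qed.

Lemma measurable_sgr (R : realType) : measurable_fun [set: R] (@Num.sg R).
Proof.
rewrite (_ : Num.sg = fun s : R => \1_`]0%R, +oo[ s - \1_`]-oo, 0%R[ s); last first.
  apply/funext => s; rewrite !indicE !mem_setE !in_itv/= andbT.
  by case: sgrP => //= _; rewrite ?subr0 ?sub0r.
by apply: measurable_funB; apply: measurable_indic; exact: measurable_itv.
Qed.

Lemma cvg_le_dist (R : realType) (u v : nat -> R) (l : R) :
  (forall j, `|l - u j| <= v j) -> v @ \oo --> (0 : R) -> u @ \oo --> l.
Proof.
move=> uv v0; apply/cvgrPdist_le => d d0; near=> j.
rewrite (le_trans (uv j))// (le_trans (ler_norm _))// -normrN -sub0r.
by near: j; exact: ((@cvgrPdist_le R R nat \oo _ v 0).1 v0).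
Unshelve. all: by end_near. Qed.

(** * Removal of the regularisation and of the cutoff *)

Section absolute_exterior_identity.
Context {R : realType} {n : nat} (n_gt0 : (0 < n)%N).
Variables (p : R) (p_gt1 : 1 < p) (p_ltn : p < n%:R).
Variables (f : 'rV[R]_n -> R) (G : 'rV[R]_n -> 'rV[R]_n).
Hypothesis fpG : sobolev p f G.
Variables (x : 'rV[R]_n) (t : R) (t_gt0 : 0 < t).
Implicit Types (h : 'rV[R]_n -> R) (z w : 'rV[R]_n).
Local Notation mu := (lebesgue_rV R n).
Local Notation PB := (punctured_ball : set 'rV[R]_n).
Local Notation g := (sphere_trace f G x t).
Local Notation S := [set z | t <= enorm (x - z)].

Let fG : weak_gradient f G. Proof. by have [] := fpG. Qed.
Let lf : loc_integrable f. Proof. by have [] := fG. Qed.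
Let lG i : loc_integrable (fun z => G z ord0 i). Proof. by have [_ + _] := fG. Qed.
Let mf := loc_integrable_measurable lf.
Let mG i := loc_integrable_measurable (lG i).

Let enormBC z : enorm (x - z) = enorm (z - x).
Proof. by rewrite -enormN opprB. Qed.

Let mS : measurable S.
Proof.
rewrite (_ : S = setT `&` (fun z => enorm (z - x)) @^-1` `[t, +oo[).
  by apply: (measurable_enormB x) => //; exact: measurable_itv.
by rewrite setTI; apply/seteqP; split => z /=; rewrite in_itv/= andbT enormBC.
Qed.

(** The size of the kernel on the exterior domain: the factor paired with [f] and with its gradient
    in Hoelder's inequality. *)
Definition radial_weight z : R := \1_S z * (enorm (z - x) ^+ n.-1)^-1.

Lemma radial_weight_ge0 z : 0 <= radial_weight z.
Proof. by rewrite mulr_ge0// invr_ge0 exprn_ge0// enorm_ge0. Qed.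

Lemma measurable_radial_weight : measurable_fun [set: 'rV[R]_n] radial_weight.
Proof.
apply: measurable_funM; first exact: (@measurable_indic _ _ R setT _ mS).
exact: measurable_enormBXV.
Qed.

Let q := p / (p - 1).

(* The exponent [(n - 1) q] exceeds [n] exactly because [p < n]. *)
Lemma radial_weight_Lnorm : ('N[mu]_q%:E[EFin \o radial_weight] < +oo)%E.
Proof.
rewrite unlock; apply: poweR_lty.
have p10 : 0 < p - 1 by rewrite subr_gt0.
have q0 : 0 < q by rewrite divr_gt0// (lt_trans _ p_gt1).
have nq : n%:R < n.-1%:R * q.
  by rewrite /q mulrA ltr_pdivlMr// -subn1 natrB// mulrBr mulr1 mulrBl mul1r ltrD2l ltrN2.
apply: le_lt_trans (integral_radial_powR_lty n_gt0 x t_gt0 nq).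
rewrite [leRHS]integral_mkcond_indic le_eqVlt; apply/orP; left; apply/eqP.
apply: eq_integral => z _; rewrite /= -poweR_EFin /radial_weight !indicE.
rewrite ger0_norm; last exact: radial_weight_ge0.
case: (boolP (z \in S)) => [/set_mem zS|_]; last first.
  by rewrite mul0r mule0 poweR_EFin powR0// gt_eqF.
rewrite mul1r mule1 poweR_EFin; congr EFin.
by rewrite enormBC -powR_mulrn ?enorm_ge0// -powRN -powRrM mulNr.
Qed.

Lemma integrable_mul_radial_weight h : measurable_fun [set: 'rV[R]_n] h ->
  ('N[mu]_p%:E[EFin \o h] < +oo)%E ->
  mu.-integrable setT (EFin \o (fun z => radial_weight z * `|h z|)).
Proof.
move=> mh Nh.
have p10 : 0 < p - 1 by rewrite subr_gt0.
have p0 : 0 < p by exact: lt_trans p_gt1.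
have q0 : 0 < q by rewrite divr_gt0.
have pq : p^-1 + q^-1 = 1.
  by rewrite /q invf_div -[X in X + _]mul1r -mulrDl addrC subrK divff// gt_eqF.
have mw := measurable_radial_weight.
have mwh : measurable_fun [set: 'rV[R]_n] (fun z => radial_weight z * `|h z|).
  by apply: measurable_funM => //; exact: measurableT_comp.
apply/integrableP; split; first exact/measurable_EFinP.
have := hoelder mu mh mw p0 q0 pq; rewrite Lnorm1 => hh.
apply: (@le_lt_trans _ _ (\int[mu]_z `|(EFin \o (h \* radial_weight)%R) z|)%E).
  rewrite le_eqVlt; apply/orP; left; apply/eqP; apply: eq_integral => z _.
  by rewrite /= !normrM normr_id mulrC.
apply: le_lt_trans hh _; apply: lte_mul_pinfty => //.
- exact: Lnorm_ge0.
- by rewrite ge0_fin_numE// Lnorm_ge0.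
- exact: radial_weight_Lnorm.
Qed.

(** The factor [n] converts the sum of absolute coordinates into the Euclidean norm; [|f| / TT j] is
    bounded by [|f|] because [TT j >= 1]. *)
Let dominator z := n%:R * (radial_weight z * `|enorm (G z)|) + radial_weight z * `|f z|.

Let integrable_dominator : mu.-integrable setT (EFin \o dominator).
Proof.
have [/LfunE[_ Nf] [mGv NG] _] := fpG.
have mGe : measurable_fun [set: 'rV[R]_n] (@enorm R n \o G).
  exact: (measurableT_comp (@measurable_enorm R n) mGv).
have iG := integrable_mul_radial_weight mGe NG.
have := integrableD measurableT (integrableZl measurableT n%:R iG) (integrable_mul_radial_weight mf Nf).
by apply: eq_integrable => // z _.
Qed.

(** The limits [e -> 0] and [T -> oo] are taken together along one sequence, so that a single
    dominated convergence suffices on each side; [TT] starts beyond [t], as the shell requires. *)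
Let eps (j : nat) : R := j.+1%:R^-1.
Let TT (j : nat) : R := t + j.+1%:R.

Let eps_gt0 j : 0 < eps j. Proof. by rewrite invr_gt0. Qed.
Let TT_gt j : t < TT j. Proof. by rewrite ltrDl. Qed.
Let TT_ge1 j : 1 <= TT j.
Proof. by rewrite (@le_trans _ _ j.+1%:R) ?ler1n// lerDr ltW. Qed.
Let TT_gt0 j : 0 < TT j. Proof. exact: lt_trans (TT_gt j). Qed.

Let cvg_eps : eps j @[j --> \oo] --> (0 : R). Proof. exact: cvg_harmonic. Qed.

Let cvg_TTV : (TT j)^-1 @[j --> \oo] --> (0 : R).
Proof.
apply: (squeeze_cvgr _ (cvg_cst 0) cvg_eps); apply: nearW => j.
rewrite invr_ge0 (ltW (TT_gt0 j))/= lef_pV2 ?posrE// lerDr ltW//.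
Qed.

Let cvg_softabs s : softabs (eps j) s @[j --> \oo] --> `|s|.
Proof. by apply: (cvg_le_dist _ cvg_eps) => j; exact: softabs_near. Qed.

Let cvg_softsgn s : softsgn (eps j) s @[j --> \oo] --> Num.sg s.
Proof.
apply: (@cvg_le_dist _ _ (fun j => eps j / `|s|)) => [j|]; first exact: softsgn_near.
by rewrite -[X in _ --> X](mul0r `|s|^-1); apply: cvgMl; exact: cvg_eps.
Qed.

Let E j := exterior_density x t (TT j) (eps j) f G.
Let E_lim z : R := radial_weight z * (Num.sg (f z) * dot (G z) (edir (z - x))).

Let cvg_E z : E j z @[j --> \oo] --> E_lim z.
Proof.
have [zS|zS] := boolP (z \in S); last first.
  rewrite /E_lim /radial_weight indicE (negbTE zS) !mul0r.
  apply: cvg_near_cst; apply: nearW => j.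
  rewrite /E /exterior_density indicE memNset ?mul0r// => -/andP[tz _].
  by move/negP: zS; apply; apply: mem_set; rewrite /= enormBC.
have tz : t <= enorm (z - x) by move/set_mem: zS; rewrite /= enormBC.
rewrite /E_lim /radial_weight indicE zS mul1r.
have c1 : 1 - enorm (z - x) / TT j @[j --> \oo] --> (1 : R).
  rewrite -[X in _ --> X]subr0 -[X in _ --> _ - X](mulr0 (enorm (z - x))).
  by apply: cvgB; [exact: cvg_cst|apply: cvgMr; exact: cvg_TTV].
have c2 : softabs (eps j) (f z) / TT j @[j --> \oo] --> (0 : R).
  by rewrite -[X in _ --> X](mulr0 `|f z|); apply: cvgM; [exact: cvg_softabs|exact: cvg_TTV].
have c3 : softsgn (eps j) (f z) * dot (G z) (edir (z - x)) @[j --> \oo] -->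
    Num.sg (f z) * dot (G z) (edir (z - x)).
  by apply: cvgMl; exact: cvg_softsgn.
have c4 : (enorm (z - x) ^+ n.-1)^-1 * ((1 - enorm (z - x) / TT j) *
    (softsgn (eps j) (f z) * dot (G z) (edir (z - x))) - softabs (eps j) (f z) / TT j)
    @[j --> \oo] --> (enorm (z - x) ^+ n.-1)^-1 * (Num.sg (f z) * dot (G z) (edir (z - x))).
  apply: cvgMr; rewrite -[X in _ --> X]subr0 -[X in _ --> X - _]mul1r.
  exact: (cvgB (cvgM c1 c3) c2).
apply: cvg_trans c4; apply: near_eq_cvg; near=> j.
(* Once [j] exceeds the distance from [z] to [x], the point lies in the shell. *)
rewrite /E /exterior_density indicE mem_set ?mul1r//.
rewrite /shell/= tz (@lt_le_trans _ _ j.+1%:R)//; last by rewrite lerDr ltW.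
rewrite (@lt_le_trans _ _ j%:R) ?ler_nat//.
by near: j; exact: nbhs_infty_gtr.
Unshelve. all: by end_near. Qed.

Let E_dominated j z : `|E j z| <= dominator z.
Proof.
rewrite (le_trans (exterior_density_le x t_gt0 (TT_gt j) (eps_gt0 j) f G z))// mulrA.
have w0 := radial_weight_ge0 z.
have sw : \1_(shell x t (TT j)) z * (enorm (z - x) ^+ n.-1)^-1 <= radial_weight z.
  rewrite /radial_weight ler_wpM2r ?invr_ge0 ?exprn_ge0 ?enorm_ge0// !indicE.
  case: (boolP (z \in shell _ _ _)) => // /set_mem /andP[tz _].
  by rewrite mem_set//= enormBC.
apply: (@le_trans _ _ (radial_weight z * (l1norm (G z) + `|f z| / TT j))).
  by rewrite ler_wpM2r// addr_ge0 ?l1norm_ge0// divr_ge0// ltW.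
rewrite /dominator mulrDr lerD//.
  by rewrite mulrCA ler_wpM2l// (ger0_norm (enorm_ge0 _)) sum_le_enorm.
by rewrite ler_wpM2l// ler_pdivrMr// ler_peMr.
Qed.

Let mg : measurable_fun [set: 'rV[R]_n] g := @measurable_sphere_trace R n f G mf mG x t.
Let ig := integrable_sphere_trace n_gt0 fG x t_gt0.

(** Both sides of the regularised identity converge, the left dominated by [dominator] and the right
    by [|g|] on the sphere, and the limits coincide. The minus sign is that of the endpoint [t] in
    the fundamental theorem of calculus. *)
Lemma integral_sphere_trace : \int[mu]_z (- E_lim z) = n%:R * \int[mu]_(w in PB) `|g (x + t *: edir w)|.
Proof.
have mPB := @measurable_punctured_ball R n.
have mE j : measurable_fun [set: 'rV[R]_n] (E j) by exact: measurable_exterior_density.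
have mEl : measurable_fun [set: 'rV[R]_n] E_lim.
  have mGv : measurable_fun [set: 'rV[R]_n] G by exact: (@measurable_fun_rVP R _ _ n).
  apply: measurable_funM; first exact: measurable_radial_weight.
  apply: measurable_funM; first exact: (measurableT_comp (@measurable_sgr R) mf).
  apply: measurable_dot => //; apply: (measurableT_comp (@measurable_edir R n)).
  exact: measurable_rVB.
have cE0 z : [set: 'rV[R]_n] z -> E j z @[j --> \oo] --> E_lim z by move=> _; exact: cvg_E.
have [iE cE] := dominated_Rintegral_cvg measurableT mE mEl cE0
  integrable_dominator (fun j z _ => E_dominated j z).
pose P j w := sphere_potential x t (TT j) (eps j) g w.
have iP j : mu.-integrable PB (EFin \o P j).
  exact: (integrable_sphere_potential t_gt0 (TT_gt j) (eps_gt0 j) mg ig).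
have mP j : measurable_fun PB (P j) by have /integrableP[/measurable_EFinP] := iP j.
have iag : mu.-integrable PB (EFin \o (fun w => `|g (x + t *: edir w)|)).
  exact: (integrable_abse ig).
have mag : measurable_fun PB (fun w => - `|g (x + t *: edir w)|).
  by apply: measurableT_comp => //; have /integrableP[/measurable_EFinP] := iag.
have cP w : PB w -> P j w @[j --> \oo] --> - `|g (x + t *: edir w)|.
  move=> _; apply: cvgN; rewrite -[X in _ --> X]mul1r.
  apply: cvgM; last exact: cvg_softabs.
  rewrite -[X in _ --> X]subr0 -[X in _ --> _ - X](mulr0 t).
  by apply: cvgB; [exact: cvg_cst|apply: cvgMr; exact: cvg_TTV].
have dP j w : PB w -> `|P j w| <= `|g (x + t *: edir w)|.
  move=> _; rewrite /P /sphere_potential normrN normrM -[leRHS]mul1r ler_pM//.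
    rewrite ger0_norm ?subr_ge0 ?ler_pdivrMr// ?mul1r ?(ltW (TT_gt j))//.
    by rewrite gerBl divr_ge0// ltW.
  by rewrite ger0_norm ?softabs_le// softabs_ge0.
have [iN cN] := dominated_Rintegral_cvg mPB mP mag cP iag dP.
have EP j : \int[mu]_z E j z = n%:R * \int[mu]_(w in PB) P j w.
  exact: (exterior_identity n_gt0 fG x t_gt0 (TT_gt j) (eps_gt0 j)).
have cE' : \int[mu]_z E j z @[j --> \oo] --> n%:R * \int[mu]_(w in PB) - `|g (x + t *: edir w)|.
  by under eq_fun do rewrite EP; apply: cvgMr; exact: cN.
have EL := cvg_unique (@norm_hausdorff R R) cE cE'.
have opp (D : set 'rV[R]_n) (a : 'rV[R]_n -> R) : measurable D -> mu.-integrable D (EFin \o a) ->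
    \int[mu]_(z in D) (- a z) = - \int[mu]_(z in D) a z.
  by move=> mD ia; under eq_Rintegral do rewrite -mulN1r; rewrite RintegralZl// mulN1r.
rewrite (opp _ _ measurableT iE) EL.
by rewrite (opp PB (fun w => `|g (x + t *: edir w)|) mPB iag) mulrN opprK.
Qed.

(** The kernel is odd and evaluated at [x - z], whereas the densities use [z - x]; this supplies the
    sign of [- E_lim]. *)
Lemma truncated_integral_sphere_trace : truncated_integral id (fun z => Num.sg (f z) *: G z) x t =
  n%:R * \int[mu]_(w in PB) `|g (x + t *: edir w)|.
Proof.
rewrite -integral_sphere_trace /truncated_integral /Rintegral integral_mkcond_indic.
congr fine; apply: eq_integral => z _; rewrite -EFinM; congr EFin.
have -> : kernel_of id (x - z) = (- (enorm (z - x) ^+ n.-1)^-1) *: edir (z - x).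
  by rewrite /kernel_of /= enormBC /edir enormBC -(opprB z x) scalerN scalerN scaleNr.
by rewrite dotZl dotZr /E_lim /radial_weight; ring.
Qed.

End absolute_exterior_identity.

(** * Comparison of the maximal functions *)

Section scaling.
Context {R : realType} {n : nat}.
Local Notation mu := (lebesgue_rV R n).
Implicit Types (h : 'rV[R]_n -> R) (G : 'rV[R]_n -> 'rV[R]_n) (c p : R).

Lemma Lnorm_scale h c p : 0 < p -> 0 <= c -> measurable_fun [set: 'rV[R]_n] h ->
  ('N[mu]_p%:E[EFin \o (fun z => (c * h z)%R)] = c%:E * 'N[mu]_p%:E[EFin \o h])%E.
Proof.
move=> p0 c0 mh; rewrite unlock.
have m1 : measurable_fun [set: 'rV[R]_n] (fun z => `|(EFin \o h) z| `^ p)%E.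
  under eq_fun do rewrite /= ?poweR_EFin.
  by apply/measurable_EFinP; apply: (measurableT_comp (@measurable_powR R p)); exact: measurableT_comp.
have cp : (0 <= (c `^ p)%:E)%E by rewrite lee_fin powR_ge0.
have E : (\int[mu]_z (`|(EFin \o (fun z => c * h z)%R) z| `^ p) =
    (c `^ p)%:E * \int[mu]_z (`|(EFin \o h) z| `^ p))%E.
  rewrite -(ge0_integralZl mu measurableT m1 (fun _ _ => poweR_ge0 _ _) cp).
  apply: eq_integral => z _.
  by rewrite /= ?poweR_EFin normrM (ger0_norm c0) powRM// EFinM.
have cE : ((c `^ p)%:E `^ p^-1 = c%:E)%E.
  by rewrite poweR_EFin -powRrM divff ?gt_eqF// powRr1.
by rewrite E poweRM ?cE//; apply: integral_ge0 => z _; exact: poweR_ge0.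
Qed.

Lemma Lnorm_vec_scale G c p : 0 < p -> 0 <= c -> measurable_fun [set: 'rV[R]_n] G ->
  (Lnorm_vec p (fun z => c *: G z) = c%:E * Lnorm_vec p G)%E.
Proof.
move=> p0 c0 mG; rewrite /Lnorm_vec.
have -> : EFin \o (@enorm R n \o (fun z => c *: G z)) = EFin \o (fun z => c * (@enorm R n \o G) z).
  by apply/funext => z; rewrite /= enormZ ger0_norm.
exact: (Lnorm_scale p0 c0 (measurableT_comp (@measurable_enorm R n) mG)).
Qed.

Lemma le_Lnorm_vec F G p : 0 < p -> measurable_fun [set: 'rV[R]_n] F ->
  measurable_fun [set: 'rV[R]_n] G -> (forall z, enorm (F z) <= enorm (G z)) ->
  (Lnorm_vec p (F : 'rV[R]_n -> 'rV[R]_n) <= Lnorm_vec p (G : 'rV[R]_n -> 'rV[R]_n))%E.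
Proof.
move=> p0 mF mG FG; rewrite /Lnorm_vec unlock.
have mN (H : 'rV[R]_n -> 'rV[R]_n) : measurable_fun [set: 'rV[R]_n] H ->
    measurable_fun [set: 'rV[R]_n] (fun z => `|(EFin \o (@enorm R n \o H)) z| `^ p)%E.
  move=> mH; under eq_fun do rewrite /= ?poweR_EFin.
  apply/measurable_EFinP; apply: (measurableT_comp (@measurable_powR R p)).
  by apply: measurableT_comp => //; exact: (measurableT_comp (@measurable_enorm R n) mH).
have I0 (H : 'rV[R]_n -> 'rV[R]_n) : (0 <= \int[mu]_z (`|(EFin \o (@enorm R n \o H)) z| `^ p))%E.
  by apply: integral_ge0 => z _; exact: poweR_ge0.
have Ioy H : (\int[mu]_z (`|(EFin \o (@enorm R n \o H)) z| `^ p))%E \in `[0%E, +oo%E].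
  by rewrite in_itv/= I0 leey.
have r0 : 0 <= p^-1 by rewrite invr_ge0 ltW.
refine (gt0_ler_poweR r0 (Ioy F) (Ioy G) _).
apply: ge0_le_integral => //.
- by move=> z _; exact: poweR_ge0.
- exact: mN.
- exact: mN.
- move=> z _; rewrite /= ?poweR_EFin lee_fin; apply: ge0_ler_powR; rewrite ?nnegrE ?(ltW p0)//.
  by rewrite !ger0_norm ?enorm_ge0.
Qed.

Lemma loc_integrable_scale h c : loc_integrable h -> loc_integrable (fun z => c * h z).
Proof.
by move=> lh K cK; exact: (integrableZl (compact_measurable_rV cK) c (lh K cK)).
Qed.

Lemma integrable_mul_test_function h phi : loc_integrable h -> test_function phi ->
  mu.-integrable setT (EFin \o (fun z => h z * phi z)).
Proof.
move=> lh tphi; have [C hC] := test_function_bounded tphi.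
have [_ [M hM]] := (test_functionP _).1 tphi.
exact: (integrable_mul_supported lh (test_function_measurable tphi) hC hM).
Qed.

Lemma weak_gradient_scale h G c : weak_gradient h G ->
  weak_gradient (fun z => c * h z) (fun z => c *: G z).
Proof.
move=> [lh lG hG]; split; first exact: loc_integrable_scale.
  by move=> i; under eq_fun do rewrite mxE; exact: loc_integrable_scale.
move=> phi tphi i.
under eq_Rintegral do rewrite -mulrA.
rewrite RintegralZl//; last exact/integrable_mul_test_function/test_function_partial.
under [in RHS]eq_Rintegral do rewrite mxE -mulrA.
rewrite RintegralZl//; last exact: (integrable_mul_test_function (lG i) tphi).
by rewrite hG// mulrN.
Qed.

End scaling.

(** The identity is its own extension to the whole space: its coordinates have constant partial
    derivatives. *)
Lemma C1_on_sphere_id (R : realType) (n : nat) : C1_on_sphere (@id 'rV[R]_n).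
Proof.
move=> theta _; exists setT, id; split => //; first exact: openT.
move=> j i.
have dc (z : 'rV[R]_n) : is_derive z (delta_mx ord0 i) (fun z : 'rV[R]_n => z ord0 j)
    ((delta_mx ord0 i : 'rV[R]_n) ord0 j).
  rewrite -[z]addr0 -[X in z + X](scale0r (delta_mx ord0 i : 'rV[R]_n)).
  apply: ((is_derive_lineP (fun z : 'rV[R]_n => z ord0 j) z (delta_mx ord0 i) _ 0).2).
  rewrite (_ : (fun s : R => _) = fun s => (delta_mx ord0 i : 'rV[R]_n) ord0 j * s + z ord0 j).
    exact: is_derive_affine.
  by apply/funext => s; rewrite mxE [X in _ + X]mxE addrC mulrC.
split; first by move=> z _; have [] := dc z.
have -> : partial i (fun z : 'rV[R]_n => z ord0 j) = cst ((delta_mx ord0 i : 'rV[R]_n) ord0 j).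
  by apply/funext => z; have [_ <-] := dc z.
by move=> z _; exact: cst_continuous.
Qed.

(** * The spherical maximal function as a singular one *)

Section spherical_maximal_function.
Context {R : realType} {n : nat} (n_gt0 : (0 < n)%N).
Variables (p : R) (p_gt1 : 1 < p) (p_ltn : p < n%:R).
Variables (f : 'rV[R]_n -> R) (G : 'rV[R]_n -> 'rV[R]_n).
Hypothesis fpG : sobolev p f G.
Local Notation mu := (lebesgue_rV R n).
Local Notation c := ((n%:R * ball_volume R n)^-1).
Local Notation F := (fun z => Num.sg (f z) *: G z).

Let fG : weak_gradient f G. Proof. by have [] := fpG. Qed.

Lemma inv_ball_volume_ge0 : 0 <= c.
Proof. by rewrite invr_ge0 mulr_ge0// fine_ge0. Qed.

(** The factor [t^(n-1)] of the sphere measure cancels the normalisation of the mean. The truncated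
    integral is nonnegative, being a multiple of an integral of [|g|], so its absolute value changes
    nothing. *)
Lemma spherical_mean_singular x t : 0 < t ->
  spherical_mean f x t = (c%:E * `|truncated_integral id F x t|%:E)%E.
Proof.
move=> t0; rewrite /spherical_mean (integral_trace n_gt0 fG x t0).
rewrite (truncated_integral_sphere_trace n_gt0 p_gt1 p_ltn fpG x t0).
set g := sphere_trace f G x t.
have ig := integrable_abse (integrable_sphere_trace n_gt0 fG x t0).
rewrite -(fineK (integrable_fin_num (@measurable_punctured_ball R n) ig)).
rewrite -/(Rintegral _ _ (fun w => `|g (x + t *: edir w)|)).
set I := Rintegral _ _ _.
have I0 : 0 <= I by apply: Rintegral_ge0.
rewrite -!EFinM; congr EFin; rewrite (ger0_norm (mulr_ge0 _ I0))//.
by rewrite invfM -mulrA mulKf// expf_neq0// gt_eqF.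
Qed.

Lemma spherical_maximal_singular x :
  spherical_maximal f x = (c%:E * maximal_singular id F x)%E.
Proof.
rewrite /spherical_maximal /maximal_singular -ereal_supZl ?inv_ball_volume_ge0//; last first.
  (* Scaling a supremum by a possibly zero factor requires a nonempty set; the radius 1 provides an
     element. *)
  by apply/set0P; exists `|truncated_integral id F x 1|%:E; exists 1 => //=.
congr ereal_sup; apply/seteqP; split => [_ [t /= t0 <-]|_ [_ [t /= t0 <-] <-]].
  by exists `|truncated_integral id F x t|%:E; [exists t|rewrite spherical_mean_singular].
by exists t => //; rewrite spherical_mean_singular.
Qed.

Lemma measurable_signed_gradient : measurable_fun [set: 'rV[R]_n] F.
Proof.
have [lf _ _] := fG; have [_ [mG _] _] := fpG.
apply: measurable_rVZ => //.
exact: (measurableT_comp (@measurable_sgr R) (loc_integrable_measurable lf)).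
Qed.

(** Pointwise, since [|Num.sg (f z)|] is 0 or 1. *)
Lemma Lnorm_signed_gradient : (Lnorm_vec p F <= Lnorm_vec p G)%E.
Proof.
have [_ [mG _] _] := fpG.
apply: le_Lnorm_vec => //; first exact: lt_trans p_gt1.
  exact: measurable_signed_gradient.
move=> z; rewrite enormZ normr_sg; case: (f z != 0); first by rewrite mul1r.
by rewrite mul0r enorm_ge0.
Qed.

End spherical_maximal_function.

Theorem proposition1p2 (R : realType) (n : nat) (n_ge2 : (2 <= n)%N) :
  (forall p : R, 1 < p -> p <= n%:R / (n%:R - 1) -> p < n%:R ->
   forall m : nat, (1 <= m)%N ->
   forall Omega : 'rV[R]_n -> 'rV[R]_m, C1_on_sphere Omega ->
   exists C : R, 0 < C /\
     forall f : 'rV[R]_n -> 'rV[R]_m, Lp_vec p f ->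
     exists (h : 'rV[R]_n -> R) (G : 'rV[R]_n -> 'rV[R]_n),
       hom_sobolev p (maximal_singular Omega f) h G /\
       (hom_sobolev_norm p h G <= C%:E * Lnorm_vec p f)%E) ->
  forall p : R, 1 < p -> p <= n%:R / (n%:R - 1) -> p < n%:R ->
  exists C' : R, 0 < C' /\
    forall (f : 'rV[R]_n -> R) (Df : 'rV[R]_n -> 'rV[R]_n), sobolev p f Df ->
    exists (h : 'rV[R]_n -> R) (G : 'rV[R]_n -> 'rV[R]_n),
      hom_sobolev p (spherical_maximal f) h G /\
      (hom_sobolev_norm p h G <= C'%:E * sobolev_norm p f Df)%E.
Proof.
move=> H p p_gt1 p_le p_ltn.
have n_gt0 : (0 < n)%N by exact: ltn_trans n_ge2.
have p_gt0 : 0 < p by exact: lt_trans p_gt1.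
have [C [C_gt0 HC]] := H p p_gt1 p_le p_ltn n n_gt0 id (@C1_on_sphere_id R n).
pose c := (n%:R * ball_volume R n)^-1.
have c_ge0 : 0 <= c by exact: inv_ball_volume_ge0.
(* The summand 1 makes the constant positive, [c] being known to be nonnegative. *)
exists (c * C + 1); split; first by rewrite ltr_wpDl// mulr_ge0// ltW.
move=> f Df fD.
have mF := measurable_signed_gradient fD.
have NF := Lnorm_signed_gradient p_gt1 fD.
have [_ [_ ND] _] := fD.
have [h [G [[hae /LfunE[mh Nh] [mG NG] hG] hC]]] := HC _ (conj mF (le_lt_trans NF ND)).
have q_gt0 : 0 < sobolev_conj n p.
  by rewrite divr_gt0 ?mulr_gt0 ?subr_gt0// ltr0n.
have Nch := Lnorm_scale q_gt0 c_ge0 mh.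
have NcG := Lnorm_vec_scale p_gt0 c_ge0 mG.
(* Representative and gradient of the singular maximal function of [sgn(f) Df], both scaled by
   [c]. *)
exists (fun z => c * h z), (fun z => c *: G z); split.
  split.
  - apply: filterS hae => x hx.
    by rewrite (spherical_maximal_singular n_gt0 p_gt1 p_ltn fD) hx.
  - apply/LfunE; split; first exact: measurable_funM.
    by rewrite Nch lte_mul_pinfty.
  - split; first exact: measurable_rVZ.
    by rewrite NcG lte_mul_pinfty.
  - exact: weak_gradient_scale.
have N0 (F : 'rV[R]_n -> 'rV[R]_n) : (0 <= Lnorm_vec p F)%E by exact: Lnorm_ge0.
rewrite /hom_sobolev_norm Nch NcG -ge0_muleDr//; last exact: Lnorm_ge0.
apply: (le_trans (lee_wpmul2l _ hC)); first by rewrite lee_fin.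
rewrite muleA -EFinM; apply: lee_pmul => //.
- by rewrite lee_fin mulr_ge0// ltW.
- by rewrite lee_fin lerDl.
- by rewrite (le_trans NF)// leeDr// Lnorm_ge0.
Qed.
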